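(* For each $j\in\{0,1,2,3\}$ let $D^{(j)}_1,D^{(j)}_3$ be the following differential operators. $(0)$ $$D^{(0)}_1=\theta_\lambda(\theta_\lambda+2\theta_\mu)-\lambda(2\theta_\lambda+5\theta_\mu+1)(2\theta_\lambda+5\theta_\mu+2),$$ $$D^{(0)}_3=\lambda^2(4\theta_\lambda^2-2\theta_\lambda\theta_\mu+5\theta_\mu^2)-8\lambda^3(1+3\theta_\lambda+5\theta_\mu+2\theta_\lambda^2+5\theta_\lambda\theta_\mu)+25\mu\theta_\lambda(\theta_\lambda-1).$$ $(1)$ $$D^{(1)}_1=\lambda\theta_\mu^2-\mu\theta_\lambda^2,$$ $$D^{(1)}_3=\tfrac{1}{27}\theta_\lambda^2+\lambda\Big(\tfrac29+\theta_\lambda+\theta_\mu+\theta_\lambda^2+2\theta_\lambda\theta_\mu+\theta_\mu^2\Big).$$ $(2)$ $$D^{(2)}_1=\lambda\theta_\mu^2+\mu\theta_\lambda(3\theta_\lambda+4\theta_\mu+1),$$ $$D^{(2)}_3=\lambda\theta_\lambda(3\theta_\lambda+2\theta_\mu)+\mu\theta_\lambda(1-\theta_\lambda)+9\lambda^2(3\theta_\lambda+4\theta_\mu+1)(3\theta_\lambda+4\theta_\mu+2).$$ $(3)$ $$D^{(3)}_1=\theta_\mu^2-\mu(3\theta_\lambda+2\theta_\mu+1)(3\theta_\lambda+2\theta_\mu+2),$$ $$D^{(3)}_3=\theta_\lambda(3\theta_\lambda-2\theta_\mu)+9\lambda(3\theta_\lambda+2\theta_\mu+1)(3\theta_\lambda+2\theta_\mu+2)+4\mu\theta_\lambda(3\theta_\lambda+2\theta_\mu+1).$$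 Then for each $j\in\{0,1,2,3\}$, $$D^{(j)}_1\eta_j(\lambda,\mu)=D^{(j)}_3\eta_j(\lambda,\mu)=0,$$ and the space of solutions of the system $D^{(j)}_1u=D^{(j)}_3u=0$ is $4$-dimensional.
   Context: $\theta_\lambda=\lambda\,\partial/\partial\lambda$, $\theta_\mu=\mu\,\partial/\partial\mu$; coefficient functions act by multiplication on the left. The space of solutions means the $\mathbb{C}$-vector space of germs of holomorphic solutions at a point outside the singular locus of the system. The functions $\eta_j$, holomorphic near $(\lambda,\mu)=(0,0)$, are the following period integrals (of the holomorphic $2$-form over a $2$-cycle on the $K3$ surfaces $S_0: xyz^2(x+y+z+1)+\lambda xyz+\mu=0$, $S_1: xyz(x+y+z+1)+\lambda x+\mu y=0$, $S_2: xyz(x+y+z+1)+\lambda x+\mu=0$, $S_3: xyz(x+y+z+1)+\lambda z+\mu xy=0$ respectively), given by the power series $$\eta_0=(2\pi i)^2\sum_{n,m=0}^\infty(-1)^m\frac{(5m+2n)!}{n!(m!)^3(2m+n)!}\lambda^n\mu^m,$$ $$\eta_1=(2\pi i)^2\sum_{n,m=0}^\infty(-1)^{m+n}\frac{(3n+3m)!}{(n!)^2(m!)^2(n+m)!}\lambda^n\mu^m,$$ $$\eta_2=(2\pi i)^2\sum_{n,m=0}^\infty(-1)^n\frac{(4m+3n)!}{(m!)^2n!((m+n)!)^2}\lambda^n\mu^m,$$ $$\eta_3=(2\pi i)^2\sum_{n,m=0}^\infty(-1)^n\frac{(3n+2m)!}{(n!)^3(m!)^2}\lambda^n\mu^m.$$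 *)

(* Defs.v *)
From mathcomp Require Import all_boot all_order all_algebra.
From mathcomp Require Import complex.
From mathcomp Require Import boolp classical_sets functions reals topology.
From mathcomp Require Import normedtype sequences derive trigo.
(* The notations of mpoly clash with those of MathComp-Analysis. *)
From mathcomp Require Import -(notations) mpoly.

Set Implicit Arguments.
Unset Strict Implicit.
Unset Printing Implicit Defensive.

Import Order.TTheory GRing.Theory Num.Theory.
Import numFieldNormedType.Exports.

Local Open Scope classical_set_scope.
Local Open Scope ring_scope.

Notation "{ 'mvpoly' A }" := (mpoly 2 A)
  (at level 0, format "{ 'mvpoly'  A }").

(* Packing R[i] as a numClosedFieldType makes the topology and the norm that
   MathComp-Analysis puts on every numFieldType available on it. *)
Definition Cx (R : realType) : numClosedFieldType := R[i].

Section TwoVariables.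
Variable R : realType.
Local Notation C := (Cx R).
Implicit Types (p z : C * C) (u v : C * C -> C).

Definition dsum (a : nat -> nat -> C) (s : C) : Prop :=
  (exists B : C, forall N, \sum_(n < N) \sum_(m < N) `|a n m| <= B) /\
  (fun N => \sum_(n < N) \sum_(m < N) a n m) @ \oo --> s.

(* Holomorphic at p: equal, on a neighbourhood of p, to the sum of an
   absolutely convergent power series centred at p. *)
Definition holomorphic_at p u : Prop :=
  exists a : nat -> nat -> C, \forall z \near p,
    dsum (fun n m => a n m * (z.1 - p.1) ^+ n * (z.2 - p.2) ^+ m) (u z).

(* The index ord0 : 'I_2 stands for lambda, ord_max : 'I_2 for mu. *)
Definition coord z (i : 'I_2) : C := if i == ord0 then z.1 else z.2.

(* A commutative polynomial P with coefficients in C[lambda, mu] encodes the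
   differential operator sum_m P_m(lambda, mu) d_0^(m_0) d_1^(m_1), with the
   coefficients on the left; (d_0, d_1) are either the Euler operators
   (theta_lambda, theta_mu) or the partial derivatives. *)
Definition diffop : nzRingType := {mvpoly {mvpoly C}}.

Definition act (V : nmodType) (mulc : {mvpoly C} -> V -> V)
    (d : 'I_2 -> V -> V) (P : diffop) (v : V) : V :=
  \sum_(m <- msupp P)
    mulc (mcoeff m P)
      (iter (m ord0) (d ord0) (iter (m ord_max) (d ord_max) v)).

Definition theta (i : 'I_2) u : C * C -> C := fun z =>
  if i == ord0 then z.1 * derive1 (fun t => u (t, z.2)) z.1
  else z.2 * derive1 (fun t => u (z.1, t)) z.2.

Definition theta_op (D : diffop) u : C * C -> C :=
  act (fun (c : {mvpoly C}) v => (fun z => meval (coord z) c * v z))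
    theta D u.

Definition solution (D1 D3 : diffop) p u : Prop :=
  holomorphic_at p u /\
  (\forall z \near p, theta_op D1 u z = 0 /\ theta_op D3 u z = 0).

(* The germs at p of the functions in S form a space with an n-element basis. *)
Definition germ_dim p (S : (C * C -> C) -> Prop) (n : nat) : Prop :=
  exists u : 'I_n -> C * C -> C,
    [/\ forall i, S (u i),
        forall c : 'I_n -> C,
          (\forall z \near p, \sum_(i < n) c i * u i z = 0) ->
          forall i, c i = 0
      & forall v, S v -> exists c : 'I_n -> C,
          \forall z \near p, v z = \sum_(i < n) c i * u i z].

(* The Weyl algebra acts faithfully on C[lambda, mu], so identities between its
   elements are tested on polynomials. *)
Definition poly_weyl (P : diffop) (f : {mvpoly C}) : {mvpoly C} :=
  act (fun c g : {mvpoly C} => c * g)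
    (fun i (g : {mvpoly C}) => mderiv i g) P f.

Definition poly_theta (D : diffop) (f : {mvpoly C}) : {mvpoly C} :=
  act (fun c g : {mvpoly C} => c * g)
    (fun i (g : {mvpoly C}) =>
       mpolyX C (mnm1 i) * mderiv i g) D f.

(* P, in partial-derivative form, is in the left ideal generated by D1 and D3,
   which are in Euler-operator form. *)
Definition left_ideal (D1 D3 P : diffop) : Prop :=
  exists A B : diffop, forall f : {mvpoly C},
    poly_weyl P f =
    poly_weyl A (poly_theta D1 f) + poly_weyl B (poly_theta D3 f).

(* The order-N symbol of P at the covector xi over p; it is the principal
   symbol when P has order N and 0 when P has smaller order. *)
Definition symbol (N : nat) (P : diffop) p (xi : C * C) : C :=
  \sum_(m <- msupp P | mdeg m == N)
    meval (coord p) (mcoeff m P)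
      * xi.1 ^+ (m ord0) * xi.2 ^+ (m ord_max).

Definition char_variety (D1 D3 : diffop) p (xi : C * C) : Prop :=
  forall (N : nat) (P : diffop), left_ideal D1 D3 P ->
    (forall m, m \in msupp P -> (mdeg m <= N)%N) ->
    symbol N P p xi = 0.

(* Projection to the base of the characteristic variety of the system, without
   the zero section. *)
Definition singular_locus (D1 D3 : diffop) : set (C * C) :=
  [set p | exists2 xi : C * C, xi != (0, 0) & char_variety D1 D3 p xi].

Definition solution_space_dim (D1 D3 : diffop) (n : nat) : Prop :=
  (exists p, ~ singular_locus D1 D3 p) /\
  (forall p, ~ singular_locus D1 D3 p -> germ_dim p (solution D1 D3 p) n).

Local Notation cst c := (mpolyC 2 (mpolyC 2 (c : C)) : diffop).
Local Notation lam :=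
  (mpolyC 2 (mpolyX C (mnm1 ord0)) : diffop).
Local Notation mu :=
  (mpolyC 2 (mpolyX C (mnm1 ord_max)) : diffop).
Local Notation tl := (mpolyX {mvpoly C} (mnm1 ord0) : diffop).
Local Notation tm := (mpolyX {mvpoly C} (mnm1 ord_max) : diffop).

Definition D1_0 : diffop :=
  tl * (tl + 2 * tm)
  - lam * (2 * tl + 5 * tm + 1) * (2 * tl + 5 * tm + 2).

Definition D3_0 : diffop :=
  lam ^+ 2 * (4 * tl ^+ 2 - 2 * tl * tm + 5 * tm ^+ 2)
  - 8 * lam ^+ 3 * (1 + 3 * tl + 5 * tm + 2 * tl ^+ 2 + 5 * tl * tm)
  + 25 * mu * tl * (tl - 1).

Definition D1_1 : diffop := lam * tm ^+ 2 - mu * tl ^+ 2.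

Definition D3_1 : diffop :=
  cst (1 / 27) * tl ^+ 2
  + lam * (cst (2 / 9) + tl + tm + tl ^+ 2 + 2 * tl * tm + tm ^+ 2).

Definition D1_2 : diffop :=
  lam * tm ^+ 2 + mu * tl * (3 * tl + 4 * tm + 1).

Definition D3_2 : diffop :=
  lam * tl * (3 * tl + 2 * tm) + mu * tl * (1 - tl)
  + 9 * lam ^+ 2 * (3 * tl + 4 * tm + 1) * (3 * tl + 4 * tm + 2).

Definition D1_3 : diffop :=
  tm ^+ 2 - mu * (3 * tl + 2 * tm + 1) * (3 * tl + 2 * tm + 2).

Definition D3_3 : diffop :=
  tl * (3 * tl - 2 * tm)
  + 9 * lam * (3 * tl + 2 * tm + 1) * (3 * tl + 2 * tm + 2)
  + 4 * mu * tl * (3 * tl + 2 * tm + 1).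

Definition D1 (j : 'I_4) : diffop := tnth [tuple D1_0; D1_1; D1_2; D1_3] j.
Definition D3 (j : 'I_4) : diffop := tnth [tuple D3_0; D3_1; D3_2; D3_3] j.

Definition coef_0 (n m : nat) : C :=
  (-1) ^+ m * ((5 * m + 2 * n)`!)%:R
  / (n`! * m`! ^ 3 * (2 * m + n)`!)%:R.

Definition coef_1 (n m : nat) : C :=
  (-1) ^+ (m + n) * ((3 * n + 3 * m)`!)%:R
  / (n`! ^ 2 * m`! ^ 2 * (n + m)`!)%:R.

Definition coef_2 (n m : nat) : C :=
  (-1) ^+ n * ((4 * m + 3 * n)`!)%:R
  / (m`! ^ 2 * n`! * (m + n)`! ^ 2)%:R.

Definition coef_3 (n m : nat) : C :=
  (-1) ^+ n * ((3 * n + 2 * m)`!)%:R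
  / (n`! ^ 3 * m`! ^ 2)%:R.

Definition coef (j : 'I_4) : nat -> nat -> C :=
  tnth [tuple coef_0; coef_1; coef_2; coef_3] j.

(* The limit has a junk value where the series diverges. *)
Definition eta (j : 'I_4) : C * C -> C := fun z =>
  (2 * (pi%:C)%C * 'i) ^+ 2
  * lim ((fun N => \sum_(n < N) \sum_(m < N)
                     coef j n m * z.1 ^+ n * z.2 ^+ m) @ \oo).

End TwoVariables.

(* Main.v *)
From mathcomp Require Import all_boot all_order all_algebra.
From mathcomp Require Import complex.
From mathcomp Require Import boolp classical_sets functions reals topology.
From mathcomp Require Import normedtype sequences derive trigo.
From mathcomp Require Import -(notations) mpoly.
From mathcomp Require Import zify ring lra.
Require Import Defs.

Set Implicit Arguments.
Unset Strict Implicit.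
Unset Printing Implicit Defensive.

Import Order.TTheory GRing.Theory Num.Theory.
Import numFieldNormedType.Exports.

Local Open Scope classical_set_scope.
Local Open Scope ring_scope.

(** Both claims are read off from formal power series. A germ at [p] is stored
as the array [A n m] of its partial derivatives at [p]; then [d/dlambda] and
[d/dmu] are the two shifts [dF], multiplication by a coordinate is [xF], and
holomorphic germs are the arrays with [growth r] for some [r > 0]. An identity
between polynomial differential operators holds on arrays once it holds on
polynomials ([compat_transfer]), because Taylor expansions of polynomials are
dense and each entry of the result depends on finitely many entries.

Convergence. Let [p] lie outside the singular locus. The symbols at [p] of the
operators of the left ideal generated by [D1] and [D3] have no common zero
[xi <> 0], so every monomial of some degree [K] in [xi] is such a symbol
([form_monomials], by the Euclidean algorithm for binary forms). The
corresponding operators express each derivative of order [n + K] through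
terms which are small near [p], and this forces every formal solution, at [p]
and at every point of a neighbourhood of [p], to converge in a polydisc whose
radius depends on [p] alone ([cauchy_estimate]). Hence germs of solutions are
formal solutions, and the solutions at [p] and at a nearby [q] are continuations
of each other, so that both spaces have the same dimension
([germ_dim_transport]).

Counting. It remains to count the formal solutions at one [q] close to [p], and
[q] may be taken off any given proper algebraic set ([mpoly_nonroot]). At a
generic [q] the leading forms of [D1] and [D3] are two quadratic forms without
common factor, and a formal solution is determined by [A 0 0], [A 1 0], [A 2 0]
and [A 0 1] ([formal_unique]): the quotient of the ring of polynomials in [xi]
by these forms has dimension 1 + 2 + 1. Existence needs the compatibility
condition of the overdetermined system. It is provided by operators [E1], [E3]
of order two with [E1 D3 = E3 D1] ([relation_0] to [relation_3]): if
[D1 A = 0] then [E1] kills [D3 A], so that [D3 A] vanishes as soon as its first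
two columns do. Only these columns have to be imposed, which leaves, up to each
degree, a linear system with as many equations as unknowns; it is injective by
the uniqueness statement, hence solvable ([formal_exists]). Genericity means
that one explicit polynomial, [generic2], does not vanish at [q], and for each
of the four systems its value at (1, 1) is nonzero.

Periods. Up to sign the coefficients of the four series are multinomial
coefficients of size at most 16 ^ (5 (n + m)), so the series converge near the
origin. Two consecutive coefficients have a rational quotient
([coef_0_lambda] and the lemmas after it), and the operators turn these
recurrences into the vanishing of all the coefficients of [D eta]. *)

(** * Modulus and limits of complex sequences *)

Section Modulus.
Variable R : realType.
Local Notation C := (Cx R).

(** The norm of [Cx R] takes its values in [Cx R] itself; estimates need a
modulus in the ordered field [R]. *)
Definition cabs (x : C) : R := ComplexField.Normc.normc (x : R[i]).

Lemma norm_cabs (x : C) : `|x| = ((cabs x)%:C)%C.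
Proof. by []. Qed.

Lemma cabs_ge0 x : 0 <= cabs x.
Proof. by rewrite /cabs; case: x => a b /=; exact: sqrtr_ge0. Qed.

Lemma cabsM x y : cabs (x * y) = cabs x * cabs y.
Proof. exact: ComplexField.Normc.normcM. Qed.

Lemma cabs0 : cabs 0 = 0.
Proof. exact: ComplexField.Normc.normc0. Qed.

Lemma cabs1 : cabs 1 = 1.
Proof. exact: ComplexField.Normc.normc1. Qed.

Lemma cabs_eq0 x : cabs x = 0 -> x = 0.
Proof. exact: ComplexField.Normc.eq0_normc. Qed.

Lemma cabs_gt0 x : x != 0 -> 0 < cabs x.
Proof.
by move=> x0; rewrite lt_def cabs_ge0 andbT; apply: contraNneq x0 => /cabs_eq0->.
Qed.

Lemma cabsD x y : cabs (x + y) <= cabs x + cabs y.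
Proof. exact: le_normcD. Qed.

Lemma cabsN x : cabs (- x) = cabs x.
Proof. exact: normcN. Qed.

Lemma cabsB x y : cabs (x - y) <= cabs x + cabs y.
Proof. by rewrite -(cabsN y) cabsD. Qed.

Lemma cabs_distC x y : cabs (x - y) = cabs (y - x).
Proof. by rewrite -cabsN opprB. Qed.

Lemma cabsX x n : cabs (x ^+ n) = cabs x ^+ n.
Proof. by elim: n => [|n IHn]; rewrite ?expr0 ?cabs1 // !exprS cabsM IHn. Qed.

Lemma cabsV x : cabs x^-1 = (cabs x)^-1.
Proof. exact: ComplexField.Normc.normcV. Qed.

Lemma cabs_real (a : R) : cabs ((a%:C)%C : C) = `|a|.
Proof. by rewrite /cabs /= expr0n /= addr0 sqrtr_sqr. Qed.

Lemma cabs_nat n : cabs n%:R = n%:R.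
Proof.
have -> : (n%:R : C) = ((n%:R : R)%:C)%C by rewrite rmorph_nat.
by rewrite cabs_real normr_nat.
Qed.

Lemma cabs_sum (I : Type) (s : seq I) (P : pred I) (F : I -> C) :
  cabs (\sum_(i <- s | P i) F i) <= \sum_(i <- s | P i) cabs (F i).
Proof.
elim/big_rec2: _ => [|i a b _ h]; first by rewrite cabs0.
by rewrite (le_trans (cabsD _ _)) // lerD2l.
Qed.

Lemma cabs_Re (x : C) : `|complex.Re x| <= cabs x.
Proof. by have := normc_ge_Re x; rewrite norm_cabs lecR. Qed.

Lemma cabs_ReIm (x : C) : cabs x <= `|complex.Re x| + `|complex.Im x|.
Proof.
rewrite [x in X in X <= _]complexE (le_trans (cabsD _ _)) // cabsM.
rewrite !cabs_real /cabs /= expr0n /= expr1n add0r sqrtr1 mul1r.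
by [].
Qed.

Lemma cabs_Im (x : C) : `|complex.Im x| <= cabs x.
Proof.
have -> : cabs x = cabs (x * ('i)%C).
  by rewrite cabsM [X in _ * X]/cabs /= expr0n /= expr1n add0r sqrtr1 mulr1.
by rewrite -normrN -ReiNIm cabs_Re.
Qed.

Lemma near_boxP (p : C * C) (P : C * C -> Prop) :
  (\forall z \near p, P z) <->
  exists2 r : R, 0 < r &
    forall z, cabs (z.1 - p.1) < r -> cabs (z.2 - p.2) < r -> P z.
Proof.
split.
  move=> /nbhs_ballP[e /= e0 H].
  have er : e = ((complex.Re e)%:C)%C by rewrite RRe_real // gtr0_real.
  exists (complex.Re e) => [|z h1 h2]; first by rewrite -ltcR -er.
  apply: H; split => /=; rewrite /ball /= distrC norm_cabs er ltcR //.
move=> [r r0 H]; apply/nbhs_ballP; exists (r%:C)%C => /=; first by rewrite ltcR.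
move=> z [/= h1 h2]; apply: H.
  by move: h1; rewrite /ball /= distrC norm_cabs ltcR.
by move: h2; rewrite /ball /= distrC norm_cabs ltcR.
Qed.

(** Convergence stated with real tolerances, so that [lra] applies. *)
Definition seq_cvg (f : nat -> C) (s : C) : Prop :=
  forall e : R, 0 < e -> exists N, forall n, (N <= n)%N -> cabs (f n - s) < e.

Lemma cvg_seqP (f : nat -> C) (s : C) : f @ \oo --> s <-> seq_cvg f s.
Proof.
split.
  move=> /cvgrPdist_lt H e e0.
  have /H : 0 < (e%:C)%C :> C by rewrite ltcR.
  case=> N _ HN; exists N => n /HN.
  by rewrite distrC norm_cabs ltcR.
move=> H; apply/cvgrPdist_lt => e e0.
have er : e = ((complex.Re e)%:C)%C by rewrite RRe_real // gtr0_real.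
have /H[N HN] : 0 < complex.Re e by rewrite -ltcR -er.
by exists N => // n /HN; rewrite distrC norm_cabs er ltcR.
Qed.

Lemma derive1_eps (f : C -> C) (x l : C) :
  (forall e : R, 0 < e -> exists2 d : R, 0 < d &
     forall h, h != 0 -> cabs h < d -> cabs (h^-1 * (f (x + h) - f x) - l) < e) ->
  derive1 f x = l.
Proof.
move=> H; rewrite /derive1; apply: (@cvg_lim C) => //.
apply/cvgrPdist_lt => e e0.
have er : e = ((complex.Re e)%:C)%C by rewrite RRe_real // gtr0_real.
have /H[d d0 Hd] : 0 < complex.Re e by rewrite -ltcR -er.
apply/nbhs_ballP; exists (d%:C)%C => /=; first by rewrite ltcR.
move=> h; rewrite /ball /= sub0r normrN norm_cabs ltcR => hd h0.
by rewrite distrC norm_cabs er ltcR [h + x]addrC; apply: Hd.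
Qed.

(** Completeness of [R], applied to the real and the imaginary parts. *)
Lemma cauchy_seq_cvg (f : nat -> C) :
  (forall e : R, 0 < e -> exists N, forall n, (N <= n)%N ->
     cabs (f n - f N) < e) ->
  exists s : C, seq_cvg f s.
Proof.
move=> H.
have real_cauchy (g : nat -> R) : (forall n m, `|g n - g m| <= cabs (f n - f m)) ->
    exists s, forall e, 0 < e -> exists N, forall n, (N <= n)%N -> `|g n - s| < e.
  move=> Hg.
  have /cauchy_cvgP /cvg_ex[s /= Hs] : cauchy (g @ \oo).
    apply: cauchy_exP => e e0; have [N HN] := H e e0.
    exists (g N); exists N => // n /= /HN; rewrite /ball /= distrC.
    exact: le_lt_trans (Hg _ _).
  exists s => e e0; move/cvgrPdist_lt: Hs => /(_ e e0)[N _ HN].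
  by exists N => n /HN; rewrite distrC.
have /real_cauchy[a Ha] n m : `|complex.Re (f n) - complex.Re (f m)| <= cabs (f n - f m).
  by have := cabs_Re (f n - f m); case: (f n) => ? ?; case: (f m).
have /real_cauchy[b Hb] n m : `|complex.Im (f n) - complex.Im (f m)| <= cabs (f n - f m).
  by have := cabs_Im (f n - f m); case: (f n) => ? ?; case: (f m).
exists (Complex a b) => e e0.
have e20 : 0 < e / 2 by rewrite divr_gt0.
have [N1 H1] := Ha _ e20; have [N2 H2] := Hb _ e20.
exists (maxn N1 N2) => n; rewrite geq_max => /andP[/H1 h1 /H2 h2].
rewrite (le_lt_trans (cabs_ReIm _)) // [e]splitr.
by move: h1 h2; case: (f n) => x y /= h1 h2; rewrite ltrD.
Qed.

Lemma cvg_seq_unique (f : nat -> C) (s t : C) :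
  seq_cvg f s -> seq_cvg f t -> s = t.
Proof. by move=> /cvg_seqP fs /cvg_seqP ft; apply: cvg_unique fs ft. Qed.

Lemma lim_seq (f : nat -> C) (s : C) : seq_cvg f s -> lim (f @ \oo) = s.
Proof. by move=> /cvg_seqP h; apply: cvg_lim. Qed.

Lemma seq_cvg_cst (c : C) : seq_cvg (fun=> c) c.
Proof.
by move=> e e0; exists 0%N => n _; rewrite subrr cabs0.
Qed.

Lemma seq_cvgD (f g : nat -> C) s t :
  seq_cvg f s -> seq_cvg g t -> seq_cvg (fun n => f n + g n) (s + t).
Proof.
move=> hf hg e e0.
have e2 : 0 < e / 2 by lra.
have [N1 H1] := hf _ e2; have [N2 H2] := hg _ e2.
exists (maxn N1 N2) => n; rewrite geq_max => /andP[/H1 h1 /H2 h2].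
have -> : f n + g n - (s + t) = (f n - s) + (g n - t) by rewrite opprD addrACA.
by rewrite (le_lt_trans (cabsD _ _)) // [e]splitr ltrD.
Qed.

Lemma seq_cvgZ (f : nat -> C) s (c : C) :
  seq_cvg f s -> seq_cvg (fun n => c * f n) (c * s).
Proof.
move=> hf e e0.
have c0 : 0 < cabs c + 1 by rewrite ltr_wpDl ?cabs_ge0.
have [N HN] := hf _ (divr_gt0 e0 c0); exists N => n /HN.
rewrite -mulrBr cabsM ltr_pdivlMr // => h; apply: le_lt_trans h.
by rewrite mulrC ler_wpM2l ?cabs_ge0 // lerDl.
Qed.

Lemma seq_cvg_sum (I : Type) (r : seq I) (F : nat -> I -> C) (G : I -> C) :
  (forall i, seq_cvg (F^~ i) (G i)) ->
  seq_cvg (fun n => \sum_(i <- r) F n i) (\sum_(i <- r) G i).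
Proof.
move=> FG; elim: r => [|i r IH].
  by under [X in seq_cvg X]eq_fun do rewrite big_nil; rewrite big_nil; apply: seq_cvg_cst.
under [X in seq_cvg X]eq_fun do rewrite big_cons.
rewrite big_cons; exact: seq_cvgD (FG i) IH.
Qed.

Lemma cabs_lim_le (f : nat -> C) (s : C) (N0 : nat) (B : R) (c : C) :
  seq_cvg f s -> (forall n, (N0 <= n)%N -> cabs (f n - c) <= B) ->
  cabs (s - c) <= B.
Proof.
move=> H HB; rewrite leNgt; apply/negP => lt_B.
have [|N HN] := H (cabs (s - c) - B); first by rewrite subr_gt0.
have h1 := HN _ (leq_maxl N N0); have h2 := HB _ (leq_maxr N N0).
have := cabsD (s - f (maxn N N0)) (f (maxn N N0) - c).
rewrite addrA subrK => h3; rewrite cabs_distC in h1; lra.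
Qed.
End Modulus.
Arguments cabs {R} x : simpl never.

(** * Double series with a geometric majorant *)

Section DoubleSeries.
Variable R : realType.
Local Notation C := (Cx R).
Implicit Types (t A : nat -> nat -> C) (B x : R) (w : C * C).

Definition rect_sum t (N M : nat) : C := \sum_(n < N) \sum_(m < M) t n m.

Definition geo_dominated t B x := forall n m, cabs (t n m) <= B * x ^+ (n + m).

Lemma geo_sum_le x N : 0 <= x < 1 -> \sum_(n < N) x ^+ n <= (1 - x)^-1.
Proof.
move=> /andP[x0 x1]; rewrite -[leRHS]mul1r ler_pdivlMr ?subr_gt0 //.
elim: N => [|N IH]; first by rewrite big_ord0 mul0r.
have -> : (\sum_(n < N.+1) x ^+ n) * (1 - x) = 1 - x ^+ N.+1.
  elim: N {IH} => [|N IH]; first by rewrite big_ord1 expr0 mul1r expr1.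
  by rewrite big_ord_recr /= mulrDl IH mulrBr mulr1 -exprSr; lra.
by rewrite gerBl exprn_ge0.
Qed.

Lemma geo_tail_le x N M : 0 <= x < 1 -> (N <= M)%N ->
  \sum_(N <= n < M) x ^+ n <= x ^+ N * (1 - x)^-1.
Proof.
move=> x01 NM; rewrite -{1}[N]add0n big_addn.
under eq_bigr do rewrite exprD.
rewrite -mulr_suml mulrC ler_wpM2l ?exprn_ge0 //; first by case/andP: x01.
by rewrite big_mkord; apply: geo_sum_le.
Qed.

Lemma expr_small x e : 0 <= x < 1 -> 0 < e ->
  exists N, forall n, (N <= n)%N -> x ^+ n < e.
Proof.
move=> /andP[x0 x1] e0.
have /cvg_expr/cvgrPdist_lt/(_ _ e0)[N _ HN] : `|x| < 1 by rewrite ger0_norm.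
exists N => n /HN; rewrite sub0r normrN ger0_norm //; exact: exprn_ge0.
Qed.

Lemma rect_sum_exchange t N M :
  rect_sum t N M = rect_sum (fun n m => t m n) M N.
Proof. exact: exchange_big. Qed.

Lemma geo_dominated_ge0 t B x : geo_dominated t B x -> 0 <= B.
Proof. by move=> /(_ 0 0)%N; rewrite expr0 mulr1; apply/le_trans/cabs_ge0. Qed.

(** Square partial sums, unlike iterated ones, are compared by adding first rows
and then columns; a geometric majorant controls each step. *)
Lemma rect_sum_rows t B x N N' M : 0 <= x < 1 -> geo_dominated t B x ->
  (N <= N')%N ->
  cabs (rect_sum t N' M - rect_sum t N M) <= B * (x ^+ N / (1 - x) ^+ 2).
Proof.
move=> x01 tB NN'; have B0 := geo_dominated_ge0 tB.
have x0 : 0 <= x by case/andP: x01.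
have -> : rect_sum t N' M - rect_sum t N M =
    \sum_(N <= n < N') \sum_(m < M) t n m.
  rewrite /rect_sum -!(big_mkord xpredT (fun n => \sum_(m < M) t n m)).
  rewrite [X in X - _](big_cat_nat (n := N)) //=.
  by rewrite [LHS]addrAC subrr add0r.
apply: le_trans (cabs_sum _ _ _) _.
apply: (@le_trans _ _ (\sum_(N <= n < N') B * (x ^+ n * (1 - x)^-1))).
  apply: ler_sum => n _; apply: le_trans (cabs_sum _ _ _) _.
  apply: (@le_trans _ _ (\sum_(m < M) B * x ^+ n * x ^+ m)).
    by apply: ler_sum => m _; rewrite -mulrA -exprD.
  rewrite -mulr_sumr -mulrA ler_wpM2l // ler_wpM2l ?exprn_ge0 //.
  exact: geo_sum_le.
rewrite -mulr_sumr ler_wpM2l // -mulr_suml expr2 invfM mulrA.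
by rewrite ler_wpM2r ?invr_ge0 ?subr_ge0 ?geo_tail_le //; case/andP: x01 => ? /ltW.
Qed.

(** Adding the missing rows and the missing columns contributes one copy each. *)
Definition geo_tail B x N : R := B * (x ^+ N / (1 - x) ^+ 2) *+ 2.

Lemma rect_sum_tail t B x N N1 N2 : 0 <= x < 1 -> geo_dominated t B x ->
  (N <= N1)%N -> (N <= N2)%N ->
  cabs (rect_sum t N1 N2 - rect_sum t N N) <= geo_tail B x N.
Proof.
move=> x01 tB h1 h2; rewrite -(subrK (rect_sum t N N2) (rect_sum t N1 N2)) -addrA.
apply: le_trans (cabsD _ _) _; rewrite /geo_tail mulr2n lerD //.
  exact: rect_sum_rows.
rewrite rect_sum_exchange (rect_sum_exchange t N N); apply: rect_sum_rows => //.
by move=> n m; rewrite addnC.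
Qed.

Lemma geo_tail_small B x e : 0 <= x < 1 -> 0 < e ->
  exists N, forall n, (N <= n)%N -> geo_tail B x n < e.
Proof.
move=> x01 e0; pose K := `|B| * ((1 - x) ^- 2) *+ 2 + 1.
have x10 : 0 < 1 - x by case/andP: x01; rewrite subr_gt0.
have K0 : 0 < K.
  by rewrite ltr_wpDl // mulrn_wge0 // mulr_ge0 // invr_ge0 exprn_ge0 // ltW.
have [N HN] := expr_small x01 (divr_gt0 e0 K0).
exists N => n /HN; rewrite ltr_pdivlMr // => h.
apply: le_lt_trans h; rewrite /geo_tail mulrCA -mulrnAr ler_wpM2l ?exprn_ge0 //.
  by case/andP: x01.
rewrite /K -[leLHS]addr0 lerD // lerMn2r /= ler_wpM2r ?ler_norm //.
by rewrite invr_ge0 exprn_ge0 // ltW.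
Qed.

Lemma rect_sum_cvg t B x : 0 <= x < 1 -> geo_dominated t B x ->
  exists s : C, seq_cvg (fun N => rect_sum t N N) s.
Proof.
move=> x01 tB; apply: cauchy_seq_cvg => e e0.
have [N HN] := geo_tail_small B x01 e0; exists N => n Nn.
by apply: le_lt_trans (HN _ (leqnn _)); apply: rect_sum_tail.
Qed.

Lemma rect_sum_cvg_tail t B x s N N1 N2 : 0 <= x < 1 -> geo_dominated t B x ->
  seq_cvg (fun N => rect_sum t N N) s -> (N <= N1)%N -> (N <= N2)%N ->
  cabs (s - rect_sum t N1 N2) <= geo_tail B x N *+ 2.
Proof.
move=> x01 tB ts h1 h2; rewrite -(subrK (rect_sum t N N) s) -addrA mulr2n.
apply: le_trans (cabsD _ _) _; apply: lerD; last first.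
  by rewrite cabs_distC; apply: rect_sum_tail.
by apply: (cabs_lim_le (N0 := N)) ts _ => n hn; apply: rect_sum_tail.
Qed.

(** Dominated convergence for double series (Tannery): beyond a fixed square the
terms are uniformly small, and on that square convergence is finite. *)
Lemma tannery (T : nat -> nat -> nat -> C) t B x s : 0 <= x < 1 ->
  (forall N, geo_dominated (T N) B x) ->
  (forall n m, seq_cvg (fun N => T N n m) (t n m)) ->
  seq_cvg (fun N => rect_sum t N N) s ->
  seq_cvg (fun N => rect_sum (T N) N N) s.
Proof.
move=> x01 TB Tt ts; have tB : geo_dominated t B x.
  move=> n m; rewrite -[t n m]subr0.
  by apply: (cabs_lim_le (N0 := 0)) (Tt n m) _ => N _; rewrite subr0; apply: TB.
move=> e e0; have e4 : 0 < e / 4 by lra.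
have [M HM] := geo_tail_small B x01 e4.
have [K HK] : exists K, forall N, (K <= N)%N ->
    cabs (rect_sum (T N) M M - rect_sum t M M) < e / 4.
  suff : seq_cvg (fun N => rect_sum (T N) M M) (rect_sum t M M).
    by move=> /(_ _ e4).
  apply: seq_cvg_sum => n; apply: seq_cvg_sum => m; exact: Tt.
exists (maxn M K) => N; rewrite geq_max => /andP[MN KN].
have h1 := rect_sum_tail x01 (TB N) MN MN.
have h2 := HK _ KN.
have h3 := rect_sum_cvg_tail x01 tB ts (leqnn M) (leqnn M).
have h4 := HM _ (leqnn M).
have -> : rect_sum (T N) N N - s = (rect_sum (T N) N N - rect_sum (T N) M M) +
  ((rect_sum (T N) M M - rect_sum t M M) + - (s - rect_sum t M M)).
  by rewrite opprB !addrA !subrK.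
have h5 := cabsD (rect_sum (T N) N N - rect_sum (T N) M M)
  ((rect_sum (T N) M M - rect_sum t M M) + - (s - rect_sum t M M)).
have h6 := cabsB (rect_sum (T N) M M - rect_sum t M M) (s - rect_sum t M M).
rewrite mulr2n in h3; lra.
Qed.

Lemma dsum_geo t B x : 0 <= x < 1 -> geo_dominated t B x ->
  dsum t (lim ((fun N => rect_sum t N N) @ \oo)).
Proof.
move=> x01 tB; split; last first.
  by have [s hs] := rect_sum_cvg x01 tB; rewrite (lim_seq hs); apply/cvg_seqP.
exists ((B * (1 - x)^-1 * (1 - x)^-1)%:C)%C => N.
have x0 : 0 <= x by case/andP: x01.
have B0 := geo_dominated_ge0 tB.
have -> : \sum_(n < N) \sum_(m < N) `|t n m| =
   ((\sum_(n < N) \sum_(m < N) cabs (t n m))%:C)%C.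
  rewrite rmorph_sum; apply: eq_bigr => n _; rewrite rmorph_sum.
  by apply: eq_bigr => m _; rewrite norm_cabs.
rewrite lecR; apply: (@le_trans _ _ (\sum_(n < N) B * x ^+ n * (1 - x)^-1)).
  apply: ler_sum => n _.
  apply: (@le_trans _ _ (\sum_(m < N) B * x ^+ n * x ^+ m)).
    by apply: ler_sum => m _; rewrite -mulrA -exprD.
  by rewrite -mulr_sumr ler_wpM2l ?geo_sum_le // mulr_ge0 // exprn_ge0.
rewrite -mulr_suml -mulr_sumr ler_wpM2r //.
  by rewrite invr_ge0 subr_ge0; case/andP: x01 => _ /ltW.
by rewrite ler_wpM2l // geo_sum_le.
Qed.

End DoubleSeries.

(** * Power series in two variables and their reexpansion *)

Section PowerSeries.
Variable R : realType.
Local Notation C := (Cx R).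
Implicit Types (A : nat -> nat -> C) (B r s : R) (w d : C * C).

(** With divided powers the coefficient of index [(n, m)] is the derivative of
order [(n, m)], which makes derivations shifts of the coefficients. *)
Definition dpow (n : nat) (x : C) : C := x ^+ n / n`!%:R.

Definition psterm A w n m : C := A n m * dpow n w.1 * dpow m w.2.

Definition psum A w : C := lim ((fun N => rect_sum (psterm A w) N N) @ \oo).

(** Cauchy's inequalities on the polydisc of radius [r]. *)
Definition coef_bound A B r :=
  forall n m, cabs (A n m) * r ^+ (n + m) <= B * (n`! * m`!)%:R.

Lemma coef_bound_ge0 A B r : coef_bound A B r -> 0 <= B.
Proof.
by move=> /(_ 0 0)%N; rewrite expr0 mulr1 fact0 mulr1; apply/le_trans/cabs_ge0.
Qed.

(** The inequalities hold on all smaller polydiscs, a condition that is stable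
under derivation while [coef_bound] is not. *)
Definition growth r A := forall s, 0 < s < r -> exists B, coef_bound A B s.

Lemma factC_neq0 n : (n`!%:R : C) != 0.
Proof. by rewrite pnatr_eq0 -lt0n fact_gt0. Qed.

Lemma factR_gt0 n : (0 : R) < n`!%:R.
Proof. by rewrite ltr0n fact_gt0. Qed.

Lemma cabs_dpow n x : cabs (dpow n x) = cabs x ^+ n / n`!%:R.
Proof. by rewrite /dpow cabsM cabsX cabsV cabs_nat. Qed.

Lemma psterm_dominated A B s t w : 0 < s -> 0 <= t -> coef_bound A B s ->
  cabs w.1 <= t -> cabs w.2 <= t -> geo_dominated (psterm A w) B (t / s).
Proof.
move=> s0 t0 AB w1 w2 n m; rewrite /psterm 2!cabsM !cabs_dpow.
rewrite expr_div_n [leRHS]mulrA ler_pdivlMr ?exprn_gt0 //.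
have -> : cabs (A n m) * (cabs w.1 ^+ n / n`!%:R) * (cabs w.2 ^+ m / m`!%:R) *
  s ^+ (n + m) = (cabs (A n m) * s ^+ (n + m)) / (n`! * m`!)%:R *
  (cabs w.1 ^+ n * cabs w.2 ^+ m).
  rewrite natrM; field; rewrite !gt_eqF ?factR_gt0 //.
apply: ler_pM.
- by rewrite divr_ge0 // mulr_ge0 ?cabs_ge0 // exprn_ge0 // ltW.
- by rewrite mulr_ge0 // exprn_ge0 // cabs_ge0.
- by rewrite ler_pdivrMr ?AB // ltr0n muln_gt0 !fact_gt0.
by rewrite exprD ler_pM ?exprn_ge0 ?cabs_ge0 // lerXn2r ?nnegrE ?cabs_ge0.
Qed.

Lemma box_radius w r : cabs w.1 < r -> cabs w.2 < r ->
  exists t, [/\ 0 <= t, t < r, cabs w.1 <= t & cabs w.2 <= t].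
Proof.
move=> w1 w2; exists (Num.max (cabs w.1) (cabs w.2)).
by rewrite gt_max w1 w2 !le_max cabs_ge0 !lexx orbT.
Qed.

Lemma growth_dominated A r w : growth r A -> cabs w.1 < r -> cabs w.2 < r ->
  exists B x, 0 <= x < 1 /\ geo_dominated (psterm A w) B x.
Proof.
move=> gA w1 w2; have [t [t0 tr w1t w2t]] := box_radius w1 w2.
have [|B AB] := gA ((t + r) / 2); first by apply/andP; split; lra.
exists B, (t / ((t + r) / 2)); split.
  have q0 : 0 < (t + r) / 2 by lra.
  by apply/andP; split; [rewrite divr_ge0 // ltW | rewrite ltr_pdivrMr //; lra].
by apply: psterm_dominated AB _ _ => //; lra.
Qed.

Lemma psum_cvg A r w : growth r A -> cabs w.1 < r -> cabs w.2 < r ->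
  seq_cvg (fun N => rect_sum (psterm A w) N N) (psum A w).
Proof.
move=> gA w1 w2; have [B [x [x01 h]]] := growth_dominated gA w1 w2.
by have [s hs] := rect_sum_cvg x01 h; rewrite /psum (lim_seq hs).
Qed.

Lemma psum_eq A r w (s : C) : growth r A -> cabs w.1 < r -> cabs w.2 < r ->
  seq_cvg (fun N => rect_sum (psterm A w) N N) s -> psum A w = s.
Proof. by move=> gA w1 w2; apply: cvg_seq_unique (psum_cvg gA w1 w2). Qed.

Lemma psum_dsum A r w : growth r A -> cabs w.1 < r -> cabs w.2 < r ->
  dsum (psterm A w) (psum A w).
Proof.
move=> gA w1 w2; have [B [x [x01 h]]] := growth_dominated gA w1 w2.
exact: dsum_geo x01 h.
Qed.

Lemma growth_le r r' A : r' <= r -> growth r A -> growth r' A.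
Proof.
by move=> h gA s /andP[s0 sr]; apply: gA; rewrite s0 (lt_le_trans sr).
Qed.

Lemma sum_ord_shift (F : nat -> C) k N : (forall n, (n < k)%N -> F n = 0) ->
  \sum_(n < N) F n = \sum_(n < N - k) F (n + k)%N.
Proof.
move=> F0; have [kN|Nk] := leqP k N.
  have [M ->] : exists M, N = (k + M)%N by exists (N - k)%N; rewrite subnKC.
  rewrite addKn big_split_ord /= big1 ?add0r; last first.
    by move=> i _; apply: F0.
  by apply: eq_bigr => i _; rewrite addnC.
have /eqP-> : (N - k == 0)%N by rewrite subn_eq0 ltnW.
by rewrite big_ord0 big1 // => i _; apply: F0; rewrite (ltn_trans _ Nk).
Qed.

Definition dpow_shift n k x : C := if (k <= n)%N then dpow (n - k) x else 0.

Lemma dpowD n N x y : (n < N)%N ->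
  dpow n (x + y) = \sum_(k < N) dpow_shift n k x * dpow k y.
Proof.
move=> nN; have [M ->] : exists M, N = (n.+1 + M)%N.
  by exists (N - n.+1)%N; rewrite subnKC.
rewrite big_split_ord /= [X in _ = _ + X]big1 ?addr0; last first.
  by move=> i _; rewrite /dpow_shift leqNgt leq_addr /= mul0r.
rewrite /dpow exprDn mulr_suml; apply: eq_bigr => -[i /= i_n] _.
rewrite /dpow_shift -ltnS i_n -(bin_fact (m := i)) // /dpow.
by rewrite !natrM -mulr_natr; field; rewrite !factC_neq0 pnatr_eq0 -lt0n bin_gt0.
Qed.

Lemma bin_expr_le n k (a b : R) : 0 <= a -> 0 <= b -> (k <= n)%N ->
  'C(n, k)%:R * a ^+ (n - k) * b ^+ k <= (a + b) ^+ n.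
Proof.
move=> a0 b0 kn; rewrite exprDn (bigD1 (Ordinal (kn : (k < n.+1)%N))) //=.
rewrite -mulrA mulr_natl lerDl sumr_ge0 // => i _.
by rewrite mulrn_wge0 // mulr_ge0 ?exprn_ge0.
Qed.

(** One term of the binomial expansion of [(e + s) ^ n]: this is why a series
with radius [r] reexpanded at distance [e] has radius [r - e]. *)
Lemma dpow_shift_le n k x (e s : R) : cabs x <= e -> 0 <= s ->
  n`!%:R * cabs (dpow_shift n k x) * s ^+ k <= k`!%:R * (e + s) ^+ n.
Proof.
move=> xe s0; have e0 := le_trans (cabs_ge0 x) xe.
rewrite /dpow_shift; case: leqP => kn; last first.
  by rewrite cabs0 mulr0 mul0r mulr_ge0 // exprn_ge0 // addr_ge0.
rewrite cabs_dpow -(bin_fact kn) !natrM.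
have -> : 'C(n, k)%:R * (k`!%:R * (n - k)`!%:R) *
  (cabs x ^+ (n - k) / (n - k)`!%:R) * s ^+ k =
  k`!%:R * ('C(n, k)%:R * cabs x ^+ (n - k) * s ^+ k) :> R.
  by field; rewrite gt_eqF ?factR_gt0.
rewrite ler_wpM2l ?(ltW (factR_gt0 _)) //.
apply: le_trans (bin_expr_le e0 s0 kn); rewrite ler_wpM2r ?exprn_ge0 //.
by rewrite ler_wpM2l // lerXn2r ?nnegrE ?cabs_ge0.
Qed.

Definition shift2 k l A n m := A (n + k)%N (m + l)%N.

Definition recenter A d k l : C := psum (shift2 k l A) d.

(** Derivatives at [d] of the polynomial obtained by truncating the series; the
reexpansion at [d] is exact for it, and passes to the limit by [tannery]. *)
Definition recenter_part A d N k l : C :=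
  \sum_(n < N) \sum_(m < N) A n m * dpow_shift n k d.1 * dpow_shift m l d.2.

Lemma recenter_partE A d N k l :
  recenter_part A d N k l = rect_sum (psterm (shift2 k l A) d) (N - k) (N - l).
Proof.
rewrite /recenter_part (sum_ord_shift (k := k)
  (F := fun n => \sum_(m < N) A n m * dpow_shift n k d.1 * dpow_shift m l d.2)).
  apply: eq_bigr => n _; rewrite (sum_ord_shift (k := l)
    (F := fun m => A (n + k)%N m * dpow_shift (n + k)%N k d.1 * dpow_shift m l d.2)).
    by apply: eq_bigr => m _; rewrite /dpow_shift !leq_addl !addnK.
  by move=> m ml; rewrite {2}/dpow_shift leqNgt ml mulr0.
move=> n nk; rewrite big1 // => m _.
by rewrite {1}/dpow_shift leqNgt nk mulr0 mul0r.
Qed.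

Lemma recenter_part_sum A d w N :
  rect_sum (psterm A (d.1 + w.1, d.2 + w.2)) N N =
  rect_sum (psterm (recenter_part A d N) w) N N.
Proof.
transitivity (\sum_(n < N) \sum_(m < N) \sum_(k < N) \sum_(l < N)
   A n m * dpow_shift n k d.1 * dpow_shift m l d.2 * dpow k w.1 * dpow l w.2).
  apply: eq_bigr => n _; apply: eq_bigr => m _; rewrite /psterm /=.
  rewrite (dpowD _ _ (ltn_ord n)) (dpowD _ _ (ltn_ord m)) [A n m * _]mulr_sumr mulr_suml.
  apply: eq_bigr => k _; rewrite mulr_sumr; apply: eq_bigr => l _.
  by ring.
under eq_bigr do rewrite exchange_big /=.
rewrite exchange_big /=; apply: eq_bigr => k _.
under eq_bigr do rewrite exchange_big /=.
rewrite exchange_big /=; apply: eq_bigr => l _.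
rewrite /psterm /recenter_part !mulr_suml; apply: eq_bigr => n _.
by rewrite !mulr_suml.
Qed.

Lemma recenter_part_bound A B (e s r : R) d N : 0 <= e -> 0 < s -> e + s < r ->
  coef_bound A B r -> cabs d.1 <= e -> cabs d.2 <= e ->
  coef_bound (recenter_part A d N) (B / (1 - (e + s) / r) ^+ 2) s.
Proof.
move=> e0 s0 esr AB d1 d2 k l; set y := (e + s) / r.
have r0 : 0 < r by lra.
have y01 : 0 <= y < 1.
  by rewrite /y divr_ge0 /= ?ltr_pdivrMr //; lra.
have B0 := coef_bound_ge0 AB.
apply: (@le_trans _ _ (\sum_(n < N) \sum_(m < N)
    (B * (k`! * l`!)%:R) * (y ^+ n * y ^+ m))); last first.
  under eq_bigr do rewrite -mulr_sumr -mulr_sumr mulrA.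
  rewrite -mulr_suml -mulr_sumr expr2 invfM.
  have -> : B * ((1 - y)^-1 * (1 - y)^-1) * (k`! * l`!)%:R =
    B * (k`! * l`!)%:R * (1 - y)^-1 * (1 - y)^-1 by ring.
  rewrite ler_pM ?geo_sum_le //.
  - by rewrite !mulr_ge0 // sumr_ge0 // => i _; rewrite exprn_ge0 //; case/andP: y01.
  - by rewrite sumr_ge0 // => i _; rewrite exprn_ge0 //; case/andP: y01.
  by rewrite ler_wpM2l ?geo_sum_le // mulr_ge0.
have sX : 0 <= s ^+ (k + l) by rewrite exprn_ge0 // ltW.
apply: le_trans (ler_wpM2r sX (cabs_sum _ _ _)) _; rewrite mulr_suml.
apply: ler_sum => n _.
apply: le_trans (ler_wpM2r sX (cabs_sum _ _ _)) _; rewrite mulr_suml.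
apply: ler_sum => m _.
rewrite !cabsM.
have hA := AB n m; have hn := dpow_shift_le n k d1 (ltW s0).
have hm := dpow_shift_le m l d2 (ltW s0).
set gn := cabs (dpow_shift n k _) in hn *; set gm := cabs (dpow_shift m l _) in hm *.
have gn0 : 0 <= gn by apply: cabs_ge0.
have gm0 : 0 <= gm by apply: cabs_ge0.
have -> : cabs (A n m) * gn * gm * s ^+ (k + l) =
  (cabs (A n m) * r ^+ (n + m)) / (n`! * m`!)%:R *
  ((n`!%:R * gn * s ^+ k) / r ^+ n * ((m`!%:R * gm * s ^+ l) / r ^+ m)).
  rewrite natrM !exprD; field.
  by rewrite !gt_eqF ?factR_gt0 ?exprn_gt0.
rewrite -[leRHS]mulrA; apply: ler_pM.
- by rewrite divr_ge0 // mulr_ge0 ?cabs_ge0 // exprn_ge0 // ltW.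
- by apply: mulr_ge0; apply: divr_ge0; rewrite ?exprn_ge0 ?(ltW r0) // !mulr_ge0 ?exprn_ge0 // ltW.
- by rewrite ler_pdivrMr ?AB // ltr0n muln_gt0 !fact_gt0.
have -> : (k`! * l`!)%:R * (y ^+ n * y ^+ m) =
  (k`!%:R * (e + s) ^+ n / r ^+ n) * (l`!%:R * (e + s) ^+ m / r ^+ m).
  by rewrite /y !expr_div_n natrM; field; rewrite !gt_eqF ?exprn_gt0.
have rX i : 0 <= (r ^+ i)^-1 by rewrite invr_ge0 exprn_ge0 // ltW.
have sX' i : 0 <= s ^+ i by rewrite exprn_ge0 // ltW.
apply: ler_pM.
- by do 3!apply: mulr_ge0 => //.
- by do 3!apply: mulr_ge0 => //.
- exact: (ler_wpM2r (rX n) hn).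
- exact: (ler_wpM2r (rX m) hm).
Qed.

Lemma growth_shift2 r A k l : growth r A -> growth r (shift2 k l A).
Proof.
move=> gA s /andP[s0 sr].
have [|B AB] := gA ((s + r) / 2); first by apply/andP; split; lra.
have B0 := coef_bound_ge0 AB.
(* The loss of radius from s + e to s pays for the factorials of the shift. *)
pose e := (r - s) / 2; have e0 : 0 < e by rewrite /e; lra.
have re : (s + r) / 2 = s + e by rewrite /e; lra.
rewrite re in AB.
have fact_le n i : (n + i)`!%:R * s ^+ n <= n`!%:R * (i`!%:R / e ^+ i) * (s + e) ^+ (n + i).
  rewrite -(bin_fact (leq_addl n i)) addnK !natrM.
  have -> : 'C(n + i, i)%:R * (i`!%:R * n`!%:R) * s ^+ n =
    n`!%:R * (i`!%:R / e ^+ i) * ('C(n + i, i)%:R * s ^+ n * e ^+ i).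
    by field; rewrite gt_eqF ?exprn_gt0.
  have c0 : 0 <= n`!%:R * (i`!%:R / e ^+ i) :> R.
    by rewrite !mulr_ge0 // invr_ge0 exprn_ge0 // ltW.
  have := bin_expr_le (ltW s0) (ltW e0) (leq_addl n i); rewrite addnK => h.
  exact: (ler_wpM2l c0 h).
exists (B * (k`!%:R / e ^+ k) * (l`!%:R / e ^+ l)) => n m.
have se0 : 0 < s + e by rewrite addr_gt0.
have -> : cabs (shift2 k l A n m) * s ^+ (n + m) =
  (cabs (A (n + k)%N (m + l)%N) * (s + e) ^+ (n + k + (m + l))) / ((n + k)`! * (m + l)`!)%:R *
  (((n + k)`!%:R * s ^+ n) / (s + e) ^+ (n + k) * (((m + l)`!%:R * s ^+ m) / (s + e) ^+ (m + l))).
  rewrite natrM !exprD /shift2; field.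
  by rewrite !gt_eqF ?factR_gt0 ?exprn_gt0.
rewrite [leRHS](_ : _ = B * ((n`!%:R * (k`!%:R / e ^+ k)) *
  (m`!%:R * (l`!%:R / e ^+ l)))); last by rewrite natrM; ring.
have pos a b : 0 <= a`!%:R * s ^+ b / (s + e) ^+ (a) :> R.
  by rewrite divr_ge0 ?mulr_ge0 ?exprn_ge0 // ltW.
apply: ler_pM.
- by rewrite divr_ge0 // mulr_ge0 ?cabs_ge0 // exprn_ge0 // ltW.
- exact: mulr_ge0.
- by rewrite ler_pdivrMr ?AB // ltr0n muln_gt0 !fact_gt0.
apply: ler_pM => //.
- by rewrite ler_pdivrMr ?exprn_gt0 // fact_le.
by rewrite ler_pdivrMr ?exprn_gt0 // fact_le.
Qed.

(** The bound and the sum are obtained together, since the bound on the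
truncations is the domination that [tannery] asks for. *)
Lemma growth_recenter_aux A r (e s : R) d w : growth r A -> 0 <= e -> 0 < s ->
  e + s < r -> cabs d.1 <= e -> cabs d.2 <= e ->
  exists B, (coef_bound (recenter A d) B s) /\ (cabs w.1 < s -> cabs w.2 < s ->
    seq_cvg (fun N => rect_sum (psterm (recenter A d) w) N N)
      (psum A (d.1 + w.1, d.2 + w.2))).
Proof.
move=> gA e0 s0 esr d1 d2.
have [|B AB] := gA ((e + s + r) / 2); first by apply/andP; split; lra.
have er : e < r by lra.
set r' := _ / 2 in AB.
have esr' : e + s < r' by rewrite /r'; lra.
set B' := B / (1 - (e + s) / r') ^+ 2.
have part_cvg k l : seq_cvg (fun N => recenter_part A d N k l) (recenter A d k l).
  have gS := growth_shift2 k l gA.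
  have [D [x [x01 tD]]] := growth_dominated gS (le_lt_trans d1 er) (le_lt_trans d2 er).
  have cS := psum_cvg gS (le_lt_trans d1 er) (le_lt_trans d2 er).
  move=> e1 e10; have [M HM] := geo_tail_small (D *+ 2) x01 e10.
  exists (M + (k + l))%N => N hN; rewrite cabs_distC recenter_partE.
  apply: le_lt_trans (HM _ (leqnn _)).
  have h1 : (M <= N - k)%N by lia.
  have h2 : (M <= N - l)%N by lia.
  apply: le_trans (rect_sum_cvg_tail x01 tD cS h1 h2) _.
  by rewrite /geo_tail mulrnAl.
have part_bound N := recenter_part_bound N e0 s0 esr' AB d1 d2.
have bound : coef_bound (recenter A d) B' s.
  move=> k l; rewrite -ler_pdivlMr ?exprn_gt0 // -[recenter A d k l]subr0.
  apply: (cabs_lim_le (N0 := 0)) (part_cvg k l) _ => N _.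
  by rewrite subr0 ler_pdivlMr ?exprn_gt0 // part_bound.
exists B'; split=> // w1 w2.
have [t [t0 ts w1t w2t]] := box_radius w1 w2.
have x01 : 0 <= t / s < 1 by apply/andP; split; [rewrite divr_ge0 // ltW | rewrite ltr_pdivrMr // mul1r].
have dom := psterm_dominated s0 t0 bound w1t w2t.
have [S hS] := rect_sum_cvg x01 dom.
have domN N : geo_dominated (psterm (recenter_part A d N) w) B' (t / s).
  exact: psterm_dominated s0 t0 (part_bound N) w1t w2t.
suff -> : psum A (d.1 + w.1, d.2 + w.2) = S by [].
have hS' : seq_cvg (fun N => rect_sum (psterm (recenter_part A d N) w) N N) S.
  apply: tannery x01 domN _ hS => n m.
  have E A' : psterm A' w n m = dpow n w.1 * dpow m w.2 * A' n m.
    by rewrite /psterm; ring.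
  under [X in seq_cvg X]eq_fun do rewrite E.
  rewrite E; exact: seq_cvgZ (part_cvg n m).
apply: psum_eq gA _ _ _.
- by rewrite (le_lt_trans (cabsD _ _)) //=; lra.
- by rewrite (le_lt_trans (cabsD _ _)) //=; lra.
by under [X in seq_cvg X]eq_fun do rewrite recenter_part_sum.
Qed.

Lemma growth_recenter A r e d : growth r A -> 0 <= e ->
  cabs d.1 <= e -> cabs d.2 <= e -> growth (r - e) (recenter A d).
Proof.
move=> gA e0 d1 d2 s /andP[s0 sr].
have [|B []] := growth_recenter_aux (0, 0) gA e0 s0 _ d1 d2; first lra.
by exists B.
Qed.

Lemma psum_recenter A r e d w : growth r A -> 0 <= e ->
  cabs d.1 <= e -> cabs d.2 <= e -> cabs w.1 < r - e -> cabs w.2 < r - e ->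
  psum A (d.1 + w.1, d.2 + w.2) = psum (recenter A d) w.
Proof.
move=> gA e0 d1 d2 w1 w2; have [t [t0 tr w1t w2t]] := box_radius w1 w2.
have [|| B [_ h]] := @growth_recenter_aux A r e ((t + (r - e)) / 2) d w gA e0 _ _ d1 d2.
- lra.
- lra.
apply/esym; apply: psum_eq (growth_recenter gA e0 d1 d2) w1 w2 (h _ _).
  by apply: le_lt_trans w1t _; lra.
by apply: le_lt_trans w2t _; lra.
Qed.

End PowerSeries.

(** * Operations on formal series and on their sums *)

Lemma ord2P (i : 'I_2) : i = ord0 \/ i = ord_max.
Proof. by case: i => -[|[|//]] hk; [left | right]; apply: val_inj. Qed.

Section FormalSeries.
Variable R : realType.
Local Notation C := (Cx R).

Definition FS : lmodType C := (nat -> nat -> C : lmodType C).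

Implicit Types (A B : FS) (r s : R) (w d p q z : C * C).

(** Derivation with respect to the coordinate [i]. *)
Definition dF (i : 'I_2) (A : FS) : FS :=
  if i == ord0 then (fun n m => A n.+1 m) else (fun n m => A n m.+1).

(** Multiplication by the local coordinate, which vanishes at the centre. *)
Definition wF (i : 'I_2) (A : FS) : FS :=
  if i == ord0 then (fun n m => n%:R * A n.-1 m) else (fun n m => m%:R * A n m.-1).

(** Multiplication by the global coordinate, for series centred at [q]. *)
Definition xF q (i : 'I_2) (A : FS) : FS := Defs.coord q i *: A + wF i A.

Lemma addFE A B n m : (A + B : FS) n m = A n m + B n m. Proof. by []. Qed.
Lemma scaleFE c A n m : (c *: A : FS) n m = c * A n m. Proof. by []. Qed.
Lemma zeroFE n m : (0 : FS) n m = 0. Proof. by []. Qed.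
Lemma FSP A B : (forall n m, A n m = B n m) -> A = B.
Proof. by move=> h; apply/funext => n; apply/funext => m. Qed.

Lemma seq_cvg_ext (f g : nat -> C) l :
  (forall n, g n = f n) -> seq_cvg f l -> seq_cvg g l.
Proof. by move=> fg h e e0; have [N HN] := h e e0; exists N => n /HN; rewrite fg. Qed.

Lemma growth0 r : growth r (0 : FS).
Proof.
by move=> s _; exists 0 => n m; rewrite zeroFE cabs0 !mul0r.
Qed.

Lemma growthD r A B : growth r A -> growth r B -> growth r (A + B).
Proof.
move=> gA gB s hs; have [a Ha] := gA s hs; have [b Hb] := gB s hs.
exists (a + b) => n m; rewrite mulrDl addFE.
have s0 : 0 <= s ^+ (n + m) by rewrite exprn_ge0 //; case/andP: hs => /ltW.
apply: le_trans (ler_wpM2r s0 (cabsD _ _)) _.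
by rewrite mulrDl lerD.
Qed.

Lemma growthZ r c A : growth r A -> growth r (c *: A).
Proof.
move=> gA s hs; have [a Ha] := gA s hs.
exists (cabs c * a) => n m; rewrite scaleFE cabsM -!mulrA ler_wpM2l ?cabs_ge0 //.
Qed.

Lemma growth_swap r A : growth r A -> growth r (fun n m => A m n).
Proof.
move=> gA s hs; have [a Ha] := gA s hs; exists a => n m.
by rewrite addnC mulnC.
Qed.

Lemma shift2_dF A i :
  dF i A = shift2 (i == ord0) (i != ord0) A.
Proof.
by rewrite /dF /shift2; apply: FSP => n m; case: eqP => _ /=; rewrite addn0 addn1.
Qed.

Lemma growth_dF r i A : growth r A -> growth r (dF i A).
Proof. by move=> gA; rewrite shift2_dF; apply: growth_shift2. Qed.

Lemma growth_w0 r A : growth r A -> growth r (wF ord0 A).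
Proof.
move=> gA s hs; have [a Ha] := gA s hs.
have s0 : 0 < s by case/andP: hs.
have a0 := coef_bound_ge0 Ha.
exists (a * s) => -[|n] m; rewrite /wF /=; first by rewrite mul0r cabs0 mul0r !mulr_ge0 // ltW.
rewrite cabsM cabs_nat addSn exprS factS.
have := ler_wpM2l (_ : 0 <= n.+1%:R * s) (Ha n m).
rewrite mulr_ge0 ?(ltW s0) // => /(_ isT); rewrite !natrM.
by move=> h; apply: le_trans (le_trans h _); rewrite le_eqVlt; apply/orP; left; apply/eqP; ring.
Qed.

Lemma growth_wF r i A : growth r A -> growth r (wF i A).
Proof.
move=> gA; case: (ord2P i) => ->; first exact: growth_w0.
exact: growth_swap (growth_w0 (growth_swap gA)).
Qed.

Lemma growth_xF r q i A : growth r A -> growth r (xF q i A).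
Proof. by move=> gA; apply: growthD (growthZ _ gA) (growth_wF _ gA). Qed.

Definition in_box r w := cabs w.1 < r /\ cabs w.2 < r.

(** Rectangles of unequal sides are needed where a shift of one index changes the
range of one summation only. *)
Lemma psum_rect A r w (f g : nat -> nat) : growth r A -> in_box r w ->
  (forall N, (N <= f N)%N) -> (forall N, (N <= g N)%N) ->
  seq_cvg (fun N => rect_sum (psterm A w) (f N) (g N)) (psum A w).
Proof.
move=> gA [w1 w2] hf hg; have [B [x [x01 dom]]] := growth_dominated gA w1 w2.
have cv := psum_cvg gA w1 w2.
move=> e e0; have [N HN] := geo_tail_small (B *+ 2) x01 e0.
exists N => n Nn; rewrite cabs_distC; apply: le_lt_trans (HN _ (leqnn _)).
apply: le_trans (rect_sum_cvg_tail x01 dom cv (leq_trans Nn (hf n)) (leq_trans Nn (hg n))) _.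
by rewrite /geo_tail mulrnAl.
Qed.

Lemma psumD A B r w : growth r A -> growth r B -> in_box r w ->
  psum (A + B) w = psum A w + psum B w.
Proof.
move=> gA gB [w1 w2]; apply: (psum_eq (growthD gA gB) w1 w2).
have := seq_cvgD (psum_cvg gA w1 w2) (psum_cvg gB w1 w2).
apply: seq_cvg_ext => N.
rewrite /rect_sum -big_split; apply: eq_bigr => n _; rewrite -big_split.
by apply: eq_bigr => m _; rewrite /psterm addFE !mulrDl.
Qed.

Lemma psumZ c A r w : growth r A -> in_box r w ->
  psum (c *: A) w = c * psum A w.
Proof.
move=> gA [w1 w2]; apply: (psum_eq (growthZ c gA) w1 w2).
have := seq_cvgZ c (psum_cvg gA w1 w2).
apply: seq_cvg_ext => N.
rewrite /rect_sum mulr_sumr; apply: eq_bigr => n _; rewrite mulr_sumr.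
by apply: eq_bigr => m _; rewrite /psterm scaleFE !mulrA.
Qed.

Lemma psum_swap A r w : growth r A -> in_box r w ->
  psum (fun n m => A m n) (w.2, w.1) = psum A w.
Proof.
move=> gA [w1 w2]; apply: (@psum_eq R _ r (w.2, w.1) _ (growth_swap gA) w2 w1).
have := psum_cvg gA w1 w2.
apply: seq_cvg_ext => N.
rewrite [RHS]rect_sum_exchange; apply: eq_bigr => n _; apply: eq_bigr => m _.
by rewrite /psterm /= mulrAC.
Qed.

Lemma psum_w1 A r w : growth r A -> in_box r w ->
  psum (wF ord0 A) w = w.1 * psum A w.
Proof.
move=> gA bw.
have h := seq_cvgZ w.1 (psum_rect gA bw (fun N => leqnn N) (fun N => leqnSn N)).
have h' := psum_rect (growth_wF ord0 gA) bw (fun N => leqnSn N) (fun N => leqnSn N).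
apply: (cvg_seq_unique h'); apply: (seq_cvg_ext _ h) => N.
rewrite /rect_sum big_ord_recl big1 ?add0r; last first.
  by move=> m _; rewrite /psterm /wF /= !mul0r.
rewrite mulr_sumr; apply: eq_bigr => n _; rewrite mulr_sumr.
apply: eq_bigr => m _; rewrite /psterm /wF /= /bump /= add1n /dpow factS natrM exprS /=.
by field; rewrite !factC_neq0 nat1r pnatr_eq0.
Qed.

Lemma psum_wF i A r w : growth r A -> in_box r w ->
  psum (wF i A) w = Defs.coord w i * psum A w.
Proof.
move=> gA bw; rewrite /Defs.coord; case: eqP => [->|/eqP i1].
  exact: psum_w1 gA bw.
have -> : i = ord_max by case: (ord2P i) i1 => ->.
have bw' : in_box r (w.2, w.1) by case: bw.
rewrite -(psum_swap (growth_wF ord_max gA) bw) -(psum_swap gA bw).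
exact: psum_w1 (growth_swap gA) bw'.
Qed.

Lemma dpow0 n : dpow n (0 : C) = (n == 0)%N%:R.
Proof. by case: n => [|n]; rewrite /dpow ?expr0 ?divr1 // exprS !mul0r. Qed.

Lemma psum_expand1 A r : 0 < r -> growth r A -> exists K d : R, [/\ 0 <= K, 0 < d, d <= r &
  forall h, cabs h < d -> cabs (psum A (h, 0) - A 0%N 0%N - A 1%N 0%N * h) <= K * cabs h ^+ 2].
Proof.
move=> r0 gA; have [|B AB] := gA (r / 2); first by apply/andP; split; lra.
set s := r / 2 in AB; have s0 : 0 < s by rewrite /s; lra.
have B0 := coef_bound_ge0 AB.
exists (B / s ^+ 2 * 2), (s / 2); split.
- by rewrite mulr_ge0 // divr_ge0 // exprn_ge0 // ltW.
- lra.
- rewrite /s; lra.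
move=> h hd; have hr : cabs h < r by rewrite (lt_trans hd) // /s; lra.
have bw : in_box r (h, 0).
  split => /=; first exact: hr.
  by rewrite cabs0.
have cv := psum_rect gA bw (fun N => leq_addr 2 N) (fun N => leqnSn N).
rewrite -addrA -opprD; apply: (cabs_lim_le (N0 := 0)) cv _ => N _.
have -> : rect_sum (psterm A (h, 0)) (N + 2) N.+1 = \sum_(n < N + 2) A n 0%N * dpow n h.
  apply: eq_bigr => n _; rewrite big_ord_recl big1 ?addr0.
    by rewrite /psterm /= dpow0 mulr1.
  by move=> m _; rewrite /psterm /= dpow0 mulr0.
rewrite addn2 !big_ord_recl /= [dpow 0 h]/dpow [dpow (bump 0 0) h]/dpow.
rewrite expr0 fact0 divr1 mulr1 [bump 0 0]/= expr1 divr1 addrA [_ + A 1%N 0%N * h + _]addrC addrK.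
apply: le_trans (cabs_sum _ _ _) _; set x := cabs h / s.
have x12 : 0 <= x <= 2^-1.
  rewrite /x divr_ge0 ?cabs_ge0 ?(ltW s0) //= ler_pdivrMr //; lra.
apply: (@le_trans _ _ (\sum_(i < N) B * x ^+ 2 * x ^+ i)).
  apply: ler_sum => n _; rewrite /bump /= !add1n cabsM cabs_dpow -mulrA -exprD add2n.
  rewrite [leLHS]mulrA [leLHS]mulrAC /x expr_div_n [leRHS]mulrA [leRHS]mulrAC ler_wpM2r ?exprn_ge0 ?cabs_ge0 //.
  rewrite ler_pdivrMr ?factR_gt0 // mulrAC ler_pdivlMr ?exprn_gt0 //.
  by have := AB n.+2 0%N; rewrite addn0 muln1.
rewrite -mulr_sumr.
have -> : B / s ^+ 2 * 2 * cabs h ^+ 2 = B * x ^+ 2 * 2.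
  by rewrite /x (expr_div_n (cabs h)); field; rewrite gt_eqF ?exprn_gt0.
have /andP[x0 x1] := x12.
apply: ler_wpM2l; first by rewrite mulr_ge0 // exprn_ge0.
apply: le_trans (geo_sum_le _ _) _; first by apply/andP; split; lra.
rewrite invf_ple ?posrE; lra.
Qed.

(** After reexpansion at [d] the derivative is read on the coefficients of the
first order. *)
Lemma psum_derive1 A r d : growth r A -> in_box r d ->
  forall e : R, 0 < e -> exists2 t : R, 0 < t & forall h, h != 0 -> cabs h < t ->
   cabs (h^-1 * (psum A (d.1 + h, d.2) - psum A d) - psum (dF ord0 A) d) < e.
Proof.
move=> gA [w1 w2] e e0; have [s [s0 sr d1 d2]] := box_radius w1 w2.
have gb := growth_recenter gA s0 d1 d2.
have rs : 0 < r - s by rewrite subr_gt0.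
have [K [t [K0 t0 tr HK]]] := psum_expand1 rs gb.
have eK : 0 < e / (K + 1) by rewrite divr_gt0 // ltr_wpDl.
exists (Num.min t (e / (K + 1))) => [|h h0]; first by rewrite lt_min t0.
rewrite lt_min => /andP[ht he].
have E (k : C) : cabs k < t -> psum A (d.1 + k, d.2) = psum (recenter A d) (k, 0).
  move=> kt; rewrite -(psum_recenter gA s0 d1 d2) /= ?addr0 ?cabs0 //.
  exact: lt_le_trans tr.
have E0 : psum A d = recenter A d 0%N 0%N.
  apply/eqP; rewrite -subr_eq0; apply/eqP/cabs_eq0/eqP; rewrite eq_le cabs_ge0 andbT.
  have := HK 0; rewrite cabs0 => /(_ t0).
  by rewrite -E ?cabs0 // addr0 mulr0 subr0 expr0n mulr0; case: (d).
have E1 : psum (dF ord0 A) d = recenter A d 1%N 0%N.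
  by rewrite /recenter shift2_dF.
rewrite E // E0 E1.
have -> : h^-1 * (psum (recenter A d) (h, 0) - recenter A d 0%N 0%N) - recenter A d 1%N 0%N
  = h^-1 * (psum (recenter A d) (h, 0) - recenter A d 0%N 0%N - recenter A d 1%N 0%N * h).
  by field.
have h0' := cabs_gt0 h0.
rewrite cabsM cabsV mulrC ltr_pdivrMr //.
apply: le_lt_trans (HK h ht) _; rewrite expr2 mulrA ltr_pM2r //.
move: he; rewrite ltr_pdivlMr ?ltr_wpDl // => he.
by apply: le_lt_trans he; rewrite mulrC ler_wpM2l ?cabs_ge0 // lerDl.
Qed.

Lemma psum_derive2 A r d : growth r A -> in_box r d ->
  forall e : R, 0 < e -> exists2 t : R, 0 < t & forall h, h != 0 -> cabs h < t ->
   cabs (h^-1 * (psum A (d.1, d.2 + h) - psum A d) - psum (dF ord_max A) d) < e.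
Proof.
move=> gA bd; have bd' : in_box r (d.2, d.1) by case: bd.
move=> e e0; have [t t0 Ht] := psum_derive1 (growth_swap gA) bd' e0.
have rd : 0 < r - cabs d.2 by case: bd => _; rewrite subr_gt0.
exists (Num.min t (r - cabs d.2)) => [|h h0]; first by rewrite lt_min t0.
rewrite lt_min => /andP[ht hr].
have := Ht h h0 ht.
rewrite /= (psum_swap (w := (d.1, d.2 + h)) gA) /=; last first.
  split => /=; first by case: bd.
  by apply: le_lt_trans (cabsD _ _) _; lra.
rewrite (psum_swap gA bd).
by rewrite -(psum_swap (growth_dF ord_max gA) bd).
Qed.

End FormalSeries.

(** * Functions represented by a power series *)

Section Representation.
Variable R : realType.
Local Notation C := (Cx R).
Local Notation FS := (FS R).
Implicit Types (A B : FS) (r s : R) (w d p q z : C * C) (u v : C * C -> C).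
Local Notation "z -2 p" := (z.1 - p.1, z.2 - p.2) (at level 50).

Definition monF q (m : multinom 2) A : FS :=
  iter (m ord0) (xF q ord0) (iter (m ord_max) (xF q ord_max) A).

Definition mulF q (c : {mvpoly C}) A : FS :=
  \sum_(m <- msupp c) mcoeff m c *: monF q m A.

Definition weylF q (P : diffop R) A : FS := act (mulF q) (@dF R) P A.

Definition thetaF q (D : diffop R) A : FS :=
  act (mulF q) (fun i A => xF q i (dF i A)) D A.

(** [u] is the sum of the series [A] centred at [p] on the polydisc of radius
[r]; every operation on functions below has a counterpart on series. *)
Definition rep p r A u :=
  growth r A /\ forall z, in_box r (z -2 p) -> u z = psum A (z -2 p).

Lemma repD p r A B u v : rep p r A u -> rep p r B v ->
  rep p r (A + B) (u + v).
Proof.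
move=> [gA uA] [gB vB]; split; first exact: growthD.
by move=> z bz; rewrite (psumD gA gB bz) -uA // -vB.
Qed.

Lemma repZ p r A u c : rep p r A u -> rep p r (c *: A) (fun z => c * u z).
Proof.
move=> [gA uA]; split; first exact: growthZ.
by move=> z bz; rewrite (psumZ c gA bz) -uA.
Qed.

Lemma rep0 p r : rep p r (0 : FS) (0 : C * C -> C).
Proof.
split=> [|z bz]; first exact: growth0.
have := psumZ 0 (@growth0 R r) bz; rewrite scale0r mul0r => ->.
by [].
Qed.

Lemma rep_sum p r (I : Type) (s : seq I) (A : I -> FS) (u : I -> C * C -> C) :
  (forall i, rep p r (A i) (u i)) ->
  rep p r (\sum_(i <- s) A i) (\sum_(i <- s) u i).
Proof.
move=> h; elim: s => [|i s IH]; first by rewrite !big_nil; exact: rep0.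
by rewrite !big_cons; apply: repD.
Qed.

Lemma rep_ext p r A u v : (forall z, u z = v z) -> rep p r A u -> rep p r A v.
Proof. by move=> uv [gA uA]; split=> // z bz; rewrite -uv uA. Qed.

Lemma coord_box z p i : Defs.coord z i = Defs.coord p i + Defs.coord (z -2 p) i.
Proof. by rewrite /Defs.coord; case: eqP => _ /=; rewrite addrC subrK. Qed.

Lemma rep_xF p r A u i : rep p r A u ->
  rep p r (xF p i A) (fun z => Defs.coord z i * u z).
Proof.
move=> [gA uA]; split; first exact: growth_xF.
move=> z bz; rewrite (psumD (growthZ _ gA) (growth_wF i gA) bz).
by rewrite (psumZ _ gA bz) (psum_wF i gA bz) (coord_box z p) mulrDl -uA.
Qed.

Lemma rep_iter p r (F : FS -> FS) (G : (C * C -> C) -> (C * C -> C)) k A u :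
  (forall A u, rep p r A u -> rep p r (F A) (G u)) ->
  rep p r A u -> rep p r (iter k F A) (iter k G u).
Proof. by move=> FG hA; elim: k => // k IH; rewrite !iterS; apply: FG. Qed.

Lemma rep_monF p r A u m : rep p r A u ->
  rep p r (monF p m A)
    (fun z => (z.1 ^+ m ord0 * z.2 ^+ m ord_max) * u z).
Proof.
move=> hA.
have := rep_iter (m ord0) (fun A u => @rep_xF p r A u ord0)
          (rep_iter (m ord_max) (fun A u => @rep_xF p r A u ord_max) hA).
apply: rep_ext => z; elim: (m ord0) => [|k IH] /=; last first.
  by rewrite IH exprS !mulrA.
by elim: (m ord_max) => [|k IH] /=; rewrite ?mul1r // IH exprS expr0 !mul1r mulrA.
Qed.

Lemma lift_ord_max : lift ord0 ord0 = ord_max :> 'I_2.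
Proof. exact: val_inj. Qed.

Lemma rep_mulF p r A u (c : {mvpoly C}) : rep p r A u ->
  rep p r (mulF p c A) (fun z => meval (Defs.coord z) c * u z).
Proof.
move=> hA.
have := @rep_sum p r _ (msupp c) (fun m => mcoeff m c *: monF p m A)
  (fun m z => mcoeff m c * ((z.1 ^+ m ord0 * z.2 ^+ m ord_max) * u z)).
move=> /(_ (fun m => repZ _ (rep_monF m hA))); apply: rep_ext => z.
rewrite fct_sumE mevalE mulr_suml; apply: eq_bigr => m _.
by rewrite big_ord_recl big_ord1 lift_ord_max /Defs.coord eqxx /= !mulrA.
Qed.

Lemma rep_theta p r A u i : rep p r A u ->
  rep p r (xF p i (dF i A)) (theta i u).
Proof.
move=> [gA uA]; split; first exact/growth_xF/growth_dF.
move=> z bz; rewrite (psumD (growthZ _ (growth_dF i gA)) (growth_wF i (growth_dF i gA)) bz).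
rewrite (psumZ _ (growth_dF i gA) bz) (psum_wF i (growth_dF i gA) bz).
rewrite -mulrDl -coord_box /theta /Defs.coord; case: eqP => [->|/eqP i1].
  congr (_ * _); apply: derive1_eps => e e0.
  have [t t0 Ht] := psum_derive1 gA bz e0.
  have zr : 0 < r - cabs (z.1 - p.1) by case: bz => /=; lra.
  exists (Num.min t (r - cabs (z.1 - p.1))) => [|h h0]; first by rewrite lt_min t0.
  rewrite lt_min => /andP[ht hr]; have := Ht h h0 ht.
  have -> : u (z.1 + h, z.2) = psum A (z.1 - p.1 + h, z.2 - p.2).
    rewrite uA /= addrAC //; split; last by case: bz.
    by rewrite /= (le_lt_trans (cabsD _ _)) //; lra.
  have -> : u (z.1, z.2) = psum A (z -2 p) by rewrite -uA //; case: (z).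
  by [].
have -> : i = ord_max by case: (ord2P i) i1 => ->.
congr (_ * _); apply: derive1_eps => e e0.
have [t t0 Ht] := psum_derive2 gA bz e0.
have zr : 0 < r - cabs (z.2 - p.2) by case: bz => /=; lra.
exists (Num.min t (r - cabs (z.2 - p.2))) => [|h h0]; first by rewrite lt_min t0.
rewrite lt_min => /andP[ht hr]; have := Ht h h0 ht.
have -> : u (z.1, z.2 + h) = psum A (z.1 - p.1, z.2 - p.2 + h).
  rewrite uA /= [_ + h - _]addrAC //; split; first by case: bz.
  by rewrite /= (le_lt_trans (cabsD _ _)) //; lra.
have -> : u (z.1, z.2) = psum A (z -2 p) by rewrite -uA //; case: (z).
by [].
Qed.

Lemma rep_theta_op p r A u (D : diffop R) : rep p r A u ->
  rep p r (thetaF p D A) (theta_op D u).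
Proof.
move=> hA; apply: rep_sum => m; apply: rep_mulF.
by apply: rep_iter => [*|]; [apply: rep_theta | apply: rep_iter => // *; apply: rep_theta].
Qed.

Lemma small_neq0 (t : R) : 0 < t -> exists2 h : C, h != 0 & cabs h < t.
Proof.
move=> t0; exists ((t / 2)%:C)%C; last by rewrite cabs_real gtr0_norm; lra.
have : cabs ((t / 2)%:C%C : C) != 0 by rewrite cabs_real gtr0_norm; lra.
by apply: contraNneq => ->; rewrite cabs0.
Qed.

(** The derivative is a limit of difference quotients, which are all zero. *)
Lemma psum_dF_eq0 i A r : growth r A -> (forall w, in_box r w -> psum A w = 0) ->
  forall w, in_box r w -> psum (dF i A) w = 0.
Proof.
move=> gA A0 w bw; apply/cabs_eq0/eqP; rewrite eq_le cabs_ge0 andbT.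
apply/ler_addgt0Pr => e e0; rewrite add0r.
have [b1 b2] := bw.
have [/eqP i0|i1] := boolP (i == ord0).
  have [t t0 Ht] := psum_derive1 gA bw e0.
  have [|h h0] := @small_neq0 (Num.min t (r - cabs w.1)).
    by rewrite lt_min t0 subr_gt0.
  rewrite lt_min => /andP[h1 h2]; have := Ht _ h0 h1.
  rewrite !A0 //; last by split=> //=; rewrite (le_lt_trans (cabsD _ _)) //; lra.
  by rewrite subrr mulr0 sub0r cabsN i0 => /ltW.
have i1' : i = ord_max by case: (ord2P i) i1 => ->.
have [t t0 Ht] := psum_derive2 gA bw e0.
have [|h h0] := @small_neq0 (Num.min t (r - cabs w.2)).
  by rewrite lt_min t0 subr_gt0.
rewrite lt_min => /andP[h1 h2]; have := Ht _ h0 h1.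
rewrite !A0 //; last by split=> //=; rewrite (le_lt_trans (cabsD _ _)) //; lra.
by rewrite subrr mulr0 sub0r cabsN i1' => /ltW.
Qed.

Lemma psum00 A r : 0 < r -> growth r A -> psum A (0, 0) = A 0%N 0%N.
Proof.
move=> r0 gA; have [K [t [K0 t0 tr /(_ 0)]]] := psum_expand1 r0 gA.
rewrite cabs0 mulr0 subr0 expr0n mulr0 => /(_ t0) h.
by apply/eqP; rewrite -subr_eq0; apply/eqP/cabs_eq0/eqP; rewrite eq_le h cabs_ge0.
Qed.

Lemma iter_dF n m A i j : iter n (dF ord0) (iter m (dF ord_max) A) i j = A (i + n)%N (j + m)%N.
Proof.
have h2 k (B : FS) : iter k (dF ord_max) B = fun i j => B i (j + k)%N.
  elim: k => [|k IH]; first by apply: FSP => i' j'; rewrite addn0.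
  by rewrite iterS IH; apply: FSP => i' j'; rewrite /dF /= addnS addSn.
have h1 k (B : FS) : iter k (dF ord0) B = fun i j => B (i + k)%N j.
  elim: k => [|k IH]; first by apply: FSP => i' j'; rewrite addn0.
  by rewrite iterS IH; apply: FSP => i' j'; rewrite /dF /= addnS addSn.
by rewrite h1 h2.
Qed.

Lemma psum_eq0 A r : 0 < r -> growth r A ->
  (forall w, in_box r w -> psum A w = 0) -> A = 0.
Proof.
move=> r0 gA A0; apply: FSP => n m; rewrite -[n]add0n -[m in A _ m]add0n -iter_dF.
suff [gB B0] : growth r (iter n (dF ord0) (iter m (dF ord_max) A)) /\
  (forall w, in_box r w -> psum (iter n (dF ord0) (iter m (dF ord_max) A)) w = 0).
  by rewrite -(psum00 r0 gB) B0 //; split; rewrite cabs0.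
have step i k B : growth r B /\ (forall w, in_box r w -> psum B w = 0) ->
    growth r (iter k (dF i) B) /\ (forall w, in_box r w -> psum (iter k (dF i) B) w = 0).
  move=> hB; elim: k => [|k [gk k0]]; first exact: hB.
  split; first exact: growth_dF.
  exact: psum_dF_eq0.
by apply: (step ord0 n _ (step ord_max m A (conj gA A0))).
Qed.

Lemma coef_bound_growth A b r : coef_bound A b r -> growth r A.
Proof.
move=> h s /andP[s0 sr]; exists b => n m; apply: le_trans (h n m).
rewrite ler_wpM2l ?cabs_ge0 //.
by rewrite lerXn2r ?nnegrE ?(ltW s0) ?(ltW sr) ?(ltW (lt_trans s0 sr)).
Qed.

Lemma rep_eq0 p r A u : 0 < r -> rep p r A u ->
  (\forall z \near p, u z = 0) -> A = 0.
Proof.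
move=> r0 [gA uA] /near_boxP[t t0 Ht].
have m0 : 0 < Num.min r t by rewrite lt_min r0.
apply: (psum_eq0 m0); first by apply: growth_le gA; rewrite ge_min lexx.
move=> w [w1 w2].
have E : (w.1 + p.1, w.2 + p.2) -2 p = w by rewrite /= !addrK; case: (w).
have := uA (w.1 + p.1, w.2 + p.2); rewrite E => <-.
  by apply: Ht; rewrite /= addrK; move: w1 w2; rewrite !lt_min => /andP[? ?] /andP[].
by split; move: w1 w2; rewrite !lt_min => /andP[? ?] /andP[].
Qed.

Lemma rep_zero p r u : rep p r 0 u -> forall z, in_box r (z -2 p) -> u z = 0.
Proof. by move=> [gA uA] z bz; rewrite uA //; have [_ /(_ z bz) <-] := rep0 p r. Qed.

Lemma rep_recenter p r A u q (e : R) : rep p r A u -> 0 <= e ->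
  in_box e (q -2 p) -> rep q (r - e) (recenter A (q -2 p)) u.
Proof.
move=> [gA uA] e0 [q1 q2]; split; first by apply: growth_recenter; rewrite // ltW.
move=> z [/= z1 z2].
rewrite -(@psum_recenter R A r e (q -2 p) (z -2 q) gA e0 (ltW q1) (ltW q2) z1 z2) /=.
have -> (a b c : C) : a - b + (c - a) = c - b by rewrite addrC addrA subrK.
have -> (a b c : C) : a - b + (c - a) = c - b by rewrite addrC addrA subrK.
apply: uA; rewrite /in_box /=.
have E (a b c : C) : c - b = (c - a) + (a - b) by rewrite addrA subrK.
split.
  by rewrite (E q.1) (le_lt_trans (cabsD _ _)) //; move: z1 q1 => /=; lra.
by rewrite (E q.2) (le_lt_trans (cabsD _ _)) //; move: z2 q2 => /=; lra.
Qed.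

Lemma rep_holomorphic p r A u : 0 < r -> rep p r A u -> holomorphic_at p u.
Proof.
move=> r0 [gA uA]; exists (fun n m => A n m / n`!%:R / m`!%:R).
apply/near_boxP; exists r => // z z1 z2.
have := psum_dsum (w := z -2 p) gA z1 z2; rewrite -uA; last exact: conj z1 z2.
by congr dsum; apply/funext => n; apply/funext => m; rewrite /psterm /dpow /=; ring.
Qed.

(** Absolute convergence at the single point with both local coordinates equal to
[r] bounds all the coefficients. *)
Lemma holomorphic_rep p u : holomorphic_at p u -> exists r A, 0 < r /\ rep p r A u.
Proof.
move=> [a /near_boxP[r0 r00 H]]; set r := r0 / 2.
have r_gt0 : 0 < r by rewrite /r; lra.
have ch : cabs ((r%:C)%C : C) = r by rewrite cabs_real gtr0_norm.
have ltr0 : r < r0 by rewrite /r; lra.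
have := H (p.1 + (r%:C)%C, p.2 + (r%:C)%C); rewrite /= ![_ + _ - _]addrC !addKr ch.
case=> // [[b Hb] _].
have aB n m : cabs (a n m) * r ^+ (n + m) <= complex.Re b.
  have n_lt : (n < (maxn n m).+1)%N by rewrite ltnS leq_maxl.
  have m_lt : (m < (maxn n m).+1)%N by rewrite ltnS leq_maxr.
  have := Hb (maxn n m).+1.
  rewrite (bigD1 (Ordinal n_lt)) //= (bigD1 (Ordinal m_lt)) //= -addrA.
  move=> h; have : `|a n m * (r%:C)%C ^+ n * (r%:C)%C ^+ m| <= b.
    apply: le_trans h; rewrite lerDl addr_ge0 //; first exact: sumr_ge0.
    by apply: sumr_ge0 => i _; apply: sumr_ge0.
  by rewrite norm_cabs !cabsM !cabsX ch -mulrA -exprD lecE => /andP[].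
pose A : FS := fun n m => a n m * n`!%:R * m`!%:R.
have gA : growth r A.
  move=> s /andP[s0 sr]; exists (complex.Re b) => n m.
  rewrite /A !cabsM !cabs_nat natrM.
  have h : cabs (a n m) * s ^+ (n + m) <= complex.Re b.
    apply: le_trans (aB n m); rewrite ler_wpM2l ?cabs_ge0 //.
    by rewrite lerXn2r ?nnegrE ?ltW // (lt_trans s0).
  have f0 : (0 : R) <= n`!%:R * m`!%:R by rewrite mulr_ge0.
  have -> : cabs (a n m) * n`!%:R * m`!%:R * s ^+ (n + m) =
    cabs (a n m) * s ^+ (n + m) * (n`!%:R * m`!%:R) by ring.
  exact: (ler_wpM2r f0 h).
exists r, A; split=> //; split=> // z [z1 z2].
have [_ /cvg_seqP cv] := H z (lt_trans z1 ltr0) (lt_trans z2 ltr0).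
apply/esym/(psum_eq gA z1 z2); apply: seq_cvg_ext cv => N.
apply: eq_bigr => n _; apply: eq_bigr => m _; rewrite /psterm /A /dpow /=.
by field; rewrite !factC_neq0.
Qed.

End Representation.

(** * Identities between operators, from polynomials to formal series *)

Section Linear.
Variables (K : nzRingType) (V W : lmodType K).

Definition lin (F : V -> W) := forall c A B, F (c *: A + B) = c *: F A + F B.

Lemma linD F : lin F -> forall A B, F (A + B) = F A + F B.
Proof. by move=> h A B; have := h 1 A B; rewrite !scale1r. Qed.

Lemma lin0 F : lin F -> F 0 = 0.
Proof.
by move=> h; apply: (addIr (F 0)); rewrite -(linD h) addr0 add0r.
Qed.

Lemma linZ F : lin F -> forall c A, F (c *: A) = c *: F A.
Proof. by move=> h c A; rewrite -[c *: A]addr0 h (lin0 h) addr0. Qed.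

Lemma lin_sum F : lin F -> forall (I : Type) (s : seq I) (A : I -> V),
  F (\sum_(i <- s) A i) = \sum_(i <- s) F (A i).
Proof.
move=> h I s A; elim: s => [|i s IH]; rewrite ?big_nil ?(lin0 h) //.
by rewrite !big_cons (linD h) IH.
Qed.

Lemma linP F : (forall A B, F (A + B) = F A + F B) ->
  (forall c A, F (c *: A) = c *: F A) -> lin F.
Proof. by move=> h1 h2 c A B; rewrite h1 h2. Qed.
End Linear.

Lemma lin_iter (K : nzRingType) (V : lmodType K) (F : V -> V) k : lin F -> lin (iter k F).
Proof. by move=> h; elim: k => [|k IH] c A B //=; rewrite IH h. Qed.

Lemma lin_bigsum (K : nzRingType) (V W : lmodType K) (I : Type) (s : seq I)
  (F : I -> V -> W) : (forall i, lin (F i)) -> lin (fun A => \sum_(i <- s) F i A).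
Proof.
move=> h c A B; rewrite scaler_sumr -big_split.
by apply: eq_bigr => i _; rewrite h.
Qed.

Section SupportSums.
Variables (n : nat) (K : nzRingType) (V : nmodType) (G : multinom n -> K -> V).
Hypothesis G0 : forall m, G m 0 = 0.

Lemma msupp_sum_widen (p : mpoly n K) (s : seq (multinom n)) :
  uniq s -> {subset msupp p <= s} ->
  \sum_(m <- msupp p) G m (mcoeff m p) = \sum_(m <- s) G m (mcoeff m p).
Proof.
move=> us ps; rewrite [RHS](bigID (mem (msupp p))) /= [X in _ + X]big1 ?addr0.
  rewrite -[RHS]big_filter; apply/perm_big/uniq_perm; rewrite ?msupp_uniq ?filter_uniq //.
  by move=> m; rewrite mem_filter; case: (boolP (m \in msupp p)) => //= /ps ->.
by move=> m /memN_msupp_eq0 ->.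
Qed.

Lemma msupp_sumD (p q : mpoly n K) :
  (forall m a b, G m (a + b) = G m a + G m b) ->
  \sum_(m <- msupp (p + q)) G m (mcoeff m (p + q)) =
  \sum_(m <- msupp p) G m (mcoeff m p) + \sum_(m <- msupp q) G m (mcoeff m q).
Proof.
move=> GD; set s := undup (msupp p ++ msupp q ++ msupp (p + q)).
have us : uniq s by apply: undup_uniq.
rewrite (msupp_sum_widen us) ?(msupp_sum_widen (p := p) us) ?(msupp_sum_widen (p := q) us).
- by rewrite -big_split; apply: eq_bigr => m _; rewrite mcoeffD GD.
all: by move=> m hm; rewrite mem_undup !mem_cat hm ?orbT.
Qed.

Lemma msupp_sumZX (a : K) (m : multinom n) :
  \sum_(k <- msupp (a *: mpolyX K m)) G k (mcoeff k (a *: mpolyX K m)) = G m a.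
Proof.
rewrite (msupp_sum_widen (s := [:: m])) //; last first.
  by move=> k /msuppZ_le; rewrite msuppX.
by rewrite big_seq1 mcoeffZ mcoeffX eqxx mulr1.
Qed.
End SupportSums.

(** Adapted to operators for which multiplication by one variable is known. *)
Lemma mpoly_XD_ind (n : nat) (K : nzRingType) (P : mpoly n K -> Prop) :
  P 1 -> (forall i p, P p -> P (mpolyX K (mnm1 i) * p)) ->
  (forall c p q, P p -> P q -> P (c *: p + q)) -> forall p, P p.
Proof.
move=> P1 PX PD; have P0 : P 0 by rewrite -(addNr 1) -scaleN1r; apply: PD.
have PXm m : P (mpolyX K m).
  rewrite (multinomUE_id m).
  elim/big_rec: _ => [|i x _ Px]; first by rewrite mpolyX0.
  elim: (m i) => [|k IH]; first by rewrite mulm0n add0m.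
  by rewrite mulmS -addmA mpolyXD; apply: PX.
elim/mpolyind => // c m p _ _ Pp; exact: PD.
Qed.

Section Transfer.
Variable R : realType.
Local Notation C := (Cx R).
Local Notation FS := (FS R).
Local Notation XX i := (mpolyX C (mnm1 i)).
Implicit Types (A B : FS) (p q : C * C).

Lemma lin_dF i : lin (@dF R i).
Proof. by move=> c A B; rewrite /dF; case: eqP. Qed.

Lemma lin_wF i : lin (@wF R i).
Proof.
move=> c A B; rewrite /wF; case: eqP => _; apply: FSP => n m;
  by rewrite addFE scaleFE !addFE !scaleFE; ring.
Qed.

Lemma lin_xF q i : lin (xF q i).
Proof.
move=> c A B; rewrite /xF lin_wF scalerDr scalerDr !scalerA.
by rewrite [Defs.coord q i * c]mulrC addrACA.
Qed.

Lemma lin_monF q m : lin (monF q m).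
Proof.
by move=> c A B; rewrite /monF (lin_iter _ (lin_xF q ord_max)) (lin_iter _ (lin_xF q ord0)).
Qed.

Lemma lin_mulF q c : lin (mulF q c).
Proof.
apply: lin_bigsum => m a A B.
by rewrite lin_monF scalerDr !scalerA [_ * a]mulrC.
Qed.

Lemma mulFD q c c' A : mulF q (c + c') A = mulF q c A + mulF q c' A.
Proof.
rewrite /mulF (msupp_sumD (G := fun m a => a *: monF q m A)) //.
- by move=> m; rewrite scale0r.
- by move=> m a b; rewrite scalerDl.
Qed.

Lemma mulFZX q a m A : mulF q (a *: mpolyX C m) A = a *: monF q m A.
Proof. by rewrite /mulF (msupp_sumZX (G := fun m a => a *: monF q m A)) // => k; rewrite scale0r. Qed.

Lemma mulFX q m A : mulF q (mpolyX C m) A = monF q m A.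
Proof. by rewrite -[mpolyX C m]scale1r mulFZX scale1r. Qed.

Lemma mulF0 q A : mulF q 0 A = 0.
Proof. by rewrite /mulF msupp0 big_nil. Qed.

Lemma mulFZ q a c A : mulF q (a *: c) A = a *: mulF q c A.
Proof.
elim/mpolyind: c => [|b m c _ _ IH]; first by rewrite scaler0 mulF0 scaler0.
by rewrite scalerDr !mulFD IH scalerA !mulFZX scalerDr scalerA.
Qed.

Lemma lin_mulF_coef q A : lin (fun c => mulF q c A).
Proof. by apply: linP => *; rewrite ?mulFD ?mulFZ. Qed.

Lemma xF_comm q i j A : xF q i (xF q j A) = xF q j (xF q i A).
Proof.
apply: FSP => n m; rewrite /xF /wF !(addFE, scaleFE).
case: eqP => _; case: eqP => _; rewrite !(addFE, scaleFE); ring.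
Qed.

Lemma dF_xF q i j A : dF i (xF q j A) = xF q j (dF i A) + (i == j)%:R *: A.
Proof.
by case: (ord2P i) => ->; case: (ord2P j) => ->; apply: FSP => n m;
  rewrite /xF /wF /dF /= !(addFE, scaleFE) /=;
  (case: n => [|n]); (case: m => [|m]) => /=; ring.
Qed.

Lemma monF_U q i m A : monF q (mnm_add (mnm1 i) m) A = xF q i (monF q m A).
Proof.
rewrite /monF !mnmDE !mnm1E.
case: (ord2P i) => -> /=; rewrite ?add1n ?add0n ?iterS //.
elim: (m ord0) => [|k IH] //=; by rewrite IH xF_comm.
Qed.

Lemma mulF_X q i c A : mulF q (XX i * c) A = xF q i (mulF q c A).
Proof.
elim/mpolyind: c => [|b m c _ _ IH].
  by rewrite mulr0 mulF0 (lin0 (lin_xF q i)).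
rewrite mulrDr -scalerAr -mpolyXD !mulFD !mulFZX IH.
by rewrite monF_U lin_xF.
Qed.

Lemma mulF1 q A : mulF q 1 A = A.
Proof. by rewrite -mpolyX0 mulFX /monF !mnm0E. Qed.

Lemma mulF_M q c d A : mulF q (c * d) A = mulF q c (mulF q d A).
Proof.
elim/mpoly_XD_ind: c => [|i c IH|b c c' IH IH'].
- by rewrite mul1r mulF1.
- by rewrite -mulrA !mulF_X IH.
by rewrite mulrDl -scalerAl !mulFD !mulFZ IH IH'.
Qed.

Definition oneF : FS := fun n m => ((n == 0) && (m == 0))%:R.

(** The series of a polynomial is obtained by letting it multiply the series of
the constant 1. *)
Definition taylor q (f : {mvpoly C}) : FS := mulF q f oneF.

Lemma lin_taylor q : lin (taylor q).
Proof. exact: lin_mulF_coef. Qed.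

Lemma taylor_X q i f : taylor q (XX i * f) = xF q i (taylor q f).
Proof. exact: mulF_X. Qed.

Lemma taylor_mul q c f : taylor q (c * f) = mulF q c (taylor q f).
Proof. exact: mulF_M. Qed.

Lemma dF_one i : dF i oneF = 0.
Proof.
apply: FSP => n m; rewrite /dF /oneF; case: eqP => _ //=.
by rewrite andbF.
Qed.

Lemma taylor_deriv q i f : taylor q (mderiv i f) = dF i (taylor q f).
Proof.
elim/mpoly_XD_ind: f => [|j f IH|a f g IH IH'].
- by rewrite -mpolyC1 mderivC (lin0 (lin_taylor q)) /taylor mpolyC1 mulF1 dF_one.
- rewrite mderivM mderivX (linD (lin_taylor q)) taylor_X IH taylor_X dF_xF addrC.
  congr (_ + _); rewrite mnm1E eq_sym; case: (altP (i =P j)) => [->|_].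
    have -> (j0 : 'I_2) : mnm_sub (mnm1 j0) (mnm1 j0) = (mnm0 : multinom 2) by apply/mnmP => k; rewrite mnmBE subnn mnm0E.
    by rewrite scale1r mpolyX0 mul1r scale1r.
  by rewrite !scale0r mul0r (lin0 (lin_taylor q)).
by rewrite mderivD mderivZ !lin_taylor lin_dF IH IH'.
Qed.

Lemma mulF_C q a A : mulF q (mpolyC 2 a) A = a *: A.
Proof. by rewrite -[mpolyC 2 a]mulr1 mul_mpolyC mulFZ mulF1. Qed.

Lemma taylor_shift q i f :
  taylor q ((XX i - mpolyC 2 (Defs.coord q i)) * f) = wF i (taylor q f).
Proof.
rewrite mulrBl mul_mpolyC (linD (lin_taylor q)) -scaleNr (linZ (lin_taylor q)).
by rewrite taylor_X /xF scaleNr addrAC subrr add0r.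
Qed.

(** The entries of total degree less than [N] of the result depend on those of
degree less than [N + k] of the argument. *)
Definition local k (G : FS -> FS) := forall A B N,
  (forall i j, (i + j < N + k)%N -> A i j = B i j) ->
  forall i j, (i + j < N)%N -> G A i j = G B i j.

Lemma local_dF i : local 1 (@dF R i).
Proof. by move=> A B N h a b ab; rewrite /dF; case: eqP => _; apply: h; lia. Qed.

Lemma local_wF i : local 0 (@wF R i).
Proof.
by move=> A B N h a b ab; rewrite /wF; case: eqP => _; rewrite h //; lia.
Qed.

Lemma local_comp k l F G : local k F -> local l G -> local (k + l) (F \o G).
Proof.
move=> hF hG A B N h a b ab /=; apply: hF ab => {a b} a b ab; apply: hG ab => a' b' ab'.
by apply: h; lia.
Qed.

Definition is_local G := exists k, local k G.

Lemma is_local_comp F G : is_local F -> is_local G -> is_local (F \o G).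
Proof. by move=> [k hF] [l hG]; exists (k + l)%N; apply: local_comp. Qed.

Lemma is_local_iter F k : is_local F -> is_local (iter k F).
Proof.
move=> hF; elim: k => [|k IH]; last exact: is_local_comp hF IH.
by exists 0%N => A B N h a b ab /=; apply: h; lia.
Qed.

Lemma is_local_sum (I : Type) (s : seq I) (F : I -> FS -> FS) :
  (forall i, is_local (F i)) -> is_local (fun A => \sum_(i <- s) F i A).
Proof.
move=> h; elim: s => [|i s [k IH]].
  by exists 0%N => A B N _ a b _; rewrite !big_nil.
have [l hl] := h i; exists (l + k)%N => A B N hAB a b ab; rewrite !big_cons !addFE.
congr (_ + _); last first.
  by apply: IH ab => a' b' ab'; apply: hAB; lia.
by apply: hl ab => a' b' ab'; apply: hAB; lia.
Qed.

Lemma is_localD F G : is_local F -> is_local G -> is_local (fun A => F A + G A).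
Proof.
move=> [k hF] [l hG]; exists (k + l)%N => A B N h a b ab; rewrite !addFE.
by congr (_ + _); [apply: hF ab | apply: hG ab] => a' b' ab'; apply: h; lia.
Qed.

Lemma is_localZ c F : is_local F -> is_local (fun A => c *: F A).
Proof.
by move=> [k hF]; exists k => A B N h a b ab; rewrite !scaleFE (hF A B N h).
Qed.

Lemma is_local_xF q i : is_local (xF q i).
Proof.
exists 0%N => A B N h a b ab; rewrite /xF !addFE !scaleFE (local_wF _ (N := N) h) //.
by rewrite h //; lia.
Qed.

Lemma is_local_mulF q c : is_local (mulF q c).
Proof.
apply: is_local_sum => m; apply: is_localZ.
by apply: (is_local_comp (F := iter _ _) (G := iter _ _));
  apply: is_local_iter; apply: is_local_xF.
Qed.

(** Powers of the local coordinates are polynomials, so every jet is the jet of a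
polynomial. *)
Lemma taylor_dense q A N : exists f, forall i j, (i + j < N)%N -> taylor q f i j = A i j.
Proof.
pose g i j : {mvpoly C} := (A i j / (i`!%:R * j`!%:R)) *:
  ((XX ord0 - mpolyC 2 (Defs.coord q ord0)) ^+ i *
   (XX ord_max - mpolyC 2 (Defs.coord q ord_max)) ^+ j).
exists (\sum_(i < N) \sum_(j < N) g i j) => a b ab.
have tg i j n m : taylor q (g i j) n m = A i j * ((n == i) && (m == j))%:R.
  rewrite /g (linZ (lin_taylor q)) scaleFE.
  have -> : taylor q ((XX ord0 - mpolyC 2 (Defs.coord q ord0)) ^+ i *
   (XX ord_max - mpolyC 2 (Defs.coord q ord_max)) ^+ j) n m =
   ((n == i) && (m == j))%:R * (i`!%:R * j`!%:R).
    elim: i n => [|i IH] n.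
      rewrite expr0 mul1r fact0 mul1r.
      elim: j m => [|j IH] m.
        by rewrite expr0 /taylor mulF1 /oneF fact0 mulr1.
      rewrite exprS taylor_shift /wF /=; case: m => [|m].
        by rewrite mul0r andbF mul0r.
      by rewrite IH eqSS factS natrM; have [->|_] := eqVneq m j; [ring | rewrite !andbF !mul0r mulr0].
    rewrite exprS -mulrA taylor_shift /wF /=; case: n => [|n]; first by rewrite !mul0r.
    by rewrite IH eqSS factS natrM; have [->|_] := eqVneq n i; [ring | rewrite !mul0r mulr0].
  by field; rewrite !factC_neq0.
rewrite (lin_sum (lin_taylor q)).
have sumFE (s : seq 'I_N) (F : 'I_N -> FS) : (\sum_(i <- s) F i) a b = \sum_(i <- s) F i a b.
  by elim: s => [|i s IH]; rewrite ?big_nil // !big_cons addFE IH.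
rewrite sumFE (bigD1 (Ordinal (leq_ltn_trans (leq_addr b a) ab))) //= [X in _ + X]big1 ?addr0.
  rewrite (lin_sum (lin_taylor q)) sumFE (bigD1 (Ordinal (leq_ltn_trans (leq_addl a b) ab))) //= [X in _ + X]big1 ?addr0.
    by rewrite tg !eqxx mulr1.
  by move=> j; rewrite -val_eqE /= tg eq_sym => /negbTE ->; rewrite andbF mulr0.
move=> i; rewrite -val_eqE /= eq_sym => /negbTE i_a; rewrite (lin_sum (lin_taylor q)) sumFE big1 // => j _.
by rewrite tg i_a mulr0.
Qed.

Definition compat q (F : {mvpoly C} -> {mvpoly C}) (G : FS -> FS) :=
  (forall f, taylor q (F f) = G (taylor q f)) /\ is_local G.

(** Both sides depend on a finite jet, and this jet is that of a polynomial. *)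
Lemma compat_transfer q F F' G G' : compat q F G -> compat q F' G' ->
  (forall f, F f = F' f) -> forall A, G A = G' A.
Proof.
move=> [FG [k lG]] [FG' [l lG']] FF' A; apply: FSP => a b.
have [f hf] := taylor_dense q A ((a + b).+1 + (k + l)).
rewrite -(lG (taylor q f) A (a + b).+1) //; last by move=> i j ij; apply: hf; lia.
rewrite -(lG' (taylor q f) A (a + b).+1) //; last by move=> i j ij; apply: hf; lia.
by rewrite -FG -FG' FF'.
Qed.

Lemma compat_comp q F F' G G' : compat q F G -> compat q F' G' ->
  compat q (F \o F') (G \o G').
Proof.
move=> [FG lG] [FG' lG']; split; last exact: is_local_comp.
by move=> f /=; rewrite FG FG'.
Qed.

Lemma compatD q F F' G G' : compat q F G -> compat q F' G' ->
  compat q (fun f => F f + F' f) (fun A => G A + G' A).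
Proof.
move=> [FG lG] [FG' lG']; split; last exact: is_localD.
by move=> f /=; rewrite (linD (lin_taylor q)) FG FG'.
Qed.

Lemma compat_iter q F G k : compat q F G -> compat q (iter k F) (iter k G).
Proof.
move=> [FG lG]; split; last exact: is_local_iter.
by elim: k => [|k IH] f //=; rewrite FG IH.
Qed.

Lemma compat_act q (d : 'I_2 -> {mvpoly C} -> {mvpoly C}) (e : 'I_2 -> FS -> FS) P :
  (forall i, compat q (d i) (e i)) ->
  compat q (act (fun c f => c * f) d P) (act (mulF q) e P).
Proof.
move=> de; split; last first.
  apply: is_local_sum => m; apply: (is_local_comp (F := mulF q _)
    (G := iter _ _ \o iter _ _)) (is_local_mulF _ _) _.
  by apply: is_local_comp; apply: is_local_iter; case: (de ord0); case: (de ord_max).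
move=> f; rewrite /act (lin_sum (lin_taylor q)); apply: eq_bigr => m _.
rewrite taylor_mul; congr mulF.
have [h _] := compat_iter (m ord0) (de ord0); rewrite h; congr iter.
by have [h' _] := compat_iter (m ord_max) (de ord_max); rewrite h'.
Qed.

Lemma compat_weyl q P : compat q (poly_weyl P) (weylF q P).
Proof.
apply: compat_act => i; split; first exact: taylor_deriv.
by exists 1%N; apply: local_dF.
Qed.

Lemma compat_theta q D : compat q (poly_theta D) (thetaF q D).
Proof.
apply: compat_act => i; split.
  by move=> f; rewrite taylor_X taylor_deriv.
by apply: (is_local_comp (F := xF q i)) (is_local_xF q i) _; exists 1%N; apply: local_dF.
Qed.

(** Membership in the left ideal is tested on polynomials; the transfer principle
makes it available for formal solutions. *)
Lemma left_ideal_formal q (D1 D3 P : diffop R) A : left_ideal D1 D3 P ->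
  thetaF q D1 A = 0 -> thetaF q D3 A = 0 -> weylF q P A = 0.
Proof.
move=> [S [T ST]] h1 h3.
have E := compat_transfer (compat_weyl q P)
  (compatD (compat_comp (compat_weyl q S) (compat_theta q D1))
           (compat_comp (compat_weyl q T) (compat_theta q D3))) ST A.
rewrite {}E /= h1 h3 /weylF.
have z P' : act (mulF q) (@dF R) P' 0 = 0.
  rewrite /act big1 // => m _; rewrite (lin0 (lin_iter _ (lin_dF _))).
  by rewrite (lin0 (lin_iter _ (lin_dF _))) (lin0 (lin_mulF _ _)).
by rewrite !z addr0.
Qed.

End Transfer.

(** * Symbols of the left ideal at a nonsingular point *)

Section ActTheory.
Variables (K : nzRingType) (V : zmodType).
Variables (mulc : K -> V -> V) (d : 'I_2 -> V -> V) (delta : 'I_2 -> K -> K).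
Hypothesis mulc0 : forall v, mulc 0 v = 0.
Hypothesis mulcD : forall a b v, mulc (a + b) v = mulc a v + mulc b v.
Hypothesis mulcA : forall a b v, mulc (a * b) v = mulc a (mulc b v).
Hypothesis mulcr0 : forall a, mulc a 0 = 0.
Hypothesis mulcDr : forall a v w, mulc a (v + w) = mulc a v + mulc a w.
Hypothesis d0 : forall i, d i 0 = 0.
Hypothesis dD : forall i v w, d i (v + w) = d i v + d i w.
Hypothesis dM : forall i a v, d i (mulc a v) = mulc (delta i a) v + mulc a (d i v).
Hypothesis d_comm : forall i j v, d i (d j v) = d j (d i v).
Hypothesis delta0 : forall i, delta i 0 = 0.
Hypothesis deltaD : forall i a b, delta i (a + b) = delta i a + delta i b.
Implicit Types (P Q : mpoly 2 K).

Definition gact P (v : V) : V :=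
  \sum_(m <- msupp P)
    mulc (mcoeff m P) (iter (m ord0) (d ord0) (iter (m ord_max) (d ord_max) v)).

Lemma gactD P Q v : gact (P + Q) v = gact P v + gact Q v.
Proof.
by rewrite /gact (msupp_sumD (G := fun m c => mulc c
  (iter (m ord0) (d ord0) (iter (m ord_max) (d ord_max) v)))).
Qed.

Lemma gactZX c m v : gact (c *: mpolyX K m) v =
  mulc c (iter (m ord0) (d ord0) (iter (m ord_max) (d ord_max) v)).
Proof.
by rewrite /gact (msupp_sumZX (G := fun m c => mulc c
  (iter (m ord0) (d ord0) (iter (m ord_max) (d ord_max) v)))).
Qed.

Lemma gact0 v : gact 0 v = 0.
Proof. by rewrite /gact msupp0 big_nil. Qed.

Lemma gactZ c P v : gact (c *: P) v = mulc c (gact P v).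
Proof.
elim/mpolyind: P => [|b m P _ _ IH]; first by rewrite scaler0 gact0 mulcr0.
by rewrite scalerDr !gactD IH scalerA !gactZX mulcDr mulcA.
Qed.

Definition coef_deriv i P : mpoly 2 K :=
  \sum_(m <- msupp P) delta i (mcoeff m P) *: mpolyX K m.

(** The product of [d i] with the operator [P], with coefficients moved to the
left by the Leibniz rule. *)
Definition left_deriv i P : mpoly 2 K := mpolyX K (mnm1 i) * P + coef_deriv i P.

Lemma coef_derivD i P Q : coef_deriv i (P + Q) = coef_deriv i P + coef_deriv i Q.
Proof.
rewrite /coef_deriv (msupp_sumD (G := fun m c => delta i c *: mpolyX K m)) //.
  by move=> m; rewrite delta0 scale0r.
by move=> m a b; rewrite deltaD scalerDl.
Qed.

Lemma coef_derivZX i c m : coef_deriv i (c *: mpolyX K m) = delta i c *: mpolyX K m.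
Proof.
rewrite /coef_deriv (msupp_sumZX (G := fun m c => delta i c *: mpolyX K m)) //.
by move=> k; rewrite delta0 scale0r.
Qed.

Lemma coef_deriv0 i : coef_deriv i 0 = 0.
Proof. by rewrite /coef_deriv msupp0 big_nil. Qed.

Lemma d_iter_comm i j k v : d i (iter k (d j) v) = iter k (d j) (d i v).
Proof. by elim: k => [|k IH] //=; rewrite -IH d_comm. Qed.

Lemma scalerXr (c : K) i (m : multinom 2) : mpolyX K (mnm1 i) * (c *: mpolyX K m) =
  c *: mpolyX K (mnm_add (mnm1 i) m).
Proof.
by rewrite -(commr_mpolyX (mnm1 i)) -scalerAl -mpolyXD addmC.
Qed.

Lemma gact_deriv i P v : gact (left_deriv i P) v = d i (gact P v).
Proof.
rewrite /left_deriv gactD.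
elim/mpolyind: P => [|c m P _ _ IH].
  by rewrite mulr0 coef_deriv0 gact0 addr0 d0.
rewrite mulrDr coef_derivD !gactD dD -IH scalerXr coef_derivZX addrACA.
congr (_ + _); rewrite !gactZX dM addrC; congr (_ + mulc _ _).
rewrite !mnmDE !mnm1E.
by case: (ord2P i) => -> /=; rewrite ?add1n ?add0n ?iterS // [RHS]d_iter_comm.
Qed.

Definition order_le N P := forall m, m \in msupp P -> (mdeg m <= N)%N.

Lemma order_leD N P Q : order_le N P -> order_le N Q -> order_le N (P + Q).
Proof. by move=> hP hQ m /msuppD_le; rewrite mem_cat => /orP[/hP|/hQ]. Qed.

Lemma order_leZ N c P : order_le N P -> order_le N (c *: P).
Proof. by move=> hP m /msuppZ_le /hP. Qed.

Lemma order_le_coef_deriv N i P : order_le N P -> order_le N (coef_deriv i P).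
Proof.
move=> hP m; rewrite mcoeff_msupp => h; apply: hP; rewrite mcoeff_msupp.
apply: contraNneq h => h; rewrite /coef_deriv raddf_sum /= big_seq big1 // => k hk.
rewrite mcoeffZ mcoeffX; case: eqP => [->|_]; last by rewrite mulr0.
by rewrite h delta0 mul0r.
Qed.

Lemma order_le_deriv N i P : order_le N P -> order_le N.+1 (left_deriv i P).
Proof.
move=> hP m /msuppD_le; rewrite mem_cat => /orP[].
  move=> /msuppM_le /allpairsP[[m1 m2] /= [h1 h2 ->]].
  move: h1; rewrite msuppX inE => /eqP ->.
  by rewrite mdegD mdeg1 add1n ltnS hP.
by move/(order_le_coef_deriv hP)/leqW.
Qed.

Section Symbol.
Variables (S : comNzRingType) (ev : {rmorphism K -> S}).

(** The homogeneous symbol of degree [N], made inhomogeneous by setting the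
second covariable to 1. *)
Definition symb N P : {poly S} :=
  \sum_(m <- msupp P) (if mdeg m == N then ev (mcoeff m P) else 0) *: 'X^(m ord0).

Lemma symbD N P Q : symb N (P + Q) = symb N P + symb N Q.
Proof.
rewrite /symb (msupp_sumD (G := fun m c =>
  (if mdeg m == N then ev c else 0) *: 'X^(m ord0))) //.
  by move=> m; rewrite rmorph0 if_same scale0r.
by move=> m a b; rewrite rmorphD; case: ifP => _; rewrite ?scale0r ?addr0 // scalerDl.
Qed.

Lemma symbZX N c m : symb N (c *: mpolyX K m) =
  (if mdeg m == N then ev c else 0) *: 'X^(m ord0).
Proof.
rewrite /symb (msupp_sumZX (G := fun m c =>
  (if mdeg m == N then ev c else 0) *: 'X^(m ord0))) //.
by move=> k; rewrite rmorph0 if_same scale0r.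
Qed.

Lemma symb0 N : symb N 0 = 0.
Proof. by rewrite /symb msupp0 big_nil. Qed.

Lemma symbZ N c P : symb N (c *: P) = ev c *: symb N P.
Proof.
elim/mpolyind: P => [|b m P _ _ IH]; first by rewrite scaler0 symb0 scaler0.
rewrite scalerDr !symbD IH scalerA !symbZX scalerDr rmorphM; congr (_ + _).
by case: ifP => _; rewrite ?scale0r ?scaler0 // scalerA.
Qed.

Lemma symb_X0 N P : symb N.+1 (mpolyX K (mnm1 ord0) * P) = 'X * symb N P.
Proof.
elim/mpolyind: P => [|c m P _ _ IH]; first by rewrite mulr0 !symb0 mulr0.
rewrite mulrDr !symbD mulrDr IH scalerXr !symbZX mdegD mdeg1 add1n eqSS.
by rewrite mnmDE mnm1E /= add1n exprS -scalerAr.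
Qed.

Lemma symb_X1 N P : symb N.+1 (mpolyX K (mnm1 ord_max) * P) = symb N P.
Proof.
elim/mpolyind: P => [|c m P _ _ IH]; first by rewrite mulr0 !symb0.
rewrite mulrDr !symbD IH scalerXr !symbZX mdegD mdeg1 add1n eqSS.
by rewrite mnmDE mnm1E /= add0n.
Qed.

Lemma symb_order N P : order_le N P -> symb N.+1 P = 0.
Proof.
move=> hP; rewrite /symb big_seq big1 // => m /hP; case: eqP => [->|_].
  by rewrite ltnn.
by rewrite scale0r.
Qed.

Lemma symb_size N P : (size (symb N P) <= N.+1)%N.
Proof.
rewrite /symb; elim/big_rec: _ => [|m f _ hf]; first by rewrite size_poly0.
apply: leq_trans (size_polyD _ _) _; rewrite geq_max hf andbT.
case: eqP => [<-|_]; last by rewrite scale0r size_poly0.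
apply: leq_trans (size_scale_leq _ _) _; rewrite size_polyXn ltnS.
by rewrite mdegE big_ord_recl leq_addr.
Qed.
End Symbol.
End ActTheory.

Section SymbolIdeal.
Variable R : realType.
Local Notation C := (Cx R).
Local Notation DO := (mpoly 2 (mpoly 2 C)).
Variables (D1 D3 : diffop R) (p : C * C).
Implicit Types (P Q : DO) (f g : {poly C}) (u : mpoly 2 C).

Lemma poly_weylD P Q u : poly_weyl (P + Q : DO) u = poly_weyl P u + poly_weyl Q u.
Proof. by apply: gactD => *; rewrite ?mul0r ?mulrDl. Qed.

Lemma poly_weyl0 u : poly_weyl (0 : DO) u = 0.
Proof. exact: gact0. Qed.

Lemma poly_weylZ (c : mpoly 2 C) P u : poly_weyl (c *: P : DO) u = c * poly_weyl P u.
Proof. by apply: gactZ => *; rewrite ?mul0r ?mulr0 ?mulrDl ?mulrDr ?mulrA. Qed.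

Definition weyl_deriv i P : DO := left_deriv (fun j (a : mpoly 2 C) => mderiv j a) i P.

Lemma poly_weyl_deriv i P u :
  poly_weyl (weyl_deriv i P) u = mderiv i (poly_weyl P u).
Proof.
apply: (gact_deriv (d := fun i (g : mpoly 2 C) => mderiv i g)) => *;
  rewrite ?mul0r ?mulr0 ?mulrDl ?mulrDr ?mulrA ?mderiv0 ?mderivD ?mderivM //.
by rewrite mderiv_comm.
Qed.

Lemma left_idealD P Q : left_ideal D1 D3 P -> left_ideal D1 D3 Q ->
  left_ideal D1 D3 (P + Q : DO).
Proof.
move=> [A [B h]] [A' [B' h']]; exists ((A : DO) + (A' : DO)), ((B : DO) + (B' : DO)) => u.
have := congr2 +%R (h u) (h' u); rewrite addrACA => E.
apply: etrans (poly_weylD P Q u) (etrans E _).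
by apply: (congr2 +%R); apply/esym; apply: poly_weylD.
Qed.

Lemma left_idealZ (c : mpoly 2 C) P : left_ideal D1 D3 P -> left_ideal D1 D3 (c *: P : DO).
Proof.
move=> [A [B h]]; exists (c *: (A : DO)), (c *: (B : DO)) => u.
have := congr1 ( *%R c) (h u); rewrite /= mulrDr => E.
apply: etrans (poly_weylZ c P u) (etrans E _).
by apply: (congr2 +%R); apply/esym; apply: poly_weylZ.
Qed.

Lemma left_ideal0 : left_ideal D1 D3 (0 : DO).
Proof. exists (0 : DO), (0 : DO) => u; apply: etrans (poly_weyl0 u) _.
by apply/esym/(etrans (congr2 +%R (poly_weyl0 _) (poly_weyl0 _))); rewrite addr0. Qed.

Lemma left_ideal_deriv i P : left_ideal D1 D3 P -> left_ideal D1 D3 (weyl_deriv i P).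
Proof.
move=> [A [B h]]; exists (weyl_deriv i A), (weyl_deriv i B) => u.
have := congr1 (fun f : mpoly 2 C => mderiv i f) (h u); rewrite /= mderivD => E.
apply: etrans (poly_weyl_deriv i P u) (etrans E _).
by apply: (congr2 +%R); apply/esym; apply: poly_weyl_deriv.
Qed.

Let ev : {rmorphism mpoly 2 C -> C} := meval (Defs.coord p).
Let symb := @symb (mpoly 2 C) C ev.

(** [f] is the dehomogenised symbol of degree [N] at [p] of an element of the
ideal. For varying [N] these polynomials form an ideal of binary forms; the
index [N] keeps track of the behaviour at the covector (1, 0). *)
Definition form N f := exists P, [/\ left_ideal D1 D3 P, order_le N P & symb N P = f].

Lemma formD N f g : form N f -> form N g -> form N (f + g).
Proof.
move=> [P [lP oP <-]] [Q [lQ oQ <-]]; exists (P + Q).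
by split; [exact: left_idealD | exact: order_leD | rewrite /symb symbD].
Qed.

Lemma formZ N a f : form N f -> form N (a *: f).
Proof.
move=> [P [lP oP <-]]; exists (mpolyC 2 a *: P).
by split; [exact: left_idealZ | exact: order_leZ | rewrite /symb symbZ /ev /= mevalC].
Qed.

Lemma form0 N : form N 0.
Proof. by exists 0; split; [exact: left_ideal0 | move=> m; rewrite msupp0 | exact: symb0]. Qed.

Lemma formX N f : form N f -> form N.+1 ('X * f).
Proof.
move=> [P [lP oP <-]]; exists (weyl_deriv ord0 P); split.
- exact: left_ideal_deriv.
- by apply: order_le_deriv oP => *; rewrite mderiv0.
by rewrite /symb symbD symb_X0 (symb_order _ (order_le_coef_deriv (@mderiv0 2 C) oP)) addr0.
Qed.

Lemma formS N f : form N f -> form N.+1 f.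
Proof.
move=> [P [lP oP <-]]; exists (weyl_deriv ord_max P); split.
- exact: left_ideal_deriv.
- by apply: order_le_deriv oP => *; rewrite mderiv0.
by rewrite /symb symbD symb_X1 (symb_order _ (order_le_coef_deriv (@mderiv0 2 C) oP)) addr0.
Qed.

Lemma form_le N M f : (N <= M)%N -> form N f -> form M f.
Proof.
by move=> NM hf; rewrite -(subnK NM); elim: (M - N)%N => // k IH; apply: formS.
Qed.

Lemma formXn N k f : form N f -> form (N + k) ('X^k * f).
Proof.
move=> hf; elim: k => [|k IH]; first by rewrite addn0 mul1r.
by rewrite addnS exprS -mulrA; apply: formX.
Qed.

Lemma form_sum N (I : Type) (s : seq I) (f : I -> {poly C}) :
  (forall i, form N (f i)) -> form N (\sum_(i <- s) f i).
Proof.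
move=> h; elim: s => [|i s IH]; first by rewrite big_nil; exact: form0.
by rewrite big_cons; apply: formD.
Qed.

Lemma form_mul N f g : form N f -> form (N + size g) (g * f).
Proof.
move=> hf; rewrite -[g]coefK poly_def mulr_suml; apply: form_sum => i.
rewrite -scalerAl; apply: formZ; apply: (form_le _ (formXn i hf)).
by rewrite -poly_def coefK leq_add2l ltnW.
Qed.

Hypothesis nonsing : ~ singular_locus D1 D3 p.

Lemma nonsing_symbol xi : xi != (0, 0) ->
  exists N P, [/\ left_ideal D1 D3 P, order_le N P & symbol N P p xi != 0].
Proof.
move=> xi0; apply: contrapT => H; apply: nonsing; exists xi => // N P lP oP.
by apply/eqP/negP => /negP h; apply: H; exists N, P.
Qed.

Lemma symbol_symb N P (x : C) : symbol N P p (x, 1) = (symb N P).[x].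
Proof.
rewrite /symbol /symb horner_sum [LHS]big_mkcond; apply: eq_bigr => m _.
by case: ifP => _; rewrite hornerZ ?mul0r // hornerXn expr1n mulr1.
Qed.

(** The covector (1, 0) is the point at infinity of the dehomogenisation, where a
form of degree [N] takes its coefficient of degree [N] as value. *)
Lemma symbol_symb_infty N P : symbol N P p (1, 0) = (symb N P)`_N.
Proof.
rewrite /symbol /symb coef_sum [LHS]big_mkcond; apply: eq_bigr => m _.
case: eqP => mN; rewrite coefZ ?mul0r // coefXn expr1n mulr1 expr0n.
congr (_ * _%:R); move: mN; rewrite mdegE big_ord_recl big_ord1 lift_ord_max => <-.
by rewrite -{2}(addn0 (m ord0)) eqn_add2l.
Qed.

(** Euclidean descent: a form [f] of positive degree has a root, at which some
other symbol of the ideal does not vanish; its remainder modulo [f] is again a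
symbol, is nonzero and has smaller degree. *)
Lemma form_one : exists N, form N 1.
Proof.
have [|N [P [lP oP sP]]] := @nonsing_symbol (1, 0); first by rewrite xpair_eqE oner_eq0.
suff H n : forall N f, form N f -> f != 0 -> (size f <= n)%N -> exists N, form N 1.
  apply: (H (size (symb N P)) N (symb N P)) => //; first by exists P.
  by apply: contraNneq sP => h; rewrite symbol_symb_infty h coef0.
elim: n => [|n IH] M f hf f0 sf.
  by move: f0; rewrite -size_poly_leq0 sf.
have [/size_poly1P[c c0 fc]|] := boolP (size f == 1)%N.
  by exists M; rewrite -[1](_ : c^-1 *: f = _); [apply: formZ|rewrite fc -mul_polyC -polyCM mulVf].
move=> /closed_rootP[x0 rx].
have [|M' [Q [lQ oQ]]] := @nonsing_symbol (x0, 1).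
  by rewrite xpair_eqE oner_eq0 andbF.
rewrite symbol_symb => hx; pose h := symb M' Q.
apply: (IH (M' + (M + size (- (h %/ f))))%N (h %% f)).
- have -> : h %% f = h + (- (h %/ f)) * f by rewrite {2}(divp_eq h f) mulNr addrAC subrr add0r.
  apply: formD; first by apply: (form_le (N := M')); [exact: leq_addr | exists Q].
  by apply: (form_le (leq_addl _ _)); apply: form_mul.
- apply: contraNneq hx => h0; rewrite -/h (divp_eq h f) h0 addr0 hornerM.
  by move/rootP: rx => ->; rewrite mulr0.
by rewrite -ltnS; apply: leq_trans sf; rewrite ltn_modp.
Qed.

(** A symbol that is nonzero at (1, 0) has full degree [N1], and allows to reduce
the monomials of degree larger than [N1]; the others are multiples of 1. *)
Lemma form_monomials : exists K, forall a, (a <= K)%N -> form K 'X^a.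
Proof.
have [N0 h0] := form_one.
have [|N1 [P [lP oP]]] := @nonsing_symbol (1, 0); first by rewrite xpair_eqE oner_eq0.
rewrite symbol_symb_infty => fN; set f := symb N1 P in fN.
have hf : form N1 f by exists P.
exists (N0 + N1)%N; elim/ltn_ind => a IH aK.
have [aN|Na] := leqP a N1.
  rewrite -[X in form _ X]mulr1; apply: (form_le _ (formXn a h0)).
  by rewrite leq_add2l.
have h : form (N0 + N1) ('X^(a - N1) * f).
  by apply: (form_le _ (formXn (a - N1) hf)); rewrite subnKC // ltnW.
have E : 'X^(a - N1) * f = \sum_(i < N1) f`_i *: 'X^(a - N1 + i) + f`_N1 *: 'X^a.
  transitivity ('X^(a - N1) * (\sum_(i < N1.+1) f`_i *: 'X^i)).
    congr (_ * _); rewrite -poly_def; apply/polyP => i; rewrite coef_poly.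
    by case: ltnP => // hi; rewrite nth_default // (leq_trans (symb_size _ _ _)).
  rewrite mulr_sumr big_ord_recr /= -scalerAr -exprD subnK ?(ltnW Na) //.
  by congr (_ + _); apply: eq_bigr => i _; rewrite -scalerAr -exprD.
have -> : 'X^a = (f`_N1)^-1 *: ('X^(a - N1) * f - \sum_(i < N1) f`_i *: 'X^(a - N1 + i)).
  by rewrite E addrAC subrr add0r scalerA mulVf // scale1r.
apply/formZ/formD => //; rewrite -scaleN1r; apply/formZ/form_sum => i.
apply/formZ/IH; first by have := ltn_ord i; lia.
by have := ltn_ord i; lia.
Qed.

End SymbolIdeal.

(** * Convergence of formal solutions near a nonsingular point *)

Section CauchyEstimate.
Variable R : realType.
Local Notation C := (Cx R).
Local Notation FS := (FS R).
Local Notation DO := (mpoly 2 (mpoly 2 C)).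
Local Notation "z -2 p" := (z.1 - p.1, z.2 - p.2) (at level 50).
Implicit Types (A B : FS) (p q : C * C) (e G : R).

(** The derivatives of order [n] of a function which is bounded on a disc of
radius [e] are at most a constant times [wt e n]. *)
Definition wt e n : R := n`!%:R / e ^+ n.

Lemma wt_ge0 e n : 0 < e -> 0 <= wt e n.
Proof. by move=> e0; rewrite divr_ge0 // exprn_ge0 // ltW. Qed.

Lemma wt_gt0 e n : 0 < e -> 0 < wt e n.
Proof. by move=> e0; rewrite divr_gt0 ?factR_gt0 // exprn_gt0. Qed.

Lemma wtS e n : 0 < e -> e * wt e n.+1 = n.+1%:R * wt e n.
Proof.
by move=> e0; rewrite /wt factS natrM exprS; field; rewrite expf_neq0 ?gt_eqF.
Qed.

Lemma wt_lt e n m : 0 < e <= 1 -> (n < m)%N -> wt e n <= e * wt e m.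
Proof.
move=> /andP[e0 e1]; elim: m => // m IH; rewrite ltnS leq_eqVlt => /orP[/eqP->|nm].
  by rewrite wtS // ler_peMl ?wt_ge0 // ler1n.
apply: le_trans (IH nm) _; rewrite wtS //.
apply: (@le_trans _ _ (wt e m)); first by rewrite ler_piMl ?wt_ge0.
by rewrite ler_peMl ?wt_ge0 // ler1n.
Qed.

(** The offset [b] lets [B] stand for a derivative of order [b] of the series
under study: it is measured by the weights of the original indices. *)
Definition weighted e b G N B :=
  forall i j, (i + j + b <= N)%N -> cabs (B i j) <= G * wt e (i + j + b).

Lemma weightedD e b G G' N A B : weighted e b G N A -> weighted e b G' N B ->
  weighted e b (G + G') N (A + B).
Proof.
move=> hA hB i j ij; rewrite addFE; apply: le_trans (cabsD _ _) _.
by rewrite mulrDl lerD ?hA ?hB.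
Qed.

Lemma weightedZ e b G N c A : weighted e b G N A ->
  weighted e b (cabs c * G) N (c *: A).
Proof.
by move=> hA i j ij; rewrite scaleFE cabsM -mulrA ler_wpM2l ?cabs_ge0 ?hA.
Qed.

Lemma weighted_le e b G G' N A : 0 < e -> G <= G' -> weighted e b G N A -> weighted e b G' N A.
Proof.
by move=> e0 GG' h i j ij; apply: le_trans (h i j ij) _; rewrite ler_wpM2r ?wt_ge0.
Qed.

(** Multiplication by a local coordinate gains the factor [e] while it keeps the
offset; this gain drives the whole estimate. *)
Lemma weighted_wF e b G N i A : 0 < e -> 0 <= G -> weighted e b G N A ->
  weighted e b (e * G) N (wF i A).
Proof.
move=> e0 G0 hA n m nm; rewrite /wF; case: eqP => _.
  case: n nm => [|n] nm; first by rewrite mul0r cabs0 (mulr_ge0 (mulr_ge0 (ltW e0) G0) (wt_ge0 _ e0)).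
  rewrite cabsM cabs_nat /= addSn addSn [e * G]mulrC -mulrA wtS // mulrCA.
  apply: ler_pM; rewrite ?cabs_ge0 //; first by rewrite ler_nat; lia.
  by apply: hA; lia.
case: m nm => [|m] nm; first by rewrite mul0r cabs0 (mulr_ge0 (mulr_ge0 (ltW e0) G0) (wt_ge0 _ e0)).
rewrite cabsM cabs_nat /= addnS addSn [e * G]mulrC -mulrA wtS // mulrCA.
apply: ler_pM; rewrite ?cabs_ge0 //; first by rewrite ler_nat; lia.
by apply: hA; lia.
Qed.

Lemma weighted_dF e b G N i A : weighted e b G N A ->
  weighted e b.+1 G N (dF i A).
Proof.
by move=> h n m nm; rewrite /dF; case: eqP => _;
  (have -> : (n + m + b.+1 = n.+1 + m + b)%N by lia);
  [apply: h; lia | rewrite addSn -addnS; apply: h; lia].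
Qed.

Lemma weighted_iter_dF e b G N i k A : weighted e b G N A ->
  weighted e (k + b) G N (iter k (dF i) A).
Proof. by move=> h; elim: k => [|k IH] //=; rewrite addSn; apply: weighted_dF. Qed.

Definition close e p q := cabs (q.1 - p.1) <= e /\ cabs (q.2 - p.2) <= e.

Lemma close_coord e p q i : close e p q -> cabs (Defs.coord q i - Defs.coord p i) <= e.
Proof. by move=> [h1 h2]; rewrite /Defs.coord; case: eqP. Qed.

Lemma weighted_shift e p q b G N i A : 0 < e -> 0 <= G -> close e p q -> weighted e b G N A ->
  weighted e b (2 * e * G) N (xF q i A - Defs.coord p i *: A).
Proof.
move=> e0 G0 pq hA.
have -> : xF q i A - Defs.coord p i *: A = (Defs.coord q i - Defs.coord p i) *: A + wF i A.
  by rewrite /xF scalerBl addrAC.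
have h := weightedD (weightedZ (Defs.coord q i - Defs.coord p i) hA) (weighted_wF i e0 G0 hA).
apply: weighted_le h => //.
have := close_coord i pq; move/(ler_wpM2r G0); lra.
Qed.

(** Near [p] a coefficient differs from its value at [p] by an operator of size
[O(e)], with a constant that depends on the coefficient alone. *)
Lemma weighted_mulF p (c : mpoly 2 C) : exists2 K : R, 0 <= K &
  forall e q b G N A, 0 < e <= 1 -> 0 <= G -> close e p q -> weighted e b G N A ->
    weighted e b (K * e * G) N (mulF q c A - meval (Defs.coord p) c *: A).
Proof.
elim/mpoly_XD_ind: c => [|i c [K K0 HK]|a c c' [K K0 HK] [K' K'0 HK']].
- exists 0 => // e q b G N A e01 G0 pq hA.
  by rewrite mulF1 meval1 scale1r subrr !mul0r => i j _; rewrite zeroFE cabs0 mul0r.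
- exists ((cabs (Defs.coord p i) + 2) * K + 2 * cabs (meval (Defs.coord p) c)).
    by rewrite addr_ge0 ?mulr_ge0 ?addr_ge0 ?cabs_ge0.
  move=> e q b G N A e01 G0 pq hA; have /andP[e0 e1] := e01.
  rewrite mulF_X mevalM mevalXU.
  set cp := meval (Defs.coord p) c; set pi := Defs.coord p i.
  have h := HK e q b G N A e01 G0 pq hA; rewrite -/cp in h.
  set E := mulF q c A - cp *: A in h.
  have E' : mulF q c A = E + cp *: A by rewrite /E subrK.
  clearbody E.
  have -> : xF q i (mulF q c A) - (pi * cp) *: A =
    (pi *: E + (xF q i E - pi *: E)) + cp *: (xF q i A - pi *: A).
    rewrite E' (linD (lin_xF q i)) (linZ (lin_xF q i)) scalerBr !scalerA.
    by rewrite [pi *: E + _]addrC subrK [cp * pi]mulrC addrA.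
  have KG : 0 <= K * e * G by rewrite !mulr_ge0 // ltW.
  have h1 := weightedD (weightedD (weightedZ pi h) (weighted_shift i e0 KG pq h))
    (weightedZ cp (weighted_shift i e0 G0 pq hA)).
  apply: weighted_le h1 => //.
  have := ler_wpM2r KG e1; rewrite mul1r /pi /cp; lra.
exists (cabs a * K + K'); first by rewrite addr_ge0 // mulr_ge0 // cabs_ge0.
move=> e q b G N A e01 G0 pq hA; have /andP[e0 e1] := e01.
have -> : mulF q (a *: c + c') A - meval (Defs.coord p) (a *: c + c') *: A =
  a *: (mulF q c A - meval (Defs.coord p) c *: A) + (mulF q c' A - meval (Defs.coord p) c' *: A).
  rewrite mulFD mulFZ mevalD mevalZ scalerDl scalerBr opprD addrACA.
  by rewrite scalerA.
have h := weightedD (weightedZ a (HK e q b G N A e01 G0 pq hA)) (HK' e q b G N A e01 G0 pq hA).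
by apply: weighted_le h => //; lra.
Qed.

Lemma weighted_ev K (v : nat -> C) (f : {poly C}) (a : nat) : (a <= K)%N ->
  f = 'X^a -> \sum_(k < K.+1) f`_k * v k = v a.
Proof.
move=> aK ->; have aK' : (a < K.+1)%N by [].
rewrite (bigD1 (Ordinal aK')) //= coefXn eqxx mul1r big1 ?addr0 // => k.
by rewrite -val_eqE /= coefXn => /negbTE ->; rewrite mul0r.
Qed.

Lemma FS_sumE (I : Type) (s : seq I) (F : I -> FS) i j :
  (\sum_(k <- s) F k) i j = \sum_(k <- s) F k i j.
Proof. by elim: s => [|k s IH]; rewrite ?big_nil // !big_cons addFE IH. Qed.

(** Freezing the coefficients of [P] at [p] leaves the derivative
[d0 ^ a d1 ^ (K - a)]. The error comes from the variation of the coefficients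
and from the terms of lower order, and both carry a factor [e]. *)
Lemma operator_estimate p K a (P : DO) : (a <= K)%N -> order_le K P ->
  symb (meval (Defs.coord p)) K P = 'X^a ->
  exists2 M : R, 0 <= M & forall e q G N A i j,
    0 < e <= 1 -> 0 <= G -> close e p q -> weighted e 0 G N A ->
    weylF q P A = 0 -> (i + j + K <= N)%N ->
    cabs (A (i + a)%N (j + (K - a))%N) <= M * e * G * wt e (i + j + K).
Proof.
move=> aK oP sP; pose ev := meval (Defs.coord p).
have /choice[Kf HK] : forall c : mpoly 2 C, exists Kc : R, 0 <= Kc /\
  forall e q b G N A, 0 < e <= 1 -> 0 <= G -> close e p q -> weighted e b G N A ->
    weighted e b (Kc * e * G) N (mulF q c A - ev c *: A).
  by move=> c; have [k k0 hk] := weighted_mulF p c; exists k.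
pose M m := Kf (mcoeff m P) + cabs (ev (mcoeff m P)).
have M0 m : 0 <= M m by rewrite addr_ge0 ?cabs_ge0 //; case: (HK (mcoeff m P)).
exists (\sum_(m <- msupp P) M m); first exact: sumr_ge0.
move=> e q G N A i j e01 G0 pq hA PA ijN; have /andP[e0 e1] := e01.
pose D (m : multinom 2) : FS := iter (m ord0) (dF ord0) (iter (m ord_max) (dF ord_max) A).
have mdegE2 (m : multinom 2) : mdeg m = (m ord0 + m ord_max)%N.
  by rewrite mdegE big_ord_recl big_ord1 lift_ord_max.
have hD m : weighted e (mdeg m) G N (D m).
  have hA1 : weighted e (m ord_max + 0) G N (iter (m ord_max) (dF ord_max) A).
    exact: weighted_iter_dF.
  have : weighted e (m ord0 + (m ord_max + 0)) G N (D m) by exact: weighted_iter_dF.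
  by rewrite mdegE2 addn0.
have main : A (i + a)%N (j + (K - a))%N =
    \sum_(m <- msupp P) (if mdeg m == K then ev (mcoeff m P) else 0) * D m i j.
  pose v k := A (i + k)%N (j + (K - k))%N.
  rewrite -/(v a) -(weighted_ev v aK sP) /symb.
  under eq_bigr do rewrite coef_sum mulr_suml.
  rewrite exchange_big /= big_seq [RHS]big_seq; apply: eq_bigr => m mP.
  under eq_bigr do rewrite coefZ coefXn -mulrA.
  rewrite -mulr_sumr; case: eqP => mK; last by rewrite !mul0r.
  congr (_ * _); rewrite /D iter_dF /v.
  have mK' : (m ord0 < K.+1)%N by rewrite -mK mdegE2 ltnS leq_addr.
  rewrite (bigD1 (Ordinal mK')) //= eqxx mul1r big1 ?addr0.
    by congr (A _ (_ + _)%N); rewrite -mK mdegE2 addKn.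
  by move=> k; rewrite -val_eqE /= => /negbTE ->; rewrite mul0r.
have zero : \sum_(m <- msupp P) mulF q (mcoeff m P) (D m) i j = 0.
  have := congr1 (fun B : FS => B i j) PA.
  by rewrite /weylF /act FS_sumE.
have -> : A (i + a)%N (j + (K - a))%N = \sum_(m <- msupp P)
   ((if mdeg m == K then ev (mcoeff m P) else 0) * D m i j - mulF q (mcoeff m P) (D m) i j).
  by rewrite sumrB -main zero subr0.
apply: le_trans (cabs_sum _ _ _) _; rewrite !mulr_suml big_seq [leRHS]big_seq.
apply: ler_sum => m mP.
have [_ /(_ e q (mdeg m) G N (D m) e01 G0 pq (hD m)) hm] := HK (mcoeff m P).
have mK := oP m mP.
have K0 : 0 <= Kf (mcoeff m P) by case: (HK (mcoeff m P)).
have hm' : cabs (ev (mcoeff m P) * D m i j - mulF q (mcoeff m P) (D m) i j) <=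
    Kf (mcoeff m P) * e * G * wt e (i + j + mdeg m).
  by rewrite cabs_distC; apply: hm; lia.
have Ke0 : 0 <= Kf (mcoeff m P) * e * G by rewrite !mulr_ge0 // ltW.
case: eqP => [mEK|/eqP mNK].
  rewrite -mEK; apply: le_trans hm' _; rewrite ler_wpM2r ?wt_ge0 // ler_wpM2r //.
  by rewrite ler_wpM2r ?(ltW e0) // /M lerDl cabs_ge0.
have ltmK : (mdeg m < K)%N by rewrite ltn_neqAle mNK.
have hw : wt e (i + j + mdeg m) <= e * wt e (i + j + K) by apply: wt_lt => //; lia.
have w1 : wt e (i + j + mdeg m) <= wt e (i + j + K).
  by apply: le_trans hw _; rewrite ler_piMl ?wt_ge0.
have -> : 0 * D m i j - mulF q (mcoeff m P) (D m) i j =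
  (ev (mcoeff m P) * D m i j - mulF q (mcoeff m P) (D m) i j) - ev (mcoeff m P) * D m i j.
  by ring.
apply: le_trans (cabsB _ _) _; rewrite /M !mulrDl; apply: lerD.
  by apply: le_trans hm' _; rewrite ler_wpM2l.
rewrite cabsM -!mulrA ler_wpM2l ?cabs_ge0 //.
apply: le_trans (hD m i j _) _; first by lia.
by rewrite [leRHS]mulrCA ler_wpM2l.
Qed.

Lemma wt_ge1 e n : 0 < e <= 1 -> 1 <= wt e n.
Proof.
move=> /andP[e0 e1]; rewrite /wt ler_pdivlMr ?exprn_gt0 // mul1r.
by apply: (@le_trans _ _ 1); rewrite ?exprn_ile1 ?(ltW e0) // ler1n fact_gt0.
Qed.

Lemma sum_box_bound K (F : nat -> nat -> R) i j : (forall i j, 0 <= F i j) ->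
  (i < K)%N -> (j < K)%N -> F i j <= \sum_(k < K) \sum_(l < K) F k l.
Proof.
move=> F0 iK jK; rewrite (bigD1 (Ordinal iK)) //= (bigD1 (Ordinal jK)) //= -addrA lerDl.
by rewrite addr_ge0 ?sumr_ge0 // => *; rewrite sumr_ge0.
Qed.

(** For small [e] the previous estimate bounds the derivatives of order [L] by
half of what is needed, so the best constant for the orders up to [L] equals
the one for the orders below [K]. The estimate is uniform in the centre [q]. *)
Lemma cauchy_estimate (D1 D3 : diffop R) p : ~ singular_locus D1 D3 p ->
  exists2 r : R, 0 < r & forall q, close r p q -> forall A,
    thetaF q D1 A = 0 -> thetaF q D3 A = 0 -> growth r A.
Proof.
move=> ns; have [K HK] := form_monomials ns.
have /choice[M HM] : forall a, exists M : R, 0 <= M /\ ((a <= K)%N ->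
   forall e q G N A i j, 0 < e <= 1 -> 0 <= G -> close e p q -> weighted e 0 G N A ->
    thetaF q D1 A = 0 -> thetaF q D3 A = 0 -> (i + j + K <= N)%N ->
    cabs (A (i + a)%N (j + (K - a))%N) <= M * e * G * wt e (i + j + K)).
  move=> a; case: (leqP a K) => aK; last by exists 0.
  have [P [lP oP sP]] := HK a aK; have [M M0 HM] := operator_estimate aK oP sP.
  exists M; split=> // _ e q G N A i j e01 G0 pq hA h1 h3.
  apply: (HM e q G N A i j e01 G0 pq hA).
  exact: left_ideal_formal lP h1 h3.
pose Mx := \sum_(a < K.+1) M a.
have Mx0 : 0 <= Mx by apply: sumr_ge0 => a _; case: (HM a).
have MMx a : (a <= K)%N -> M a <= Mx.
  move=> aK; rewrite /Mx (bigD1 (Ordinal (aK : (a < K.+1)%N))) //= lerDl.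
  by apply: sumr_ge0 => b _; case: (HM b).
(* With this e the constant Mx * e is at most 1/2. *)
pose e := (2 * (Mx + 1))^-1.
have e0 : 0 < e by rewrite invr_gt0; lra.
have e1 : e <= 1 by rewrite /e invf_le1; lra.
have Me : Mx * e <= 2^-1.
  by rewrite /e ler_pdivrMr; lra.
have e01 : 0 < e <= 1 by rewrite e0.
exists (e / 2); first by lra.
move=> q pq' A h1 h3.
have pq : close e p q by case: pq' => c1 c2; split; lra.
pose G0 := \sum_(i < K) \sum_(j < K) cabs (A i j).
have G00 : 0 <= G0 by apply: sumr_ge0 => i _; apply: sumr_ge0 => j _; apply: cabs_ge0.
have low i j : (i + j < K)%N -> cabs (A i j) <= G0 * wt e (i + j).
  move=> ij; apply: (@le_trans _ _ G0).
    by apply: (@sum_box_bound K (fun i j => cabs (A i j))) => [*||];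
      [apply: cabs_ge0 | lia | lia].
  by rewrite ler_peMr // wt_ge1.
have bound : forall L i j, (i + j < L)%N -> cabs (A i j) <= G0 * wt e (i + j).
  elim=> // L IH i j; rewrite ltnS leq_eqVlt => /orP[/eqP ijL|]; last exact: IH.
  have [|KL] := ltnP L K; first by rewrite -ijL => /low.
  pose B := \big[Num.max/(0 : R)]_(k < L.+1) (cabs (A k (L - k)%N) / wt e L).
  have B0 : 0 <= B by exact: bigmax_ge_id.
  pose G := Num.max G0 B.
  have G_ge0 : 0 <= G by rewrite le_max G00.
  have wL : 0 < wt e L by apply: wt_gt0.
  have AB k : (k <= L)%N -> cabs (A k (L - k)%N) <= B * wt e L.
    move=> kL; rewrite -ler_pdivrMr //.
    exact: (le_bigmax _ (fun k : 'I_L.+1 => cabs (A k (L - k)%N) / wt e L)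
             (Ordinal (kL : (k < L.+1)%N))).
  have hA : weighted e 0 G L A.
    move=> i' j'; rewrite addn0 leq_eqVlt => /orP[/eqP ij'|ij'].
      rewrite ij'; have -> : j' = (L - i')%N by lia.
      apply: le_trans (AB i' _) _; first by lia.
      by rewrite ler_wpM2r ?(ltW wL) // /G le_max lexx orbT.
    apply: le_trans (IH _ _ ij') _; rewrite ler_wpM2r ?wt_ge0 //.
    by rewrite /G le_max lexx.
  (* The index k splits off a derivations in the first variable. *)
  have half k : (k <= L)%N -> cabs (A k (L - k)%N) <= G / 2 * wt e L.
    move=> kL; pose a := minn k K.
    have aK : (a <= K)%N by rewrite geq_minr.
    have [Ma0 /(_ aK e q G L A (k - a)%N (L - k - (K - a))%N e01 G_ge0 pq hA h1 h3)] := HM a.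
    have e1' : (k - a + (L - k - (K - a)) + K = L)%N by rewrite /a; lia.
    have -> : (k - a + a = k)%N by rewrite /a; lia.
    have -> : (L - k - (K - a) + (K - a) = L - k)%N by rewrite /a; lia.
    rewrite e1' leqnn => /(_ isT) h; apply: le_trans h _.
    rewrite ler_wpM2r ?(ltW wL) // [G / 2]mulrC ler_wpM2r //.
    by apply: le_trans Me; rewrite ler_wpM2r ?(ltW e0) // MMx.
  have BG : B <= G / 2.
    apply: bigmax_le; first by rewrite divr_ge0.
    by move=> k _; rewrite ler_pdivrMr // half // -ltnS.
  have GG0 : G <= G0.
    move: BG; rewrite /G; case: (leP B G0) => // h1' h2'; lra.
  have := hA i j; rewrite addn0 ijL leqnn => /(_ isT) h.
  by apply: le_trans h _; rewrite ler_wpM2r // ltW.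
apply: (@coef_bound_growth _ _ G0) => i j.
have := bound _ _ _ (ltnSn (i + j)); rewrite /wt => h.
have eij : 0 < (e / 2) ^+ (i + j) by rewrite exprn_gt0 //; lra.
have := ler_wpM2r (ltW eij) h => {}h; apply: le_trans h _.
rewrite expr_div_n.
have -> : G0 * ((i + j)`!%:R / e ^+ (i + j)) * (e ^+ (i + j) / 2 ^+ (i + j)) =
  G0 * ((i + j)`!%:R / 2 ^+ (i + j)).
  by field; rewrite !expf_neq0 // gt_eqF.
apply: ler_wpM2l => //; rewrite ler_pdivrMr ?exprn_gt0 //.
have := @bin_expr_le R (i + j) i 1 1 ler01 ler01 (leq_addr j i).
rewrite !expr1n !mulr1 => hb.
rewrite -(bin_fact (leq_addr j i)) addKn natrM mulrC ler_wpM2l //.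
Qed.

End CauchyEstimate.

(** * Second order operators and their leading forms *)

Section LeadingPart.
Variable R : realType.
Local Notation C := (Cx R).
Local Notation FS := (FS R).
Implicit Types (A B : FS) (q : C * C).

Definition vanish N A := forall i j, (i + j < N)%N -> A i j = 0.

Lemma vanish_le N M A : (M <= N)%N -> vanish N A -> vanish M A.
Proof. by move=> MN h i j ij; apply: h; lia. Qed.

Lemma vanish_dF N k A : vanish N.+1 A -> vanish N (dF k A).
Proof. by move=> h i j ij; rewrite /dF; case: eqP => _; apply: h; lia. Qed.

(** On the lowest degree of [A], multiplication by a polynomial is multiplication
by its value at the centre. *)
Lemma mulF_lead q (c : mpoly 2 C) A i j : vanish (i + j) A ->
  mulF q c A i j = meval (Defs.coord q) c * A i j.
Proof.
elim/mpoly_XD_ind: c i j => [|k c IH|a c c' IH IH'] i j hA.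
- by rewrite mulF1 meval1 mul1r.
- rewrite mulF_X mevalM mevalXU /xF addFE scaleFE IH // -mulrA.
  rewrite [X in _ + X = _](_ : _ = 0) ?addr0 // /wF; case: eqP => _.
    case: i hA => [|i] hA; rewrite ?mul0r //= IH; last by apply: vanish_le hA; lia.
    by rewrite hA ?mulr0 //; lia.
  case: j hA => [|j] hA; rewrite ?mul0r //= IH; last by apply: vanish_le hA; lia.
  by rewrite hA ?mulr0 //; lia.
by rewrite mulFD mulFZ mevalD mevalZ addFE scaleFE IH // IH' // mulrDl mulrA.
Qed.

Lemma xF_lead q k A i j : vanish (i + j) A -> xF q k A i j = Defs.coord q k * A i j.
Proof.
by move=> hA; rewrite -[A in xF q k A](mulF1 q) -mulF_X mulr1 mulF_lead // mevalXU.
Qed.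

Lemma vanish_xF q k N A : vanish N A -> vanish N (xF q k A).
Proof.
move=> hA i j ij; rewrite xF_lead; last by apply: vanish_le hA; lia.
by rewrite hA ?mulr0.
Qed.

Definition thF q k A : FS := xF q k (dF k A).

Lemma lin_thF q k : lin (thF q k).
Proof. by move=> c A B; rewrite /thF lin_dF lin_xF. Qed.

Lemma vanish_thF q k N A : vanish N.+1 A -> vanish N (thF q k A).
Proof. by move=> h; apply/vanish_xF/vanish_dF. Qed.

Lemma thF_lead q k A i j : vanish (i + j).+1 A ->
  thF q k A i j = Defs.coord q k * dF k A i j.
Proof. by move=> h; rewrite /thF xF_lead //; apply: vanish_dF. Qed.

Lemma thF2_lead q k l A i j : vanish (i + j).+2 A ->
  thF q k (thF q l A) i j = Defs.coord q k * Defs.coord q l * dF k (dF l A) i j.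
Proof.
move=> h; rewrite thF_lead; last exact: vanish_thF.
rewrite -mulrA; congr (_ * _).
have dE (B : FS) : dF k B i j = B (i + (k == ord0))%N (j + (k != ord0))%N.
  by rewrite /dF; case: eqP => _ /=; rewrite addn0 addn1.
by rewrite !dE thF_lead //; apply: vanish_le h; case: (k == ord0) => /=; lia.
Qed.

End LeadingPart.

(** Coefficients of an operator of order two written in [theta_lambda] and
[theta_mu], the coefficient [cij] going with the powers [i] and [j]. *)
Record op2 (K : Type) := Op2 { c20 : K; c11 : K; c02 : K; c10 : K; c01 : K; c00 : K }.

Definition act2 (K : Type) (V : nmodType) (mulc : K -> V -> V) (t0 t1 : V -> V) (c : op2 K) (v : V) : V :=
  mulc (c20 c) (t0 (t0 v)) + mulc (c11 c) (t0 (t1 v)) + mulc (c02 c) (t1 (t1 v)) +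
  mulc (c10 c) (t0 v) + mulc (c01 c) (t1 v) + mulc (c00 c) v.

Lemma lin_act2 (K : Type) (S : nzRingType) (V : lmodType S) (mulc : K -> V -> V) t0 t1 c :
  (forall k, lin (mulc k)) -> lin t0 -> lin t1 -> lin (act2 mulc t0 t1 c).
Proof.
move=> hm h0 h1 a A B; rewrite /act2 !(h0, h1) !hm !scalerDr.
by do 5![rewrite [RHS]addrACA; congr (_ + _)].
Qed.

Section Op2.
Variable R : realType.
Local Notation C := (Cx R).
Local Notation FS := (FS R).
Local Notation P2 := (mpoly 2 C).
Implicit Types (A B : FS) (q : C * C) (c : op2 P2).

Definition opF q c : FS -> FS := act2 (mulF q) (thF q ord0) (thF q ord_max) c.

Definition lead2 (F : FS -> FS) (a b c : C) := forall A i j, vanish (i + j).+2 A ->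
  F A i j = a * A i.+2 j + b * A i.+1 j.+1 + c * A i j.+2.

(** [theta] is [x d/dx] up to lower order terms, so the leading form at [q] is the
quadratic form of the coefficients, rescaled by the coordinates of [q]. *)
Lemma opF_lead q c : lead2 (opF q c)
  (meval (Defs.coord q) (c20 c) * q.1 ^+ 2)
  (meval (Defs.coord q) (c11 c) * (q.1 * q.2))
  (meval (Defs.coord q) (c02 c) * q.2 ^+ 2).
Proof.
move=> A i j hA; rewrite /opF /act2 !addFE.
have v2 k l : vanish (i + j) (thF q k (thF q l A)).
  by apply/vanish_thF/vanish_thF.
have v1 k : vanish (i + j).+1 (thF q k A) by apply: vanish_thF.
rewrite !mulF_lead //; try (by apply: vanish_le hA; lia); try by apply: vanish_le (v1 _); lia.
rewrite !v1 // hA // !thF2_lead // !mulr0 !addr0 /Defs.coord /dF /=.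
by rewrite !expr2 !mulrA.
Qed.

Lemma lin_opF q c : lin (opF q c).
Proof. by apply: lin_act2 => [k||]; [exact: lin_mulF | exact: lin_thF | exact: lin_thF]. Qed.
End Op2.

Section Sylvester.
Variable F : fieldType.

(** The determinant of this system of four equations in four unknowns is the
resultant of the two quadratic forms. *)
Lemma sylvester2 (a b c a' b' c' u v w t : F) :
  (a * c' - a' * c) ^+ 2 - (a * b' - a' * b) * (b * c' - b' * c) != 0 ->
  a * u + b * v + c * w = 0 -> a * v + b * w + c * t = 0 ->
  a' * u + b' * v + c' * w = 0 -> a' * v + b' * w + c' * t = 0 ->
  [/\ u = 0, v = 0, w = 0 & t = 0].
Proof.
set r := _ - _ => r0 h1 h2 h3 h4.
have z x : r * x = 0 -> x = 0.
  by move/eqP; rewrite mulf_eq0 (negbTE r0) => /eqP.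
pose P := a * b' - a' * b; pose Q := a * c' - a' * c; pose S := b * c' - b' * c.
have e1 : P * v + Q * w = 0.
  transitivity (a * (a' * u + b' * v + c' * w) - a' * (a * u + b * v + c * w)).
    by rewrite /P /Q; ring.
  by rewrite h1 h3; ring.
have e2 : Q * u + S * v = 0.
  transitivity (c' * (a * u + b * v + c * w) - c * (a' * u + b' * v + c' * w)).
    by rewrite /S /Q; ring.
  by rewrite h1 h3; ring.
have e3 : P * u - S * w = 0.
  transitivity (b' * (a * u + b * v + c * w) - b * (a' * u + b' * v + c' * w)).
    by rewrite /P /S; ring.
  by rewrite h1 h3; ring.
have f1 : P * w + Q * t = 0.
  transitivity (a * (a' * v + b' * w + c' * t) - a' * (a * v + b * w + c * t)).
    by rewrite /P /Q; ring.
  by rewrite h2 h4; ring.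
have f2 : Q * v + S * w = 0.
  transitivity (c' * (a * v + b * w + c * t) - c * (a' * v + b' * w + c' * t)).
    by rewrite /S /Q; ring.
  by rewrite h2 h4; ring.
have f3 : P * v - S * t = 0.
  transitivity (b' * (a * v + b * w + c * t) - b * (a' * v + b' * w + c' * t)).
    by rewrite /P /S; ring.
  by rewrite h2 h4; ring.
have rE : r = Q ^+ 2 - P * S by [].
split; apply: z; rewrite rE.
- transitivity (Q * (Q * u + S * v) - S * (P * u - S * w) - S * (Q * v + S * w)).
    by ring.
  by rewrite e2 e3 f2; ring.
- transitivity (Q * (Q * v + S * w) - S * (P * v + Q * w)); first by ring.
  by rewrite f2 e1; ring.
- transitivity (Q * (P * v + Q * w) - P * (Q * v + S * w)); first by ring.
  by rewrite f2 e1; ring.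
transitivity (Q * (P * w + Q * t) + P * (P * v - S * t) - P * (P * v + Q * w)).
  by ring.
by rewrite f1 f3 e1; ring.
Qed.

Lemma cramer2 (b c b' c' v w : F) : b * c' - b' * c != 0 ->
  b * v + c * w = 0 -> b' * v + c' * w = 0 -> v = 0 /\ w = 0.
Proof.
set r := _ - _ => r0 h1 h2.
have z x : r * x = 0 -> x = 0.
  by move/eqP; rewrite mulf_eq0 (negbTE r0) => /eqP.
split; apply: z; rewrite /r.
  transitivity (c' * (b * v + c * w) - c * (b' * v + c' * w)); first by ring.
  by rewrite h1 h2; ring.
transitivity (b * (b' * v + c' * w) - b' * (b * v + c * w)); first by ring.
by rewrite h1 h2; ring.
Qed.

Lemma lin_inj_surj (T : finType) (M : (T -> F) -> (T -> F)) :
  (forall (c : F) f g, M (fun t => c * f t + g t) = fun t => c * M f t + M g t) ->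
  (forall f, (forall t, M f t = 0) -> forall t, f t = 0) ->
  forall y, exists f, forall t, M f t = y t.
Proof.
move=> Mlin Minj y.
have ML : lin (M : (T -> F^o) -> (T -> F^o)) by exact: Mlin.
have sE (c : F) (g : T -> F^o) t : (c *: g) t = c * g t by [].
pose n := #|T|; pose ed (i : 'I_n) : T -> F := fun t => (t == enum_val i)%:R.
pose A : 'M[F]_n := \matrix_(i, j) M (ed i) (enum_val j).
have ME (v : 'rV[F]_n) j : M (fun t => v 0 (enum_rank t)) (enum_val j) = (v *m A) 0 j.
  have -> : (fun t => v 0 (enum_rank t)) = \sum_i (v 0 i *: (ed i : (T -> F^o))).
    apply/funext => t; rewrite fct_sumE (bigD1 (enum_rank t)) //= big1 ?addr0.
      by rewrite sE /ed enum_rankK eqxx mulr1.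
    move=> i it; rewrite sE /ed (_ : t == _ = false) ?mulr0 //.
    by apply: contraNF it => /eqP ->; rewrite enum_valK.
  rewrite (lin_sum ML) fct_sumE mxE; apply: eq_bigr => i _.
  by rewrite (linZ ML) sE mxE.
have Aunit : A \in unitmx.
  rewrite -row_free_unit -kermx_eq0; apply/rowV0P => v /sub_kermxP vA.
  have h : forall t, v 0 (enum_rank t) = 0.
    apply: Minj => t; have := ME v (enum_rank t); rewrite enum_rankK => ->.
    by rewrite vA mxE.
  by apply/rowP => i; have := h (enum_val i); rewrite enum_valK mxE.
exists (fun t => ((\row_j y (enum_val j)) *m invmx A) 0 (enum_rank t)) => t.
by have := ME (_ *m _) (enum_rank t); rewrite enum_rankK => ->; rewrite mulmxKV // mxE enum_rankK.
Qed.
End Sylvester.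

(** * Formal solutions at a generic point *)

Section FormalSolutions.
Variable R : realType.
Local Notation C := (Cx R).
Local Notation FS := (FS R).
Implicit Types (A B : FS).

Lemma lead2_vanish (F : FS -> FS) a b c N A : lead2 F a b c -> vanish N.+2 A -> vanish N (F A).
Proof.
move=> hF hA i j ij; rewrite hF; last by apply: vanish_le hA; lia.
by rewrite !hA ?mulr0 ?addr0 //; lia.
Qed.

Lemma lead2_local (F : FS -> FS) a b c A B i j : lin F -> lead2 F a b c ->
  (forall i' j', (i' + j' <= (i + j).+2)%N -> A i' j' = B i' j') -> F A i j = F B i j.
Proof.
move=> lF hF hAB; have v : vanish (i + j).+3 (A + (-1) *: B).
  move=> i' j' ij; rewrite addFE scaleFE mulN1r hAB ?subrr //; lia.
have := lead2_vanish (N := (i + j).+1) hF v (ltnSn _).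
rewrite (linD lF) (linZ lF) addFE scaleFE mulN1r => /eqP.
by rewrite subr_eq0 => /eqP.
Qed.

Variables (F1 F3 E1 E3 : FS -> FS).
Variables (a1 b1 c1 a3 b3 c3 e20 e11 e02 d20 d11 d02 : C).
Hypotheses (linF1 : lin F1) (linF3 : lin F3) (linE1 : lin E1) (linE3 : lin E3).
Hypothesis leadF1 : lead2 F1 a1 b1 c1.
Hypothesis leadF3 : lead2 F3 a3 b3 c3.
Hypothesis leadE1 : lead2 E1 e20 e11 e02.
Hypothesis leadE3 : lead2 E3 d20 d11 d02.
Hypothesis rel : forall A, E1 (F3 A) = E3 (F1 A).
Hypothesis e20_neq0 : e20 != 0.
Hypothesis minor_neq0 : b1 * c3 - b3 * c1 != 0.
Hypothesis res_neq0 :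
  (a1 * c3 - a3 * c1) ^+ 2 - (a1 * b3 - a3 * b1) * (b1 * c3 - b3 * c1) != 0.

Definition solves L A :=
  forall i j, (i + j + 2 <= L)%N -> F1 A i j = 0 /\ F3 A i j = 0.

(** Induction on the degree: on four consecutive entries of degree at least 3 the
equations form the Sylvester system. In degree 2 the two equations leave one
free entry, taken to be [A 2 0] thanks to [minor_neq0]. *)
Lemma solves_unique L A : solves L A ->
  A 0%N 0%N = 0 -> A 1%N 0%N = 0 -> A 0%N 1%N = 0 -> A 2%N 0%N = 0 -> vanish L.+1 A.
Proof.
move=> sA A00 A10 A01 A20.
have v0 : vanish 1 A by move=> [|i] [|j].
have v1 : vanish 2 A by move=> [|[|i]] [|[|j]].
suff H N : (N <= L.+1)%N -> vanish N A by apply: H.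
elim: N => // N IH NL.
have [N1|N2] := leqP N 1; first by apply: vanish_le v1; lia.
have vN := IH (ltnW NL); move: vN IH NL N2.
case: N => [|[|[|N]]] // vN _ NL _.
  have [|f1 f3] := sA 0%N 0%N; first by lia.
  move: f1 f3; rewrite leadF1 // leadF3 // A20 !mulr0 !add0r => f1 f3.
  have [A11 A02] := cramer2 minor_neq0 f1 f3.
  move=> i j; rewrite ltnS leq_eqVlt => /orP[/eqP|]; last exact: vN.
  by case: i => [|[|[|i]]]; case: j => [|[|[|j]]] //; lia.
have four x y : (x + y = N)%N ->
    [/\ A x.+3 y = 0, A x.+2 y.+1 = 0, A x.+1 y.+2 = 0 & A x y.+3 = 0].
  move=> xy.
  have [|f1 f3] := sA x.+1 y; first by lia.
  have [|g1 g3] := sA x y.+1; first by lia.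
  rewrite leadF1 in f1; last by apply: vanish_le vN; lia.
  rewrite leadF3 in f3; last by apply: vanish_le vN; lia.
  rewrite leadF1 in g1; last by apply: vanish_le vN; lia.
  rewrite leadF3 in g3; last by apply: vanish_le vN; lia.
  exact: sylvester2 res_neq0 f1 g1 f3 g3.
move=> i j; rewrite ltnS leq_eqVlt => /orP[/eqP ij|]; last exact: vN.
have [jN|jN] := leqP j N.
  have [|h _ _ _] := four (i - 3)%N j; first by lia.
  by move: h; have -> : ((i - 3).+3 = i)%N by lia.
have [i0 i1 i2 i3] := four 0%N N (add0n N).
by move: ij; case: i => [|[|[|i]]] ij; [have -> : j = N.+3 by lia | have -> : j = N.+2 by lia
  | have -> : j = N.+1 by lia | exfalso; lia].
Qed.

(** [E1 (F3 A)] vanishes where [F1 A] does, and [e20 <> 0] lets it be solved for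
[F3 A] column after column, from the first two. *)
Lemma columns_vanish L A :
  (forall i j, (i + j + 2 <= L)%N -> F1 A i j = 0) ->
  (forall i j, (i < 2)%N -> (i + j + 2 <= L)%N -> F3 A i j = 0) -> solves L A.
Proof.
move=> hF1 hF3.
have v1 : vanish L.-1 (F1 A) by move=> i j ij; apply: hF1; lia.
suff v3 : vanish L.-1 (F3 A).
  by move=> i j ij; split; [apply: hF1 | apply: v3; lia].
suff H N : (N <= L.-1)%N -> vanish N (F3 A) by apply: H.
elim: N => // N IH NL; have vN := IH (ltnW NL).
move=> i j; rewrite ltnS leq_eqVlt => /orP[/eqP|]; last exact: vN.
elim/ltn_ind: i j => i IHi j ij.
have [i2|i2] := ltnP i 2; first by apply: hF3; lia.
have [k ik] : exists k, i = k.+2 by exists (i - 2)%N; lia.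
have := congr1 (fun B : FS => B k j) (rel A); rewrite /= leadE1; last first.
  by apply: vanish_le vN; lia.
rewrite (IHi k.+1 _ j.+1) ?(IHi k _ j.+2) ?mulr0 ?addr0; try lia.
rewrite (lead2_vanish (N := (L - 3)%N) leadE3); last by lia.
  by rewrite -ik => /eqP; rewrite mulf_eq0 (negbTE e20_neq0) => /eqP.
by apply: vanish_le v1; lia.
Qed.

(** Unknowns of the truncated problem: the entries of degree at most [L]. *)
Definition lattice L := {x : 'I_L.+1 * 'I_L.+1 | (x.1 + x.2 <= L)%N}.

Definition extend L (f : lattice L -> C) : FS := fun i j =>
  (if insub (inord i, inord j) is Some x then
     (if (i <= L)%N && (j <= L)%N then f x else 0) else 0).

Lemma extendE L (f : lattice L -> C) i j (x : lattice L) :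
  (val x).1 = i :> nat -> (val x).2 = j :> nat -> extend f i j = f x.
Proof.
move=> h1 h2; have := valP x; rewrite /extend => hx.
have -> : (inord i, inord j) = val x :> 'I_L.+1 * 'I_L.+1.
  rewrite -h1 -h2; case: (val x) => y z /=; by rewrite !inord_val.
have iL : (i <= L)%N by rewrite -h1 -ltnS ltn_ord.
have jL : (j <= L)%N by rewrite -h2 -ltnS ltn_ord.
by rewrite valK iL jL.
Qed.

Lemma lattice_exists L i j : (i + j <= L)%N ->
  exists x : lattice L, (val x).1 = i :> nat /\ (val x).2 = j :> nat.
Proof.
move=> ij; have hi : (i < L.+1)%N by lia.
have hj : (j < L.+1)%N by lia.
have h : ((Ordinal hi, Ordinal hj).1 + (Ordinal hi, Ordinal hj).2 <= L)%N by [].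
by exists (exist _ (Ordinal hi, Ordinal hj) h).
Qed.

(** One equation for each entry [(i, j)], so that the linear system is square:
all equations of [F1] are placed at [j >= 2], those of [F3] in its columns 0
and 1 at [j = 1] and [j = 0], and the four remaining places hold the initial
data. *)
Definition square_eq A i j : C :=
  if j is j'.+2 then F1 A i j'
  else if j is 1%N then (if i is i'.+1 then F3 A 0%N i' else A 0%N 1%N)
  else if i is i'.+3 then F3 A 1%N i' else A i 0%N.

Lemma square_eq_solves L A : (2 <= L)%N ->
  (forall i j, (i + j <= L)%N -> square_eq A i j =
     if j is 0 then (if (i <= 2)%N then A i 0%N else 0)
     else if (i == 0%N) && (j == 1%N) then A 0%N 1%N else 0) ->
  solves L A.
Proof.
move=> L2 h; apply: columns_vanish => [i j ij|[|[|i]] // j _ ij].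
- by have := h i j.+2; rewrite /= andbF => -> //; lia.
- by have := h j.+1 1%N; rewrite /= => -> //; lia.
by have := h j.+3 0%N; rewrite /= => -> //; lia.
Qed.

(** The square system is injective by [solves_unique]. *)
Lemma jet_exists L (x : nat -> C) y : (2 <= L)%N -> exists A : FS,
  [/\ solves L A, (forall i, (i <= 2)%N -> A i 0%N = x i) & A 0%N 1%N = y].
Proof.
move=> L2; pose M (f : lattice L -> C^o) : lattice L -> C^o := fun t =>
  square_eq (extend f) (val t).1 (val t).2.
have lin_ext (c : C) f g : extend (fun t => c * f t + g t) = c *: extend f + extend g :> FS.
  apply: FSP => i j; rewrite addFE scaleFE /extend; case: insub => [t|].
    by case: ifP => _; rewrite ?mulr0 ?addr0.
  by rewrite mulr0 addr0.
have lin_sq (c : C) A B i j : square_eq (c *: A + B) i j = c * square_eq A i j + square_eq B i j.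
  rewrite /square_eq; case: j => [|[|j]]; rewrite ?linF1 //; case: i => [|i] //.
    by case: i => [|[|i]] //; rewrite linF3.
  by rewrite linF3.
have [||f hf] := @lin_inj_surj C (lattice L) M _ _
  (fun t => let i : nat := (val t).1 in let j : nat := (val t).2 in
     if j is 0 then (if (i <= 2)%N then x i else 0)
     else if (i == 0%N) && (j == 1%N) then y else 0).
- by move=> c f g; apply/funext => t; rewrite /M lin_ext lin_sq.
- move=> f fM.
  have sq0 i j : (i + j <= L)%N -> square_eq (extend f) i j = 0.
    by move=> ij; have [t [<- <-]] := lattice_exists ij; apply: fM.
  have v : vanish L.+1 (extend f).
    have z i : (i <= 2)%N -> extend f i 0%N = 0.
      by move=> i2; have := sq0 i 0%N; case: i i2 => [|[|[|i]]] //= _ -> //; lia.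
    have z01 : extend f 0%N 1%N = 0 by have := sq0 0%N 1%N; rewrite /= => -> //; lia.
    apply: solves_unique; rewrite ?z // ?z01 //.
    apply: square_eq_solves => // i j ij; rewrite sq0 //; case: j {ij} => [|j].
      by case: ifP => // i2; rewrite z.
    by case: ifP => // _; rewrite z01.
  by move=> t; rewrite -(extendE f (erefl _) (erefl _)) v // ltnS (valP t).
have sq i j : (i + j <= L)%N -> square_eq (extend f) i j =
     if j is 0 then (if (i <= 2)%N then x i else 0)
     else if (i == 0%N) && (j == 1%N) then y else 0.
  by move=> ij; have [t [t1 t2]] := lattice_exists ij; have := hf t; rewrite /M t1 t2.
have x0 i : (i <= 2)%N -> extend f i 0%N = x i.
  by move=> i2; have := sq i 0%N; case: i i2 => [|[|[|i]]] //= _ -> //; lia.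
have y0 : extend f 0%N 1%N = y by have := sq 0%N 1%N; rewrite /= => -> //; lia.
exists (extend f); split => //.
apply: square_eq_solves => // i j ij; rewrite sq //; case: j {ij} => [|j].
  by case: ifP => // i2; rewrite x0.
by rewrite y0.
Qed.

Lemma formal_unique A : F1 A = 0 -> F3 A = 0 ->
  A 0%N 0%N = 0 -> A 1%N 0%N = 0 -> A 0%N 1%N = 0 -> A 2%N 0%N = 0 -> A = 0.
Proof.
move=> h1 h3 A00 A10 A01 A20; apply: FSP => i j.
have sA : solves (i + j) A by move=> i' j' _; rewrite h1 h3.
exact: (solves_unique sA).
Qed.

(** By uniqueness the solutions of the truncated problems extend one another. *)
Lemma formal_exists (x : nat -> C) y : exists A : FS,
  [/\ F1 A = 0, F3 A = 0, (forall i, (i <= 2)%N -> A i 0%N = x i) & A 0%N 1%N = y].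
Proof.
have /choice[J HJ] : forall L, exists A : FS,
    [/\ solves L.+2 A, (forall i, (i <= 2)%N -> A i 0%N = x i) & A 0%N 1%N = y].
  by move=> L; apply: jet_exists.
have JJ L L' i j : (i + j <= L.+2)%N -> (L <= L')%N -> J L i j = J L' i j.
  move=> ij LL'; have [s z w] := HJ L; have [s' z' w'] := HJ L'.
  have : vanish L.+3 (J L + (-1) *: J L').
    apply: solves_unique; rewrite ?addFE ?scaleFE ?z ?z' ?w ?w' ?mulN1r ?subrr //.
    move=> i' j' ij'; have [p1 p3] := s i' j' ij'.
    have [|q1 q3] := s' i' j'; first by lia.
    by rewrite (linD linF1) (linD linF3) (linZ linF1) (linZ linF3) !addFE !scaleFE p1 p3 q1 q3 mulr0 addr0.
  move=> /(_ i j); rewrite ltnS => /(_ ij); rewrite addFE scaleFE mulN1r => /eqP.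
  by rewrite subr_eq0 => /eqP.
pose A : FS := fun i j => J (i + j)%N i j.
have AJ L i j : (i + j <= L)%N -> A i j = J L i j by move=> ij; apply: JJ; lia.
exists A; split.
- apply: FSP => i j; have [s _ _] := HJ (i + j).+2.
  rewrite (lead2_local (B := J (i + j).+2) linF1 leadF1) => [|i' j' ij]; last exact: AJ.
  by case: (s i j) => //; lia.
- apply: FSP => i j; have [s _ _] := HJ (i + j).+2.
  rewrite (lead2_local (B := J (i + j).+2) linF3 leadF3) => [|i' j' ij]; last exact: AJ.
  by case: (s i j) => //; lia.
- by move=> i i2; rewrite /A; have [_ -> //] := HJ (i + 0)%N.
by rewrite /A; have [_ _] := HJ (0 + 1)%N.
Qed.

End FormalSolutions.

(** * From formal solutions to germs *)

Section Germs.
Variable R : realType.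
Local Notation C := (Cx R).
Local Notation FS := (FS R).
Local Notation "z -2 p" := (z.1 - p.1, z.2 - p.2) (at level 50).
Implicit Types (A B : FS) (p q z : C * C) (r : R) (u v : C * C -> C).

Lemma lin_thetaF q (D : diffop R) : lin (thetaF q D).
Proof.
apply: lin_bigsum => m c A B.
have h i : lin (fun A : FS => xF q i (dF i A)) by move=> a A' B'; rewrite lin_dF lin_xF.
by rewrite (lin_iter _ (h ord_max)) (lin_iter _ (h ord0)) lin_mulF.
Qed.

Lemma rep_lincomb p r n (c : 'I_n -> C) (A : 'I_n -> FS) (u : 'I_n -> C * C -> C) :
  (forall i, rep p r (A i) (u i)) ->
  rep p r (\sum_(i < n) c i *: A i) (fun z => \sum_(i < n) c i * u i z).
Proof.
move=> h; have := @rep_sum _ p r _ (index_enum 'I_n) (fun i => c i *: A i)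
  (fun i z => c i * u i z) (fun i => repZ (c i) (h i)).
by apply: rep_ext => z; rewrite fct_sumE.
Qed.

Variables (D1 D3 : diffop R).

Definition formal_solution p A := thetaF p D1 A = 0 /\ thetaF p D3 A = 0.

Lemma rep_solution p r A u : 0 < r -> rep p r A u -> formal_solution p A ->
  forall z, in_box r (z -2 p) -> theta_op D1 u z = 0 /\ theta_op D3 u z = 0.
Proof.
move=> r0 hA [h1 h3] z bz.
have := rep_theta_op D1 hA; have := rep_theta_op D3 hA; rewrite h1 h3 => h h'.
by rewrite (rep_zero h' bz) (rep_zero h bz).
Qed.

Lemma box_near p r q (P : C * C -> Prop) (e : R) : 0 <= e < r -> in_box e (q -2 p) \/ e = 0 /\ q = p ->
  (forall z, in_box r (z -2 p) -> P z) -> \forall z \near q, P z.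
Proof.
move=> /andP[e0 er] hq H; apply/near_boxP; exists (r - e) => [|z z1 z2]; first by rewrite subr_gt0.
apply: H; have E (a b c : C) : c - b = (c - a) + (a - b) by rewrite addrA subrK.
have [h1 h2] : cabs (q.1 - p.1) <= e /\ cabs (q.2 - p.2) <= e.
  by case: hq => [[/= /ltW ? /ltW ?]|[-> ->]] //; rewrite !subrr !cabs0 lexx.
by split; [rewrite /= (E q.1) | rewrite /= (E q.2)]; apply: le_lt_trans (cabsD _ _) _; lra.
Qed.

Lemma box_near_center p r (P : C * C -> Prop) : 0 < r ->
  (forall z, in_box r (z -2 p) -> P z) -> \forall z \near p, P z.
Proof.
by move=> r0; apply: (@box_near p r p P 0); [rewrite lexx | right].
Qed.

Lemma formal_rep_solution p r A u : 0 < r -> rep p r A u -> formal_solution p A ->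
  solution D1 D3 p u.
Proof.
move=> r0 hA sA; split; first exact: rep_holomorphic hA.
exact: box_near_center r0 (rep_solution r0 hA sA).
Qed.

Lemma solution_formal p u : solution D1 D3 p u ->
  exists r A, [/\ 0 < r, rep p r A u & formal_solution p A].
Proof.
move=> [/holomorphic_rep[r [A [r0 hA]]] hu]; exists r, A; split=> //; split.
  by apply: (rep_eq0 r0 (rep_theta_op D1 hA)); apply: filterS hu => z [].
by apply: (rep_eq0 r0 (rep_theta_op D3 hA)); apply: filterS hu => z [].
Qed.

Lemma rep_psum p r A : growth r A -> rep p r A (fun z => psum A (z -2 p)).
Proof. by move=> gA; split. Qed.

Lemma formal_solution_lincomb p n (c : 'I_n -> C) (A : 'I_n -> FS) :
  (forall i, formal_solution p (A i)) -> formal_solution p (\sum_(i < n) c i *: A i).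
Proof.
move=> h; split.
  rewrite (lin_sum (lin_thetaF p D1)) big1 // => i _.
  by rewrite (linZ (lin_thetaF p D1)) (proj1 (h i)) scaler0.
rewrite (lin_sum (lin_thetaF p D3)) big1 // => i _.
by rewrite (linZ (lin_thetaF p D3)) (proj2 (h i)) scaler0.
Qed.

(** Germs of solutions and formal solutions are the same here, and the basis
consists of the solutions with one initial value 1 and the others 0. *)
Lemma germ_dim_formal p r n (ini : 'I_n -> FS -> C) : 0 < r ->
  (forall A, formal_solution p A -> growth r A) ->
  (forall k, forall a A B, ini k (a *: A + B) = a * ini k A + ini k B) ->
  (forall A, formal_solution p A -> (forall k, ini k A = 0) -> A = 0) ->
  (forall x : 'I_n -> C, exists2 A, formal_solution p A & forall k, ini k A = x k) ->
  germ_dim p (solution D1 D3 p) n.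
Proof.
move=> r0 gr ini_lin uniq ex.
have /choice[A HA] : forall k : 'I_n, exists A, formal_solution p A /\
    forall l, ini l A = (l == k)%:R.
  by move=> k; have [A sA iA] := ex (fun l => (l == k)%:R); exists A.
have sA k : formal_solution p (A k) by case: (HA k).
have iA k l : ini l (A k) = (l == k)%:R by case: (HA k).
have iniL l : lin (ini l : FS -> C^o) by move=> a B B'; rewrite ini_lin.
have ini_comb (c : 'I_n -> C) l : ini l (\sum_(k < n) c k *: A k) = c l.
  rewrite (lin_sum (iniL l)) (bigD1 l) //= big1 ?addr0.
    by rewrite (linZ (iniL l)) iA eqxx; exact: mulr1.
  by move=> k kl; rewrite (linZ (iniL l)) iA eq_sym (negbTE kl); exact: mulr0.
pose u k : C * C -> C := fun z => psum (A k) (z -2 p).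
have hu k : rep p r (A k) (u k) by apply/rep_psum/gr.
exists u; split.
- by move=> k; apply: formal_rep_solution (hu k) (sA k).
- move=> c hc k; rewrite -(ini_comb c k).
  have h := rep_eq0 r0 (rep_lincomb c hu) hc.
  by rewrite h (lin0 (iniL k)).
move=> v sv; have [t [B [t0 hB sB]]] := solution_formal sv.
exists (fun k => ini k B).
have BE : B = \sum_(k < n) ini k B *: A k.
  apply/eqP; rewrite -subr_eq0; apply/eqP; rewrite -scaleN1r; apply: uniq.
    split; rewrite ?(linD (lin_thetaF p _)) ?(linZ (lin_thetaF p _)).
      by have [-> _] := formal_solution_lincomb (fun k => ini k B) sA; have [-> _] := sB; rewrite scaler0 addr0.
    by have [_ ->] := formal_solution_lincomb (fun k => ini k B) sA; have [_ ->] := sB; rewrite scaler0 addr0.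
  move=> k; rewrite (linD (iniL k)) (linZ (iniL k)) ini_comb.
  by rewrite scaleN1r subrr.
have hc := rep_lincomb (fun k => ini k B) hu; rewrite -BE in hc.
have n1 := box_near_center t0 (proj2 hB); have n2 := box_near_center r0 (proj2 hc).
by apply: filterS2 n1 n2 => z -> ->.
Qed.

(** All the solutions at either point converge on a polydisc of radius [r] that
contains the other point, and reexpansion goes back and forth. *)
Lemma germ_dim_transport p q r (e : R) n : 0 < e -> 3 * e < r ->
  in_box e (q -2 p) ->
  (forall A, formal_solution p A -> growth r A) ->
  (forall A, formal_solution q A -> growth r A) ->
  germ_dim q (solution D1 D3 q) n -> germ_dim p (solution D1 D3 p) n.
Proof.
move=> e0 er qp grp grq [u [su indep span]].
have pq : in_box e (p -2 q) by case: qp => h1 h2; split; rewrite /= cabs_distC.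
have er1 : 0 <= e < r by apply/andP; split; lra.
have er2 : 0 <= e < r - e by apply/andP; split; lra.
have re0 : 0 < r - e by lra.
have r0 : 0 < r by lra.
have /choice[A HA] : forall i, exists A : FS, formal_solution q A /\
    (exists2 t : R, 0 < t & rep q t A (u i)).
  by move=> i; have [t [A [t0 hA sA]]] := solution_formal (su i); exists A; split=> //; exists t.
pose u' i : C * C -> C := fun z => psum (A i) (z -2 q).
have hu i : rep q r (A i) (u' i) by apply/rep_psum/grq; case: (HA i).
have uu' i : \forall z \near q, u i z = u' i z.
  have [_ [t t0 [_ h]]] := HA i.
  exact: box_near_center t0 h.
have hup i : rep p (r - e) (recenter (A i) (p -2 q)) (u' i).
  exact: rep_recenter (hu i) (ltW e0) pq.
exists u'; split.
- move=> i; split; first exact: rep_holomorphic (hup i).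
  apply: (box_near er1 (or_introl pq)); apply: rep_solution (hu i) _ => //.
  by case: (HA i).
- move=> c hc; apply: indep.
  have h := rep_lincomb c hup.
  have z0 : (\sum_(i < n) c i *: (recenter (A i) (p -2 q) : FS)) = 0 by apply: rep_eq0 re0 h hc.
  rewrite z0 in h.
  have h1 := box_near er2 (or_introl qp) (rep_zero h).
  have h2 : \forall z \near q, forall i, u i z = u' i z by exact: (filter_forall _ uu').
  apply: filterS2 h1 h2 => z hz hu2; rewrite -[RHS]hz.
  by apply: eq_bigr => i _; rewrite hu2.
move=> v sv; have [t [B [t0 hB sB]]] := solution_formal sv.
pose v' : C * C -> C := fun z => psum B (z -2 p).
have hv' : rep p r B v' by apply/rep_psum/grp.
have hv'q := rep_recenter hv' (ltW e0) qp.
have sv' : solution D1 D3 q v'.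
  split; first exact: rep_holomorphic hv'q.
  by apply: (box_near er1 (or_introl qp)); apply: rep_solution hv' sB.
have [c hc] := span _ sv'; exists c.
have huq i : rep q (r - e) (A i) (u' i).
  have [gA uA] := hu i; split; first by apply: growth_le gA; lra.
  by move=> z [z1 z2]; apply: uA; split; lra.
have h := repD hv'q (repZ (-1) (rep_lincomb c huq)).
have h0 : (recenter B (q -2 p) : FS) + (-1) *: \sum_(i < n) c i *: A i = 0.
  apply: rep_eq0 re0 h _.
  have h2 : \forall z \near q, forall i, u i z = u' i z by exact: (filter_forall _ uu').
  apply: filterS2 hc h2 => z h1 h2; rewrite addrfctE /= h1 mulN1r.
  by apply/eqP; rewrite subr_eq0; apply/eqP/eq_bigr => i _; rewrite h2.
rewrite h0 in h.
have h1 := box_near er2 (or_introl pq) (rep_zero h).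
have h2 : \forall z \near p, v z = v' z by exact: box_near_center t0 (proj2 hB).
apply: filterS2 h1 h2 => z; rewrite addrfctE mulN1r => /eqP.
by rewrite subr_eq0 => /eqP <- ->.
Qed.

End Germs.

Section Density.
Variable R : realType.
Local Notation C := (Cx R).

Lemma poly_nonroot (h : {poly C}) (e : R) : h != 0 -> 0 < e ->
  exists2 t : C, cabs t < e & h.[t] != 0.
Proof.
move=> h0 e0; pose n := size h.
pose t k : C := ((e / (k.+2)%:R)%:C)%C.
have ct k : cabs (t k) < e.
  rewrite /t cabs_real gtr0_norm ?divr_gt0 // ltr_pdivrMr //.
  by rewrite ltr_pMr // ltr1n.
have tinj : injective t.
  move=> k l /complexI /(mulfI (lt0r_neq0 e0)) /invr_inj /eqP.
  by rewrite eqr_nat => /eqP [].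
apply: contrapT => H; have all0 k : root h (t k).
  by apply/rootP/eqP/negPn/negP => hk; apply: H; exists (t k).
have := max_poly_roots (rs := [seq t k | k <- iota 0 n]) h0.
rewrite size_map size_iota ltnn => H'.
suff : false by []; apply: H'.
  by apply/allP => x /mapP[k _ ->].
by rewrite map_inj_uniq // iota_uniq.
Qed.

(** On the line from [p] to a point where [g] does not vanish, [g] has finitely
many zeros. *)
Lemma mpoly_nonroot (g : mpoly 2 C) (p pt : C * C) (e : R) : 0 < e ->
  meval (Defs.coord pt) g != 0 ->
  exists q : C * C, [/\ cabs (q.1 - p.1) < e, cabs (q.2 - p.2) < e & meval (Defs.coord q) g != 0].
Proof.
move=> e0 gpt; pose line (i : 'I_2) : {poly C} :=
  (Defs.coord p i)%:P + (Defs.coord pt i - Defs.coord p i)%:P * 'X.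
pose h : {poly C} := mmap (@polyC C) line g.
have hE t : h.[t] = meval (fun i => Defs.coord p i + (Defs.coord pt i - Defs.coord p i) * t) g.
  rewrite /h; elim/mpoly_XD_ind: g {gpt h} => [|i c IH|a c c' IH IH'].
  - by rewrite rmorph1 hornerC meval1.
  - by rewrite rmorphM /= hornerM IH mevalM mevalXU mmapX mmap1U /line !hornerE.
  by rewrite rmorphD /= mmapZ hornerD hornerM hornerC IH IH' mevalD mevalZ.
have h0 : h != 0.
  apply: contraNneq gpt => h0; have := hE 1; rewrite h0 horner0 => ->.
  by apply/eqP/meval_eq => i; rewrite mulr1 addrC subrK.
pose M := cabs (pt.1 - p.1) + cabs (pt.2 - p.2) + 1.
have M0 : 0 < M by rewrite ltr_wpDl // addr_ge0 // cabs_ge0.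
have [t te ht] := poly_nonroot h0 (divr_gt0 e0 M0).
exists (p.1 + (pt.1 - p.1) * t, p.2 + (pt.2 - p.2) * t); split => /=.
- rewrite addrC addKr cabsM; move: te; rewrite ltr_pdivlMr // => te.
  apply: le_lt_trans te; rewrite mulrC ler_wpM2l ?cabs_ge0 // /M.
  by have := cabs_ge0 (pt.2 - p.2); lra.
- rewrite addrC addKr cabsM; move: te; rewrite ltr_pdivlMr // => te.
  apply: le_lt_trans te; rewrite mulrC ler_wpM2l ?cabs_ge0 // /M.
  by have := cabs_ge0 (pt.1 - p.1); lra.
rewrite hE in ht; apply: contraNneq ht => <-; apply/eqP/meval_eq => i.
by rewrite /Defs.coord; case: eqP.
Qed.

End Density.

(** * The dimension of the solution space of a compatible system *)

Section SecondOrder.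
Variables (K : nzRingType).

Definition diff2 (c : op2 K) : mpoly 2 K :=
  c20 c *: mpolyX K (mnm_add (mnm1 ord0) (mnm1 ord0)) +
  c11 c *: mpolyX K (mnm_add (mnm1 ord0) (mnm1 ord_max)) +
  c02 c *: mpolyX K (mnm_add (mnm1 ord_max) (mnm1 ord_max)) +
  c10 c *: mpolyX K (mnm1 ord0) + c01 c *: mpolyX K (mnm1 ord_max) +
  c00 c *: mpolyX K mnm0.

Lemma msupp_sum_diff2 (V : nmodType) (G : multinom 2 -> K -> V) c :
  (forall m, G m 0 = 0) -> (forall m a b, G m (a + b) = G m a + G m b) ->
  \sum_(m <- msupp (diff2 c)) G m (mcoeff m (diff2 c)) =
  G (mnm_add (mnm1 ord0) (mnm1 ord0)) (c20 c) +
  G (mnm_add (mnm1 ord0) (mnm1 ord_max)) (c11 c) +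
  G (mnm_add (mnm1 ord_max) (mnm1 ord_max)) (c02 c) +
  G (mnm1 ord0) (c10 c) + G (mnm1 ord_max) (c01 c) + G mnm0 (c00 c).
Proof. by move=> G0 GD; rewrite /diff2 !(msupp_sumD G0 _ _ GD) !(msupp_sumZX G0). Qed.

Lemma gact_diff2 (V : zmodType) (mulc : K -> V -> V) (d : 'I_2 -> V -> V) c v :
  (forall v, mulc 0 v = 0) -> (forall a b v, mulc (a + b) v = mulc a v + mulc b v) ->
  gact mulc d (diff2 c) v = act2 mulc (d ord0) (d ord_max) c v.
Proof.
move=> m0 mD; rewrite /gact (msupp_sum_diff2 (G := fun m a => mulc a
  (iter (m ord0) (d ord0) (iter (m ord_max) (d ord_max) v)))) // /act2.
by rewrite !mnmDE !mnm1E !mnm0E.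
Qed.

Lemma order_le_diff2 c : order_le 2 (diff2 c).
Proof.
have h a m : (mdeg m <= 2)%N -> order_le 2 (a *: mpolyX K m).
  by move=> hm k /msuppZ_le; rewrite msuppX inE => /eqP ->.
by do !apply: order_leD; apply: h; rewrite ?mdegD ?mdeg1 ?mdeg0.
Qed.
End SecondOrder.

Lemma euler_to_partial (K : comNzRingType)
    (a b c d e g f x y f00 f01 f11 f0 f1 t00 t01 t11 : K) :
  t00 = x ^+ 2 * f00 + x * f0 -> t01 = x * y * f01 -> t11 = y ^+ 2 * f11 + y * f1 ->
  a * x ^+ 2 * f00 + b * x * y * f01 + c * y ^+ 2 * f11 + (a + d) * x * f0 +
  (c + e) * y * f1 + g * f =
  a * t00 + b * t01 + c * t11 + d * (x * f0) + e * (y * f1) + g * f.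
Proof. by move=> -> -> ->; ring. Qed.

Definition map_op2 (K L : Type) (f : K -> L) (c : op2 K) : op2 L :=
  Op2 (f (c20 c)) (f (c11 c)) (f (c02 c)) (f (c10 c)) (f (c01 c)) (f (c00 c)).

Definition minor2 (K : nzRingType) (d1 d3 : op2 K) : K := c11 d1 * c02 d3 - c11 d3 * c02 d1.

(** Resultant of the two leading quadratic forms. *)
Definition resultant2 (K : nzRingType) (d1 d3 : op2 K) : K :=
  (c20 d1 * c02 d3 - c20 d3 * c02 d1) ^+ 2 -
  (c20 d1 * c11 d3 - c20 d3 * c11 d1) * (c11 d1 * c02 d3 - c11 d3 * c02 d1).

(** Its nonvanishing at [(x, y)] grants all the hypotheses of [formal_exists]:
nonzero coordinates make the Euler derivations independent there. *)
Definition generic2 (K : nzRingType) (x y : K) (d1 d3 e1 : op2 K) : K :=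
  x * y * c20 e1 * minor2 d1 d3 * resultant2 d1 d3.

Lemma generic2_morph (K L : nzRingType) (f : {rmorphism K -> L}) x y d1 d3 e1 :
  f (generic2 x y d1 d3 e1) =
  generic2 (f x) (f y) (map_op2 f d1) (map_op2 f d3) (map_op2 f e1).
Proof. by rewrite /generic2 /minor2 /resultant2 !(rmorphM, rmorphB, rmorphXn). Qed.

Lemma generic2_neq0 (F : fieldType) (x y : F) d1 d3 e1 :
  generic2 x y d1 d3 e1 != 0 ->
  [/\ c20 e1 * x ^+ 2 != 0,
    c11 d1 * (x * y) * (c02 d3 * y ^+ 2) - c11 d3 * (x * y) * (c02 d1 * y ^+ 2) != 0 &
    (c20 d1 * x ^+ 2 * (c02 d3 * y ^+ 2) - c20 d3 * x ^+ 2 * (c02 d1 * y ^+ 2)) ^+ 2 -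
    (c20 d1 * x ^+ 2 * (c11 d3 * (x * y)) - c20 d3 * x ^+ 2 * (c11 d1 * (x * y))) *
    (c11 d1 * (x * y) * (c02 d3 * y ^+ 2) - c11 d3 * (x * y) * (c02 d1 * y ^+ 2)) != 0].
Proof.
rewrite {1}/generic2 mulf_eq0 negb_or => /andP[+ r0]; rewrite mulf_eq0 negb_or => /andP[+ m0].
rewrite mulf_eq0 negb_or => /andP[+ e0]; rewrite mulf_eq0 negb_or => /andP[x0 y0]; split.
- by rewrite mulf_neq0 // expf_neq0.
- rewrite (_ : _ - _ = (x * y ^+ 3) * minor2 d1 d3); last by rewrite /minor2; ring.
  by rewrite !mulf_neq0 // expf_neq0.
rewrite (_ : _ - _ = (x * y) ^+ 4 * resultant2 d1 d3); last by rewrite /resultant2; ring.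
by rewrite !mulf_neq0 // expf_neq0 // mulf_neq0.
Qed.

Section Solve.
Variable R : realType.
Local Notation C := (Cx R).
Local Notation FS := (FS R).
Local Notation K := (mpoly 2 C).
Local Notation X0 := (mpolyX C (mnm1 ord0)).
Local Notation X1 := (mpolyX C (mnm1 ord_max)).
Implicit Types (c d : op2 K) (p q : C * C).

Definition poly_mul (c : K) (f : K) : K := c * f.

Definition poly_th (i : 'I_2) (f : K) : K := mpolyX C (mnm1 i) * mderiv i f.

Definition poly_op2 c (f : K) : K := act2 poly_mul (poly_th ord0) (poly_th ord_max) c f.

Lemma poly_theta_diff2 c f : poly_theta (diff2 c) f = poly_op2 c f.
Proof. by apply: (@gact_diff2 K K) => *; rewrite ?mul0r ?mulrDl. Qed.

Lemma thetaF_diff2 q c A : thetaF q (diff2 c) A = opF q c A.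
Proof. by apply: (@gact_diff2 K FS) => *; rewrite ?mulF0 ?mulFD. Qed.

(** The square of [theta] is [x ^ 2 d ^ 2 + x d], whence the sums in the first
order coefficients. *)
Definition partial2 c : op2 K := Op2 (c20 c * X0 ^+ 2) (c11 c * X0 * X1)
  (c02 c * X1 ^+ 2) ((c20 c + c10 c) * X0) ((c02 c + c01 c) * X1) (c00 c).

Lemma poly_th0 f : poly_th ord0 (poly_th ord0 f) =
  X0 ^+ 2 * mderiv ord0 (mderiv ord0 f) + X0 * mderiv ord0 f.
Proof.
rewrite /poly_th mderivM mderivX mnm1E eqxx scale1r.
have -> : mnm_sub (mnm1 ord0) (mnm1 ord0) = (mnm0 : multinom 2).
  by apply/mnmP => k; rewrite mnmBE subnn mnm0E.
by rewrite mpolyX0; ring.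
Qed.

Lemma poly_th1 f : poly_th ord_max (poly_th ord_max f) =
  X1 ^+ 2 * mderiv ord_max (mderiv ord_max f) + X1 * mderiv ord_max f.
Proof.
rewrite /poly_th mderivM mderivX mnm1E eqxx scale1r.
have -> : mnm_sub (mnm1 ord_max) (mnm1 ord_max) = (mnm0 : multinom 2).
  by apply/mnmP => k; rewrite mnmBE subnn mnm0E.
by rewrite mpolyX0; ring.
Qed.

Lemma poly_th01 f : poly_th ord0 (poly_th ord_max f) =
  X0 * X1 * mderiv ord0 (mderiv ord_max f).
Proof. by rewrite /poly_th mderivM mderivX mnm1E /= scale0r; ring. Qed.

Lemma poly_weyl_partial2 c f : poly_weyl (diff2 (partial2 c)) f = poly_theta (diff2 c) f.
Proof.
rewrite poly_theta_diff2; transitivity (act2 poly_mul (fun g : K => mderiv ord0 g)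
   (fun g : K => mderiv ord_max g) (partial2 c) f).
  by apply: (@gact_diff2 K K) => *; rewrite ?mul0r ?mulrDl.
exact (euler_to_partial (c20 c) (c11 c) (c02 c) (c10 c) (c01 c) (c00 c) f
  (poly_th0 f) (poly_th01 f) (poly_th1 f)).
Qed.

Lemma poly_weyl1 (f : K) : poly_weyl (1 : mpoly 2 K) f = f.
Proof.
have := @gactZX K K poly_mul (fun i (g : K) => mderiv i g) (fun v => mul0r v) 1 mnm0 f.
by rewrite scale1r mpolyX0 /poly_mul mul1r !mnm0E.
Qed.

Lemma left_ideal_D1 c d : left_ideal (diff2 c) (diff2 d) (diff2 (partial2 c)).
Proof.
exists (1 : mpoly 2 K), (0 : mpoly 2 K) => f.
apply: etrans (poly_weyl_partial2 c f) _; apply/esym.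
by apply: etrans (congr2 +%R (poly_weyl1 _) (poly_weyl0 _)) _; rewrite addr0.
Qed.

Lemma left_ideal_D3 c d : left_ideal (diff2 c) (diff2 d) (diff2 (partial2 d)).
Proof.
exists (0 : mpoly 2 K), (1 : mpoly 2 K) => f.
apply: etrans (poly_weyl_partial2 d f) _; apply/esym.
by apply: etrans (congr2 +%R (poly_weyl0 _) (poly_weyl1 _)) _; rewrite add0r.
Qed.

Lemma symbol_diff2 c p x y : symbol 2 (diff2 c) p (x, y) =
  meval (Defs.coord p) (c20 c) * x ^+ 2 + meval (Defs.coord p) (c11 c) * (x * y) +
  meval (Defs.coord p) (c02 c) * y ^+ 2.
Proof.
pose G (m : multinom 2) (a : K) : C := if mdeg m == 2
  then meval (Defs.coord p) a * x ^+ (m ord0) * y ^+ (m ord_max) else 0.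
have G0 m : G m 0 = 0 by rewrite /G meval0 !mul0r if_same.
have GD m a b : G m (a + b) = G m a + G m b.
  by rewrite /G; case: ifP; rewrite ?addr0 // mevalD !mulrDl.
have E (P : mpoly 2 K) : symbol 2 P p (x, y) = \sum_(m <- msupp P) G m (mcoeff m P).
  by rewrite /symbol big_mkcond.
rewrite E (msupp_sum_diff2 _ G0 GD) /G.
rewrite !mdegD !mdeg1 mdeg0 /= !addr0 !mnmDE !mnm1E /= !addn0 !add0n !expr0 !mulr1 !expr1.
by rewrite -(mulrA _ x y).
Qed.

Lemma meval_X2 (v : 'I_2 -> C) (a : K) i :
  meval v (a * mpolyX C (mnm1 i) ^+ 2) = meval v a * v i ^+ 2.
Proof. by rewrite mevalM expr2 mevalM mevalXU. Qed.

Lemma meval_XX (v : 'I_2 -> C) (a : K) i j :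
  meval v (a * mpolyX C (mnm1 i) * mpolyX C (mnm1 j)) = meval v a * (v i * v j).
Proof. by rewrite !mevalM !mevalXU mulrA. Qed.

(** A common zero of the symbols of [D1] and [D3] alone already contradicts the
resultant. *)
Lemma nonsingular_resultant c d p :
  let a1 := meval (Defs.coord p) (c20 c) * p.1 ^+ 2 in
  let b1 := meval (Defs.coord p) (c11 c) * (p.1 * p.2) in
  let g1 := meval (Defs.coord p) (c02 c) * p.2 ^+ 2 in
  let a3 := meval (Defs.coord p) (c20 d) * p.1 ^+ 2 in
  let b3 := meval (Defs.coord p) (c11 d) * (p.1 * p.2) in
  let g3 := meval (Defs.coord p) (c02 d) * p.2 ^+ 2 in
  (a1 * g3 - a3 * g1) ^+ 2 - (a1 * b3 - a3 * b1) * (b1 * g3 - b3 * g1) != 0 ->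
  ~ singular_locus (diff2 c) (diff2 d) p.
Proof.
move=> a1 b1 g1 a3 b3 g3 res [[x y] xy ch].
have h1 := ch 2 _ (left_ideal_D1 c d) (@order_le_diff2 _ _).
have h3 := ch 2 _ (left_ideal_D3 c d) (@order_le_diff2 _ _).
have e1 : a1 * x ^+ 2 + b1 * (x * y) + g1 * y ^+ 2 = 0.
  by move: h1; rewrite symbol_diff2 /partial2 [c20 _]/= [c11 _]/= [c02 _]/= !meval_X2 meval_XX.
have e3 : a3 * x ^+ 2 + b3 * (x * y) + g3 * y ^+ 2 = 0.
  by move: h3; rewrite symbol_diff2 /partial2 [c20 _]/= [c11 _]/= [c02 _]/= !meval_X2 meval_XX.
have [||||/eqP x3 _ _ /eqP y3] := @sylvester2 C a1 b1 g1 a3 b3 g3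
    (x ^+ 3) (x ^+ 2 * y) (x * y ^+ 2) (y ^+ 3) res.
- by transitivity (x * (a1 * x ^+ 2 + b1 * (x * y) + g1 * y ^+ 2)); [ring | rewrite e1 mulr0].
- by transitivity (y * (a1 * x ^+ 2 + b1 * (x * y) + g1 * y ^+ 2)); [ring | rewrite e1 mulr0].
- by transitivity (x * (a3 * x ^+ 2 + b3 * (x * y) + g3 * y ^+ 2)); [ring | rewrite e3 mulr0].
- by transitivity (y * (a3 * x ^+ 2 + b3 * (x * y) + g3 * y ^+ 2)); [ring | rewrite e3 mulr0].
move: x3 y3 xy; rewrite !expf_eq0 /= => /eqP -> /eqP ->.
by rewrite eqxx.
Qed.

Lemma opF_compat q c : compat q (poly_op2 c) (opF q c).
Proof.
have [h l] := compat_theta q (diff2 c); split.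
  by move=> f; rewrite -poly_theta_diff2 h; exact: thetaF_diff2.
have [k hk] := l; exists k => A B N hAB i j ij.
by rewrite -!thetaF_diff2; apply: hk hAB i j ij.
Qed.

Lemma generic_dim d1 d3 e1 e3 q :
  (forall f, poly_op2 e1 (poly_op2 d3 f) = poly_op2 e3 (poly_op2 d1 f)) ->
  meval (Defs.coord q) (generic2 X0 X1 d1 d3 e1) != 0 ->
  ~ singular_locus (diff2 d1) (diff2 d3) q /\
  germ_dim q (solution (diff2 d1) (diff2 d3) q) 4.
Proof.
move=> rel; pose ev := meval (Defs.coord q) : {rmorphism K -> C}.
have -> : meval (Defs.coord q) (generic2 X0 X1 d1 d3 e1) =
    generic2 q.1 q.2 (map_op2 ev d1) (map_op2 ev d3) (map_op2 ev e1).
  have := generic2_morph ev X0 X1 d1 d3 e1; rewrite [ev X0]mevalXU [ev X1]mevalXU.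
  exact.
move=> /generic2_neq0[e20' minor' res'].
have ns := nonsingular_resultant res'; split=> //.
have relF A : opF q e1 (opF q d3 A) = opF q e3 (opF q d1 A).
  exact: (compat_transfer (compat_comp (opF_compat q e1) (opF_compat q d3))
    (compat_comp (opF_compat q e3) (opF_compat q d1)) rel A).
have [r r0 gr] := cauchy_estimate ns.
have gr' A : formal_solution (diff2 d1) (diff2 d3) q A -> growth r A.
  by case; apply: gr; split; rewrite subrr cabs0 ltW.
pose ini (k : 'I_4) (A : FS) : C := if k == ord_max then A 0%N 1%N else A k 0%N.
apply: (germ_dim_formal (ini := ini) r0 gr').
- by move=> k a A B; rewrite /ini; case: ifP.
- move=> A [h1 h3] iA.
  have f1 : opF q d1 A = 0 by rewrite -thetaF_diff2.
  have f3 : opF q d3 A = 0 by rewrite -thetaF_diff2.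
  exact (formal_unique (opF_lead q d1) (opF_lead q d3) e20' minor' res' f1 f3
    (iA (@Ordinal 4 0 isT)) (iA (@Ordinal 4 1 isT)) (iA (@Ordinal 4 3 isT)) (iA (@Ordinal 4 2 isT))).
move=> x; have [A [h1 h3 hx hy]] := formal_exists (lin_opF q d1) (lin_opF q d3)
   (opF_lead q d1) (opF_lead q d3) (opF_lead q e1) (opF_lead q e3) relF e20' minor' res'
   (fun i => x (inord i)) (x ord_max).
exists A; first by split; rewrite thetaF_diff2.
move=> k; rewrite /ini; case: eqP => [->|/eqP k3]; first exact: hy.
rewrite hx ?inord_val //; case: k k3 => [[|[|[|[|k]]]]] //= hk.
Qed.

(** The point [pt] only shows that [generic2] is not the zero polynomial. *)
Theorem solution_space_dim_relation d1 d3 e1 e3 pt :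
  (forall f, poly_op2 e1 (poly_op2 d3 f) = poly_op2 e3 (poly_op2 d1 f)) ->
  meval (Defs.coord pt) (generic2 X0 X1 d1 d3 e1) != 0 ->
  solution_space_dim (diff2 d1) (diff2 d3) 4.
Proof.
move=> rel gpt; split; first by exists pt; case: (generic_dim rel gpt).
move=> p ns; have [r r0 gr] := cauchy_estimate ns.
have r4 : 0 < r / 4 by lra.
have [q [q1 q2 gq]] := mpoly_nonroot p r4 gpt.
have [_ dimq] := generic_dim rel gq.
have r43 : 3 * (r / 4) < r by lra.
have gp A : formal_solution (diff2 d1) (diff2 d3) p A -> growth r A.
  by case; apply: gr; split; rewrite subrr cabs0 ltW.
have gq' A : formal_solution (diff2 d1) (diff2 d3) q A -> growth r A.
  by case; apply: gr; split; lra.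
have qp : in_box (r / 4) (q.1 - p.1, q.2 - p.2) by split.
exact (germ_dim_transport r4 r43 qp gp gq' dimq).
Qed.

End Solve.

(** * The four systems and their compatibility relations *)

Section Data.
Variable S : comNzRingType.
Implicit Types (l m t u k a : S).

(** For commuting [t] and [u] this recovers the polynomial notation of the
operators. *)
Definition ev2 (c : op2 S) t u : S :=
  c20 c * t ^+ 2 + c11 c * (t * u) + c02 c * u ^+ 2 + c10 c * t + c01 c * u + c00 c.

(** For each system [j], [d1_j] and [d3_j] are the coefficients of the given
operators, and [e1_j], [e3_j] those of the operators [E1], [E3] for which
[E1 D3 = E3 D1]. The second order parts of [e1_j], [e3_j] are those of
[d1_j], [d3_j], as the vanishing of the symbol of [E1 D3 - E3 D1] suggests; the
lower order parts then solve linear equations. *)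
Definition d1_0 l m := Op2 (1 - 4 * l) (2 - 20 * l) (- (25 * l)) (- (6 * l)) (- (15 * l)) (- (2 * l)).
Definition d3_0 l m := Op2 (4 * l * l - 16 * l * l * l + 25 * m) (- (2 * l * l) - 40 * l * l * l)
  (5 * l * l) (- (24 * l * l * l) - 25 * m) (- (40 * l * l * l)) (- (8 * l * l * l)).
Definition e1_0 l m := Op2 (1 - 4 * l) (2 - 20 * l) (- (25 * l)) (14 * l - 4) (35 * l - 4) (4 - 12 * l).
Definition e3_0 l m := Op2 (4 * l * l - 16 * l * l * l + 25 * m) (- (2 * l * l) - 40 * l * l * l)
  (5 * l * l) (- (8 * l * l * l) - 75 * m) 0 (50 * m).

Definition d1_1 l m := Op2 (- m) 0 l 0 0 0.
Definition d3_1 k a l m := Op2 (k + l) (2 * l) l l l (a * l).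
Definition e1_1 l m := Op2 (- m) 0 l (2 * m) 0 (- m).
Definition e3_1 k a l m := Op2 (k + l) (2 * l) l (- (2 * k) - l) (- l) (k + a * l).

Definition d1_2 l m := Op2 (3 * m) (4 * m) l m 0 0.
Definition d3_2 l m := Op2 (3 * l - m + 81 * l * l) (2 * l + 216 * l * l) (144 * l * l)
  (m + 81 * l * l) (108 * l * l) (18 * l * l).
Definition e1_2 l m := Op2 (3 * m) (4 * m) l (- (9 * m)) (- (8 * m)) (6 * m).
Definition e3_2 l m := Op2 (3 * l - m + 81 * l * l) (2 * l + 216 * l * l) (144 * l * l)
  (3 * m - 6 * l - 81 * l * l) (- (2 * l) - 108 * l * l) (3 * l - 2 * m + 18 * l * l).

Definition d1_3 l m := Op2 (- (9 * m)) (- (12 * m)) (1 - 4 * m) (- (9 * m)) (- (6 * m)) (- (2 * m)).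
Definition d3_3 l m := Op2 (3 + 81 * l + 12 * m) (108 * l + 8 * m - 2) (36 * l)
  (81 * l + 4 * m) (54 * l) (18 * l).
Definition e1_3 l m := Op2 (- (9 * m)) (- (12 * m)) (1 - 4 * m) (- (3 * m)) (- (2 * m)) 0.
Definition e3_3 l m := d3_3 l m.

Lemma ev_d1_0 l m t u : ev2 (d1_0 l m) t u =
  t * (t + 2 * u) - l * (2 * t + 5 * u + 1) * (2 * t + 5 * u + 2).
Proof. by rewrite /ev2 /=; ring. Qed.

Lemma ev_d3_0 l m t u : ev2 (d3_0 l m) t u =
  l ^+ 2 * (4 * t ^+ 2 - 2 * t * u + 5 * u ^+ 2)
  - 8 * l ^+ 3 * (1 + 3 * t + 5 * u + 2 * t ^+ 2 + 5 * t * u)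
  + 25 * m * t * (t - 1).
Proof. by rewrite /ev2 /=; ring. Qed.

Lemma ev_d1_1 l m t u : ev2 (d1_1 l m) t u = l * u ^+ 2 - m * t ^+ 2.
Proof. by rewrite /ev2 /=; ring. Qed.

Lemma ev_d3_1 k a l m t u : ev2 (d3_1 k a l m) t u =
  k * t ^+ 2 + l * (a + t + u + t ^+ 2 + 2 * t * u + u ^+ 2).
Proof. by rewrite /ev2 /=; ring. Qed.

Lemma ev_d1_2 l m t u : ev2 (d1_2 l m) t u = l * u ^+ 2 + m * t * (3 * t + 4 * u + 1).
Proof. by rewrite /ev2 /=; ring. Qed.

Lemma ev_d3_2 l m t u : ev2 (d3_2 l m) t u =
  l * t * (3 * t + 2 * u) + m * t * (1 - t)
  + 9 * l ^+ 2 * (3 * t + 4 * u + 1) * (3 * t + 4 * u + 2).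
Proof. by rewrite /ev2 /=; ring. Qed.

Lemma ev_d1_3 l m t u : ev2 (d1_3 l m) t u =
  u ^+ 2 - m * (3 * t + 2 * u + 1) * (3 * t + 2 * u + 2).
Proof. by rewrite /ev2 /=; ring. Qed.

Lemma ev_d3_3 l m t u : ev2 (d3_3 l m) t u =
  t * (3 * t - 2 * u) + 9 * l * (3 * t + 2 * u + 1) * (3 * t + 2 * u + 2)
  + 4 * m * t * (3 * t + 2 * u + 1).
Proof. by rewrite /ev2 /=; ring. Qed.

End Data.

Section Relations.
Variable K : comNzRingType.
Variables (t0 t1 : K -> K) (l m k a : K).
Hypothesis t0D : forall x y, t0 (x + y) = t0 x + t0 y.
Hypothesis t1D : forall x y, t1 (x + y) = t1 x + t1 y.
Hypothesis t0M : forall x y, t0 (x * y) = t0 x * y + x * t0 y.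
Hypothesis t1M : forall x y, t1 (x * y) = t1 x * y + x * t1 y.
Hypothesis t10 : forall x, t0 (t1 x) = t1 (t0 x).
Hypotheses (t0l : t0 l = l) (t1l : t1 l = 0) (t0m : t0 m = 0) (t1m : t1 m = m).
Hypotheses (t0k : t0 k = 0) (t1k : t1 k = 0) (t0a : t0 a = 0) (t1a : t1 a = 0).

Let t00 : t0 0 = 0. Proof. by apply: (addrI (t0 0)); rewrite -t0D !addr0. Qed.
Let t1_0 : t1 0 = 0. Proof. by apply: (addrI (t1 0)); rewrite -t1D !addr0. Qed.
Let t0N x : t0 (- x) = - t0 x.
Proof. by apply: (addrI (t0 x)); rewrite -t0D !subrr. Qed.
Let t1N x : t1 (- x) = - t1 x.
Proof. by apply: (addrI (t1 x)); rewrite -t1D !subrr. Qed.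
Let t0_1 : t0 1 = 0.
Proof.
have h := t0M 1 1; rewrite !mulr1 mul1r in h.
by apply: (addrI (t0 1)); rewrite -h addr0.
Qed.
Let t1_1 : t1 1 = 0.
Proof.
have h := t1M 1 1; rewrite !mulr1 mul1r in h.
by apply: (addrI (t1 1)); rewrite -h addr0.
Qed.
Let t0n n : t0 n%:R = 0.
Proof. by elim: n => [|n IH]; rewrite ?t00 // -natr1 t0D IH t0_1 addr0. Qed.
Let t1n n : t1 n%:R = 0.
Proof. by elim: n => [|n IH]; rewrite ?t1_0 // -natr1 t1D IH t1_1 addr0. Qed.

Let rules := (t0D, t1D, t0M, t1M, t0N, t1N, t00, t1_0, t0_1, t1_1, t0n, t1n,
  t0l, t1l, t0m, t1m, t0k, t1k, t0a, t1a, t10).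

Local Notation ap c f := (act2 (fun x y : K => x * y) t0 t1 c f).

(** Coefficients of the composite of two operators on the jet below: [t0] and [t1]
are derivations, so moving them across coefficients produces derivatives of
the latter. *)
Definition comp2 (e d : op2 K) : seq K :=
  let: Op2 a b c p q r := d in let: Op2 e20 e11 e02 e10 e01 e00 := e in
  [:: e20 * a; e20 * b + e11 * a; e20 * c + e11 * b + e02 * a; e11 * c + e02 * b; e02 * c;
      e20 * (p + 2 * t0 a) + e11 * t1 a + e10 * a;
      e20 * (q + 2 * t0 b) + e11 * (p + t1 b + t0 a) + e02 * (2 * t1 a) + e10 * b + e01 * a;
      e20 * (2 * t0 c) + e11 * (q + t1 c + t0 b) + e02 * (p + 2 * t1 b) + e10 * c + e01 * b;
      e11 * t0 c + e02 * (q + 2 * t1 c) + e01 * c;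
      e20 * (r + 2 * t0 p + t0 (t0 a)) + e11 * (t1 p + t1 (t0 a)) + e02 * t1 (t1 a) +
        e10 * (p + t0 a) + e01 * t1 a + e00 * a;
      e20 * (2 * t0 q + t0 (t0 b)) + e11 * (r + t1 q + t0 p + t1 (t0 b)) +
        e02 * (2 * t1 p + t1 (t1 b)) + e10 * (q + t0 b) + e01 * (p + t1 b) + e00 * b;
      e20 * t0 (t0 c) + e11 * (t0 q + t1 (t0 c)) + e02 * (r + 2 * t1 q + t1 (t1 c)) +
        e10 * t0 c + e01 * (q + t1 c) + e00 * c;
      e20 * (2 * t0 r + t0 (t0 p)) + e11 * (t1 r + t1 (t0 p)) + e02 * t1 (t1 p) +
        e10 * (r + t0 p) + e01 * t1 p + e00 * p;
      e20 * t0 (t0 q) + e11 * (t0 r + t1 (t0 q)) + e02 * (2 * t1 r + t1 (t1 q)) +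
        e10 * t0 q + e01 * (r + t1 q) + e00 * q;
      e20 * t0 (t0 r) + e11 * t1 (t0 r) + e02 * t1 (t1 r) + e10 * t0 r + e01 * t1 r + e00 * r].

Definition jet4 (f : K) : seq K :=
  [:: t0 (t0 (t0 (t0 f))); t1 (t0 (t0 (t0 f))); t1 (t1 (t0 (t0 f))); t1 (t1 (t1 (t0 f)));
      t1 (t1 (t1 (t1 f))); t0 (t0 (t0 f)); t1 (t0 (t0 f)); t1 (t1 (t0 f)); t1 (t1 (t1 f));
      t0 (t0 f); t1 (t0 f); t1 (t1 f); t0 f; t1 f; f].

Lemma act2_comp e d f : ap e (ap d f) = \sum_(x <- zip (comp2 e d) (jet4 f)) x.1 * x.2.
Proof.
case: e => e20 e11 e02 e10 e01 e00; case: d => da db dc dp dq dr.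
rewrite /act2 /=; rewrite !rules /comp2 /jet4 /= !big_cons big_nil /=.
set f0 := t0 f; set f1 := t1 f; set f00 := t0 f0; set f01 := t1 f0; set f11 := t1 f1.
ring.
Qed.

Lemma act2_comp_eq e d e' d' : comp2 e d = comp2 e' d' ->
  forall f, ap e (ap d f) = ap e' (ap d' f).
Proof. by move=> h f; rewrite !act2_comp h. Qed.

Lemma relation_1 f : ap (e1_1 l m) (ap (d3_1 k a l m) f) = ap (e3_1 k a l m) (ap (d1_1 l m) f).
Proof.
apply: act2_comp_eq; rewrite /comp2 /=; do !congr (_ :: _); rewrite ?rules; ring.
Qed.

Lemma relation_3 f : ap (e1_3 l m) (ap (d3_3 l m) f) = ap (e3_3 l m) (ap (d1_3 l m) f).
Proof.
apply: act2_comp_eq; rewrite /comp2 /=; do !congr (_ :: _); rewrite ?rules; ring.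
Qed.

Lemma relation_2 f : ap (e1_2 l m) (ap (d3_2 l m) f) = ap (e3_2 l m) (ap (d1_2 l m) f).
Proof.
apply: act2_comp_eq; rewrite /comp2 /=; do !congr (_ :: _); rewrite ?rules; ring.
Qed.

Lemma relation_0 f : ap (e1_0 l m) (ap (d3_0 l m) f) = ap (e3_0 l m) (ap (d1_0 l m) f).
Proof.
apply: act2_comp_eq; rewrite /comp2 /=; do !congr (_ :: _); rewrite ?rules; ring.
Qed.

End Relations.

(** * The dimension for the four systems *)

Lemma diff2_ev2 (K : comNzRingType) (c : op2 K) :
  diff2 c = ev2 (map_op2 (mpolyC 2 (R := K)) c) (mpolyX K (mnm1 ord0)) (mpolyX K (mnm1 ord_max)).
Proof. by rewrite /diff2 /ev2 /= !expr2 !mpolyXD mpolyX0 -!mul_mpolyC !mulr1. Qed.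

Lemma leibniz_mul (K : comNzRingType) (x a b c d : K) :
  x * (a * b + c * d) = x * a * b + c * (x * d).
Proof. by ring. Qed.

Lemma mulrAC_swap (K : comNzRingType) (x y a : K) : x * y * a = y * (x * a).
Proof. by ring. Qed.

Section Morph.
Variables (K L : comNzRingType) (f : {rmorphism K -> L}).
Let E := (rmorphD f, rmorphB f, rmorphN f, rmorphM f, rmorph0 f, rmorph1 f, rmorph_nat f).

Lemma map_d1_0 l m : map_op2 f (d1_0 l m) = d1_0 (f l) (f m).
Proof. by rewrite /map_op2 /= !E. Qed.
Lemma map_d3_0 l m : map_op2 f (d3_0 l m) = d3_0 (f l) (f m).
Proof. by rewrite /map_op2 /= !E. Qed.
Lemma map_e1_0 l m : map_op2 f (e1_0 l m) = e1_0 (f l) (f m).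
Proof. by rewrite /map_op2 /= !E. Qed.
Lemma map_d1_1 l m : map_op2 f (d1_1 l m) = d1_1 (f l) (f m).
Proof. by rewrite /map_op2 /= !E. Qed.
Lemma map_d3_1 k a l m : map_op2 f (d3_1 k a l m) = d3_1 (f k) (f a) (f l) (f m).
Proof. by rewrite /map_op2 /= !E. Qed.
Lemma map_e1_1 l m : map_op2 f (e1_1 l m) = e1_1 (f l) (f m).
Proof. by rewrite /map_op2 /= !E. Qed.
Lemma map_d1_2 l m : map_op2 f (d1_2 l m) = d1_2 (f l) (f m).
Proof. by rewrite /map_op2 /= !E. Qed.
Lemma map_d3_2 l m : map_op2 f (d3_2 l m) = d3_2 (f l) (f m).
Proof. by rewrite /map_op2 /= !E. Qed.
Lemma map_e1_2 l m : map_op2 f (e1_2 l m) = e1_2 (f l) (f m).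
Proof. by rewrite /map_op2 /= !E. Qed.
Lemma map_d1_3 l m : map_op2 f (d1_3 l m) = d1_3 (f l) (f m).
Proof. by rewrite /map_op2 /= !E. Qed.
Lemma map_d3_3 l m : map_op2 f (d3_3 l m) = d3_3 (f l) (f m).
Proof. by rewrite /map_op2 /= !E. Qed.
Lemma map_e1_3 l m : map_op2 f (e1_3 l m) = e1_3 (f l) (f m).
Proof. by rewrite /map_op2 /= !E. Qed.
End Morph.

Section Generic11.
Variable F : numFieldType.

(** The factors come from the values of [c20 e1], [minor2] and [resultant2] at
(1, 1), up to signs and grouping. *)
Lemma generic11_0 : generic2 1 1 (d1_0 1 1) (d3_0 1 1) (e1_0 1 1) != 0 :> F.
Proof.
rewrite (_ : generic2 _ _ _ _ _ = 3 * (2 * 570) * (4 * (125 * 1013))); last first.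
  by rewrite /generic2 /minor2 /resultant2 /=; ring.
by rewrite !mulf_neq0 // pnatr_eq0.
Qed.

Lemma generic11_1 : generic2 1 1 (d1_1 1 1) (d3_1 (1 / 27) (2 / 9) 1 1) (e1_1 1 1) != 0 :> F.
Proof.
rewrite (_ : generic2 _ _ _ _ _ = 2 / 27 * (109 / 27)); last first.
  by rewrite /generic2 /minor2 /resultant2 /=; field; rewrite ?pnatr_eq0.
by rewrite !mulf_neq0 ?invr_eq0 ?pnatr_eq0.
Qed.

Lemma generic11_2 : generic2 1 1 (d1_2 1 1) (d3_2 1 1) (e1_2 1 1) != 0 :> F.
Proof.
rewrite (_ : generic2 _ _ _ _ _ = 3 * 358 * (9 * 25 * 29)); last first.
  by rewrite /generic2 /minor2 /resultant2 /=; ring.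
by rewrite !mulf_neq0 // pnatr_eq0.
Qed.

Lemma generic11_3 : generic2 1 1 (d1_3 1 1) (d3_3 1 1) (e1_3 1 1) != 0 :> F.
Proof.
rewrite (_ : generic2 _ _ _ _ _ = 9 * 90 * (4 * 27 * 9 * 13)); last first.
  by rewrite /generic2 /minor2 /resultant2 /=; ring.
by rewrite !mulf_neq0 // pnatr_eq0.
Qed.
End Generic11.

Section Dimension.
Variable R : realType.
Local Notation C := (Cx R).
Local Notation K := (mpoly 2 C).
Local Notation X0 := (mpolyX C (mnm1 ord0)).
Local Notation X1 := (mpolyX C (mnm1 ord_max)).
Local Notation DO := (mpoly 2 K).
Local Notation k27 := (mpolyC 2 (1 / 27 : C)).
Local Notation k29 := (mpolyC 2 (2 / 9 : C)).

Lemma D1_0E : D1_0 R = diff2 (d1_0 X0 X1).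
Proof. by rewrite diff2_ev2 map_d1_0 ev_d1_0. Qed.
Lemma D3_0E : D3_0 R = diff2 (d3_0 X0 X1).
Proof. by rewrite diff2_ev2 map_d3_0 ev_d3_0. Qed.
Lemma D1_1E : D1_1 R = diff2 (d1_1 X0 X1).
Proof. by rewrite diff2_ev2 map_d1_1 ev_d1_1. Qed.
Lemma D3_1E : D3_1 R = diff2 (d3_1 k27 k29 X0 X1).
Proof. by rewrite diff2_ev2 map_d3_1 ev_d3_1. Qed.
Lemma D1_2E : D1_2 R = diff2 (d1_2 X0 X1).
Proof. by rewrite diff2_ev2 map_d1_2 ev_d1_2. Qed.
Lemma D3_2E : D3_2 R = diff2 (d3_2 X0 X1).
Proof. by rewrite diff2_ev2 map_d3_2 ev_d3_2. Qed.
Lemma D1_3E : D1_3 R = diff2 (d1_3 X0 X1).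
Proof. by rewrite diff2_ev2 map_d1_3 ev_d1_3. Qed.
Lemma D3_3E : D3_3 R = diff2 (d3_3 X0 X1).
Proof. by rewrite diff2_ev2 map_d3_3 ev_d3_3. Qed.

Lemma poly_thD i (f g : K) : poly_th i (f + g) = poly_th i f + poly_th i g.
Proof. by rewrite /poly_th mderivD mulrDr. Qed.

Lemma poly_thM i (f g : K) : poly_th i (f * g) = poly_th i f * g + f * poly_th i g.
Proof. by rewrite /poly_th mderivM; exact: (leibniz_mul (_ : K)). Qed.

Lemma poly_thX i j : poly_th i (mpolyX C (mnm1 j)) = if i == j then mpolyX C (mnm1 j) else 0.
Proof.
rewrite /poly_th mderivX mnm1E eq_sym; case: eqP => [->|_]; last by rewrite scale0r mulr0.
rewrite scale1r; apply: etrans (esym (mpolyXD _ _ _)) _.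
by congr mpolyX; apply/mnmP => k; rewrite mnmDE mnmBE subnn addn0.
Qed.

Lemma poly_thC i (a : C) : poly_th i (mpolyC 2 a) = 0.
Proof. by rewrite /poly_th mderivC mulr0. Qed.

Lemma poly_th_comm (f : K) : poly_th ord0 (poly_th ord_max f) = poly_th ord_max (poly_th ord0 f).
Proof.
rewrite poly_th01 /poly_th mderivM mderivX mnm1E /= scale0r mul0r add0r mderiv_comm.
exact: (mulrAC_swap (_ : K)).
Qed.

Let t00 : poly_th ord0 X0 = X0 := poly_thX ord0 ord0.
Let t10 : poly_th ord_max X0 = 0 := poly_thX ord_max ord0.
Let t01 : poly_th ord0 X1 = 0 := poly_thX ord0 ord_max.
Let t11 : poly_th ord_max X1 = X1 := poly_thX ord_max ord_max.

Let ev : {rmorphism K -> C} := meval (Defs.coord ((1, 1) : C * C)).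
Let evX0 : ev X0 = 1. Proof. exact: mevalXU. Qed.
Let evX1 : ev X1 = 1. Proof. exact: mevalXU. Qed.

Lemma dim_0 : solution_space_dim (D1_0 R) (D3_0 R) 4.
Proof.
rewrite D1_0E D3_0E; apply: (@solution_space_dim_relation R _ _ (e1_0 X0 X1) (e3_0 X0 X1) (1, 1)).
  exact: (relation_0 (poly_thD ord0) (poly_thD ord_max) (poly_thM ord0) (poly_thM ord_max)
    poly_th_comm t00 t10 t01 t11).
have -> := generic2_morph ev X0 X1 (d1_0 X0 X1) (d3_0 X0 X1) (e1_0 X0 X1).
by rewrite map_d1_0 map_d3_0 map_e1_0 evX0 evX1 generic11_0.
Qed.

Lemma dim_1 : solution_space_dim (D1_1 R) (D3_1 R) 4.
Proof.
rewrite D1_1E D3_1E; apply: (@solution_space_dim_relation R _ _ (e1_1 X0 X1) (e3_1 k27 k29 X0 X1) (1, 1)).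
  exact: (relation_1 (poly_thD ord0) (poly_thD ord_max) (poly_thM ord0) (poly_thM ord_max)
    poly_th_comm t00 t10 t01 t11 (poly_thC ord0 _) (poly_thC ord_max _) (poly_thC ord0 _) (poly_thC ord_max _)).
have -> := generic2_morph ev X0 X1 (d1_1 X0 X1) (d3_1 k27 k29 X0 X1) (e1_1 X0 X1).
by rewrite map_d1_1 map_d3_1 map_e1_1 evX0 evX1 [ev k27]mevalC [ev k29]mevalC generic11_1.
Qed.

Lemma dim_2 : solution_space_dim (D1_2 R) (D3_2 R) 4.
Proof.
rewrite D1_2E D3_2E; apply: (@solution_space_dim_relation R _ _ (e1_2 X0 X1) (e3_2 X0 X1) (1, 1)).
  exact: (relation_2 (poly_thD ord0) (poly_thD ord_max) (poly_thM ord0) (poly_thM ord_max)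
    poly_th_comm t00 t10 t01 t11).
have -> := generic2_morph ev X0 X1 (d1_2 X0 X1) (d3_2 X0 X1) (e1_2 X0 X1).
by rewrite map_d1_2 map_d3_2 map_e1_2 evX0 evX1 generic11_2.
Qed.

Lemma dim_3 : solution_space_dim (D1_3 R) (D3_3 R) 4.
Proof.
rewrite D1_3E D3_3E; apply: (@solution_space_dim_relation R _ _ (e1_3 X0 X1) (e3_3 X0 X1) (1, 1)).
  exact: (relation_3 (poly_thD ord0) (poly_thD ord_max) (poly_thM ord0) (poly_thM ord_max)
    poly_th_comm t00 t10 t01 t11).
have -> := generic2_morph ev X0 X1 (d1_3 X0 X1) (d3_3 X0 X1) (e1_3 X0 X1).
by rewrite map_d1_3 map_d3_3 map_e1_3 evX0 evX1 generic11_3.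
Qed.

End Dimension.

(** * The period series *)

Lemma bin_le_exp2 n k : ('C(n, k) <= 2 ^ n)%N.
Proof.
elim: n k => [|n IH] [|k]; rewrite ?bin0 ?bin0n ?expn_gt0 //.
by rewrite binS expnS mul2n -addnn leq_add.
Qed.

Lemma fact_add_le N a b : (a + b <= N)%N -> ((a + b)`! <= 2 ^ N * (a`! * b`!))%N.
Proof.
move=> abN; have <- := bin_fact (leq_addr b a); rewrite addKn leq_pmul2r ?muln_gt0 ?fact_gt0 //.
by rewrite (leq_trans (bin_le_exp2 _ _)) // leq_exp2l.
Qed.

(** Four applications of [(a + b)! <= 2 ^ (a + b) a! b!]. *)
Lemma fact_sum5_le a b c d e :
  ((a + b + c + d + e)`! <= 16 ^ (a + b + c + d + e) * (a`! * b`! * c`! * d`! * e`!))%N.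
Proof.
set N := (a + b + c + d + e)%N; pose k := (2 ^ N)%N.
have -> : (16 ^ N = k * k * k * k)%N by rewrite /k -!expnMn.
have h1 : ((a + b)`! <= k * (a`! * b`!))%N by apply: fact_add_le; lia.
have h2 : ((a + b + c)`! <= k * ((a + b)`! * c`!))%N by apply: fact_add_le; lia.
have h3 : ((a + b + c + d)`! <= k * ((a + b + c)`! * d`!))%N by apply: fact_add_le; lia.
have h4 : (N`! <= k * ((a + b + c + d)`! * e`!))%N by apply: fact_add_le; lia.
have m x y z t : (x <= k * (y * z))%N -> (y <= t)%N -> (x <= k * (t * z))%N.
  by move=> h yt; rewrite (leq_trans h) // leq_mul // leq_mul.
have := m _ _ _ _ h4 (m _ _ _ _ h3 (m _ _ _ _ h2 h1)).
by congr (_ <= _)%N; rewrite !mulnA; ring.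
Qed.

Section Eta.
Variable R : realType.
Local Notation C := (Cx R).
Local Notation FS := (FS R).
Implicit Types (a b : nat -> nat -> C).

(** Passage from ordinary Taylor coefficients to derivatives at the origin. *)
Definition seqF a : FS := fun n m => a n m * n`!%:R * m`!%:R.

Lemma psterm_seqF a w n m : psterm (seqF a) w n m = a n m * w.1 ^+ n * w.2 ^+ m.
Proof.
rewrite /psterm /dpow /seqF; have := @factC_neq0 R m; have := @factC_neq0 R n.
by move: (n`!%:R : C) (m`!%:R : C) => x y x0 y0; field; rewrite x0 y0.
Qed.

Lemma growth_seqF a k : (forall n m, cabs (a n m) <= k%:R ^+ (n + m)) -> (0 < k)%N ->
  growth (k%:R^-1) (seqF a).
Proof.
move=> h k0; apply: (@coef_bound_growth R _ 1) => n m.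
rewrite /seqF !cabsM !cabs_nat mul1r natrM exprVn.
rewrite ler_pdivrMr ?exprn_gt0 ?ltr0n // -mulrA [leLHS]mulrC.
by rewrite ler_wpM2l // mulr_ge0 // ler0n.
Qed.

(** In each of the four series the numerator is [N!] where [N] is the sum of the
numbers whose factorials form the denominator, five of them every time. *)
Lemma multinomial_cabs_le (s : C) (N p x y z t w n m : nat) : cabs s = 1 ->
  (x + y + z + t + w)%N = N -> (x`! * y`! * z`! * t`! * w`!)%N = p ->
  (N <= 5 * (n + m))%N ->
  cabs (s * N`!%:R / p%:R) <= (16 ^ 5)%:R ^+ (n + m).
Proof.
move=> s1 <- <- le; rewrite !cabsM cabsV !cabs_nat s1 mul1r ler_pdivrMr; last first.
  by rewrite ltr0n !muln_gt0 !fact_gt0.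
rewrite -natrX -natrM ler_nat; apply: leq_trans (fact_sum5_le _ _ _ _ _) _.
by rewrite leq_mul // -expnM leq_exp2l.
Qed.

Lemma cabs_sign n : cabs ((-1) ^+ n : C) = 1.
Proof. by rewrite cabsX cabsN cabs1 expr1n. Qed.

Lemma coef_0_le n m : cabs (coef_0 R n m) <= (16 ^ 5)%:R ^+ (n + m).
Proof.
apply: (multinomial_cabs_le (x := n) (y := m) (z := m) (t := m) (w := 2 * m + n));
  rewrite ?cabs_sign //; try lia.
Qed.

Lemma coef_1_le n m : cabs (coef_1 R n m) <= (16 ^ 5)%:R ^+ (n + m).
Proof.
apply: (multinomial_cabs_le (x := n) (y := n) (z := m) (t := m) (w := n + m));
  rewrite ?cabs_sign //; try lia.
Qed.

Lemma coef_2_le n m : cabs (coef_2 R n m) <= (16 ^ 5)%:R ^+ (n + m).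
Proof.
apply: (multinomial_cabs_le (x := m) (y := m) (z := n) (t := m + n) (w := m + n));
  rewrite ?cabs_sign //; try lia.
Qed.

Lemma coef_3_le n m : cabs (coef_3 R n m) <= (16 ^ 5)%:R ^+ (n + m).
Proof.
apply: (multinomial_cabs_le (x := n) (y := n) (z := n) (t := m) (w := m));
  rewrite ?cabs_sign //; try lia.
Qed.
End Eta.

Section Recurrences.
Variable R : realType.
Local Notation C := (Cx R).

Lemma natS_neq0 n : (n%:R + 1 : C) != 0.
Proof. by rewrite natr1 pnatr_eq0. Qed.

Lemma coef_0_lambda n m : n.+1%:R * (n.+1%:R + 2 * m%:R) * coef_0 R n.+1 m =
  (2 * n%:R + 5 * m%:R + 1) * (2 * n%:R + 5 * m%:R + 2) * coef_0 R n m.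
Proof.
rewrite /coef_0 (_ : 5 * m + 2 * n.+1 = (5 * m + 2 * n).+2)%N; last lia.
rewrite addnS !factS !(natrX, natrM).
have := @factC_neq0 R n; have := @factC_neq0 R m; have := @factC_neq0 R (2 * m + n).
have := @natS_neq0 n; have := @natS_neq0 (2 * m + n).
move: (n`!%:R : C) (m`!%:R : C) ((2 * m + n)`!%:R : C) ((5 * m + 2 * n)`!%:R : C) => x y z t.
rewrite -!natr1 => h1 h2 z0 y0 x0.
by field; rewrite z0 y0 x0 -(natrM _ 2) -natrD h1 h2.
Qed.

Lemma coef_0_mu n m :
  n.+2%:R * n.+1%:R * (2 * n%:R + 5 * m.+1%:R) * coef_0 R n.+2 m =
  - (m.+1%:R ^+ 3) * coef_0 R n m.+1.
Proof.
rewrite /coef_0 (_ : 5 * m.+1 + 2 * n = (5 * m + 2 * n.+2).+1)%N; last lia.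
rewrite (_ : 2 * m.+1 + n = 2 * m + n.+2)%N; last lia.
rewrite [(-1) ^+ _.+1]exprS !(factS n, factS n.+1, factS m, factS (5 * m + 2 * n.+2)) !(natrX, natrM).
have := @factC_neq0 R n; have := @factC_neq0 R m; have := @factC_neq0 R (2 * m + n.+2).
have := @natS_neq0 n; have := @natS_neq0 n.+1; have := @natS_neq0 m.
rewrite -(natr1 m) -(natr1 n.+1) -(natr1 n) -(natr1 (5 * m + 2 * n.+2)).
move: (n`!%:R : C) (m`!%:R : C) ((2 * m + n.+2)`!%:R : C) ((5 * m + 2 * n.+2)`!%:R : C) => x y z t.
move: ((-1) ^+ m : C) => s.
move=> h1 h2 h3 z0 y0 x0.
by field; rewrite h1 h2 h3 z0 y0 x0.
Qed.

Lemma coef_1_ratio n m :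
  m.+1%:R ^+ 2 * coef_1 R n m.+1 = n.+1%:R ^+ 2 * coef_1 R n.+1 m.
Proof.
rewrite /coef_1 (_ : 3 * n + 3 * m.+1 = 3 * n.+1 + 3 * m)%N; last lia.
rewrite addSnnS addSnnS !factS !(natrX, natrM).
have := @factC_neq0 R n; have := @factC_neq0 R m; have := @factC_neq0 R (n + m.+1).
have := @natS_neq0 n; have := @natS_neq0 m.
move: (n`!%:R : C) (m`!%:R : C) ((n + m.+1)`!%:R : C) ((3 * n.+1 + 3 * m)`!%:R : C) => x y z t.
move: ((-1) ^+ (m + n.+1) : C) => s.
rewrite -!natr1 => h1 h2 z0 y0 x0.
by field; rewrite h1 h2 z0 y0 x0.
Qed.

Lemma coef_1_lambda n m :
  n.+1%:R ^+ 2 * coef_1 R n.+1 m =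
  - 3 * (3 * (n%:R + m%:R) + 1) * (3 * (n%:R + m%:R) + 2) * coef_1 R n m.
Proof.
rewrite /coef_1 (_ : 3 * n.+1 + 3 * m = (3 * n + 3 * m).+3)%N; last lia.
rewrite addnS addSn [(-1) ^+ _.+1]exprS !factS !(natrX, natrM).
have := @factC_neq0 R n; have := @factC_neq0 R m; have := @factC_neq0 R (n + m).
have := @natS_neq0 n; have := @natS_neq0 (n + m).
move: (n`!%:R : C) (m`!%:R : C) ((n + m)`!%:R : C) ((3 * n + 3 * m)`!%:R : C) => x y z t.
move: ((-1) ^+ (m + n) : C) => s.
rewrite -!natr1 => h1 h2 z0 y0 x0.
by field; rewrite -natrD h1 h2 z0 y0 x0.
Qed.

Lemma coef_2_ratio n m :
  m.+1%:R ^+ 2 * coef_2 R n m.+1 =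
  - (n.+1%:R * (3 * n%:R + 4 * m%:R + 4)) * coef_2 R n.+1 m.
Proof.
rewrite /coef_2 (_ : 4 * m.+1 + 3 * n = (4 * m + 3 * n.+1).+1)%N; last lia.
rewrite addSnnS [(-1) ^+ _.+1]exprS (factS m) (factS n) (factS (4 * m + _)) !(natrX, natrM).
have := @factC_neq0 R n; have := @factC_neq0 R m; have := @factC_neq0 R (m + n.+1).
have := @natS_neq0 n; have := @natS_neq0 m.
move: (n`!%:R : C) (m`!%:R : C) ((m + n.+1)`!%:R : C) ((4 * m + 3 * n.+1)`!%:R : C) => x y z t.
move: ((-1) ^+ n : C) => s.
rewrite -!natr1 => h1 h2 z0 y0 x0.
by field; rewrite h1 h2 z0 y0 x0.
Qed.

Lemma coef_2_lambda n m :
  n.+1%:R * (n.+1%:R + m%:R) ^+ 2 * coef_2 R n.+1 m =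
  - ((3 * n%:R + 4 * m%:R + 1) * (3 * n%:R + 4 * m%:R + 2) * (3 * n%:R + 4 * m%:R + 3))
  * coef_2 R n m.
Proof.
rewrite /coef_2 (_ : 4 * m + 3 * n.+1 = (4 * m + 3 * n).+3)%N; last lia.
rewrite addnS [(-1) ^+ _.+1]exprS !factS !(natrX, natrM).
have := @factC_neq0 R n; have := @factC_neq0 R m; have := @factC_neq0 R (m + n).
have := @natS_neq0 n; have := @natS_neq0 (m + n).
move: (n`!%:R : C) (m`!%:R : C) ((m + n)`!%:R : C) ((4 * m + 3 * n)`!%:R : C) => x y z t.
move: ((-1) ^+ n : C) => s.
rewrite -!natr1 => h1 h2 z0 y0 x0.
by field; rewrite -natrD h1 h2 z0 y0 x0.
Qed.

Lemma coef_3_mu n m : m.+1%:R ^+ 2 * coef_3 R n m.+1 =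
  (3 * n%:R + 2 * m%:R + 1) * (3 * n%:R + 2 * m%:R + 2) * coef_3 R n m.
Proof.
rewrite /coef_3 (_ : 3 * n + 2 * m.+1 = (3 * n + 2 * m).+2)%N; last lia.
rewrite !factS !(natrX, natrM).
have := @factC_neq0 R n; have := @factC_neq0 R m; have := @natS_neq0 m.
move: (n`!%:R : C) (m`!%:R : C) ((3 * n + 2 * m)`!%:R : C) => x y t.
move: ((-1) ^+ n : C) => s.
rewrite -!natr1 => h1 y0 x0.
by field; rewrite h1 y0 x0.
Qed.

Lemma coef_3_lambda n m : n.+1%:R ^+ 3 * coef_3 R n.+1 m =
  - ((3 * n%:R + 2 * m%:R + 1) * (3 * n%:R + 2 * m%:R + 2) * (3 * n%:R + 2 * m%:R + 3))
  * coef_3 R n m.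
Proof.
rewrite /coef_3 (_ : 3 * n.+1 + 2 * m = (3 * n + 2 * m).+3)%N; last lia.
rewrite [(-1) ^+ _.+1]exprS !factS !(natrX, natrM).
have := @factC_neq0 R n; have := @factC_neq0 R m; have := @natS_neq0 n.
move: (n`!%:R : C) (m`!%:R : C) ((3 * n + 2 * m)`!%:R : C) => x y t.
move: ((-1) ^+ n : C) => s.
rewrite -!natr1 => h1 y0 x0.
by field; rewrite h1 y0 x0.
Qed.

End Recurrences.

Lemma eq0_comb1 (F : fieldType) (k c e x y : F) :
  k != 0 -> x = y -> k * e = c * (x - y) -> e = 0.
Proof. by move=> k0 -> h; apply: (mulfI k0); rewrite h subrr !mulr0. Qed.

(** [k] is the common factor by which the equation has to be multiplied to become
a combination of the two recurrences. *)
Lemma eq0_comb2 (F : fieldType) (k c c' e x y x' y' : F) :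
  k != 0 -> x = y -> x' = y' -> k * e = c * (x - y) + c' * (x' - y') -> e = 0.
Proof. by move=> k0 -> -> h; apply: (mulfI k0); rewrite h !subrr !mulr0 addr0. Qed.

Section SequenceAction.
Variable R : realType.
Local Notation C := (Cx R).
Local Notation FS := (FS R).
Implicit Types (a b : nat -> nat -> C).

Definition shift_lambda b n m : C := if n is k.+1 then b k m else 0.
Definition shift_mu b n m : C := if m is k.+1 then b n k else 0.

Lemma seqF0 b : (forall n m, b n m = 0) -> seqF b = 0.
Proof. by move=> h; apply: FSP => n m; rewrite /seqF h !mul0r. Qed.

Lemma seqFD a b : seqF a + seqF b = seqF (fun n m => a n m + b n m).
Proof. by apply: FSP => n m; rewrite addFE /seqF !mulrDl. Qed.

Lemma seqFZ c b : c *: seqF b = seqF (fun n m => c * b n m).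
Proof. by apply: FSP => n m; rewrite scaleFE /seqF !mulrA. Qed.

Lemma xF0_seqF b : xF (0, 0) ord0 (seqF b) = seqF (shift_lambda b).
Proof.
apply: FSP => -[|n] m; rewrite /xF addFE scaleFE /wF /seqF /Defs.coord /= !mul0r ?addr0 // add0r.
by rewrite factS natrM; ring.
Qed.

Lemma xF1_seqF b : xF (0, 0) ord_max (seqF b) = seqF (shift_mu b).
Proof.
apply: FSP => n -[|m]; rewrite /xF addFE scaleFE /wF /seqF /Defs.coord /= !mul0r ?addr0 // add0r.
by rewrite factS natrM; ring.
Qed.

Lemma thF0_seqF b : thF (0, 0) ord0 (seqF b) = seqF (fun n m => n%:R * b n m).
Proof.
apply: FSP => -[|n] m; rewrite /thF /xF addFE scaleFE /wF /dF /seqF /Defs.coord /= !mul0r ?addr0 // add0r.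
by ring.
Qed.

Lemma thF1_seqF b : thF (0, 0) ord_max (seqF b) = seqF (fun n m => m%:R * b n m).
Proof.
apply: FSP => n -[|m]; rewrite /thF /xF addFE scaleFE /wF /dF /seqF /Defs.coord /= !mul0r ?addr0 // add0r.
by ring.
Qed.

Variables (S : comNzRingType) (mulc : S -> FS -> FS) (t0 t1 : FS -> FS) (l m k a : S).
Hypothesis mulD : forall x y A, mulc (x + y) A = mulc x A + mulc y A.
Hypothesis mulM : forall x y A, mulc (x * y) A = mulc x (mulc y A).
Hypothesis mul1 : forall A, mulc 1 A = A.
Hypothesis mul_l : forall b, mulc l (seqF b) = seqF (shift_lambda b).
Hypothesis mul_m : forall b, mulc m (seqF b) = seqF (shift_mu b).
Hypothesis mul_k : forall A, mulc k A = (1 / 27) *: A.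
Hypothesis mul_a : forall A, mulc a A = (2 / 9) *: A.
Hypothesis t0E : forall b, t0 (seqF b) = seqF (fun n m => n%:R * b n m).
Hypothesis t1E : forall b, t1 (seqF b) = seqF (fun n m => m%:R * b n m).

Let mul0 A : mulc 0 A = 0.
Proof. by apply: (addrI (mulc 0 A)); rewrite -mulD !addr0. Qed.
Let muln x A : mulc x%:R A = x%:R *: A.
Proof.
elim: x => [|x IH]; first by rewrite mul0 scale0r.
by rewrite -!natr1 mulD mul1 IH scalerDl scale1r.
Qed.
Let mul_neg x A : mulc (- x) A = - mulc x A.
Proof. by apply: (addrI (mulc x A)); rewrite -mulD !subrr mul0. Qed.
Let seqFN b : - seqF b = seqF (fun n m => - b n m).
Proof. by rewrite -scaleN1r seqFZ; apply: FSP => n p; rewrite /seqF mulN1r. Qed.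

Let E := (t0E, t1E, mulD, mul_neg, mulM, muln, mul1, mul0, mul_k, mul_a, mul_l, mul_m, seqFZ, seqFN, seqFD, addr0).

Local Notation ann c f := (act2 mulc t0 t1 c (seqF f) = 0).

Lemma annihilates_d1_0 : ann (d1_0 l m) (coef_0 R).
Proof.
rewrite /act2 /= !E; apply: seqF0 => -[|i] j /=; first by ring.
by apply: (eq0_comb1 (k := 1) (c := 1) _ (coef_0_lambda R i j)); rewrite ?oner_neq0 //; ring.
Qed.

Lemma annihilates_d3_0 : ann (d3_0 l m) (coef_0 R).
Proof.
rewrite /act2 /= !E; apply: seqF0 => -[|[|[|i]]] [|j] /=; try by ring.
- by apply: (eq0_comb1 (k := j.+1%:R) (c := 5) _ (coef_0_mu R 0 j)); rewrite ?pnatr_eq0 //; ring.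
- by apply: (eq0_comb1 (k := 1) (c := 4) _ (coef_0_lambda R i 0)); rewrite ?oner_neq0 //; ring.
by apply: (eq0_comb2 (k := (2 * i.+1 + 5 * j.+1)%:R) (c := 8 * i.+1%:R) (c' := 25) _
  (coef_0_lambda R i j.+1) (coef_0_mu R i.+1 j)); rewrite ?pnatr_eq0 //; ring.
Qed.

Lemma annihilates_d1_1 : ann (d1_1 l m) (coef_1 R).
Proof.
rewrite /act2 /= !E; apply: seqF0 => -[|i] [|j] /=; try by ring.
by apply: (eq0_comb1 (k := 1) (c := 1) _ (coef_1_ratio R i j)); rewrite ?oner_neq0 //; ring.
Qed.

Lemma annihilates_d3_1 : ann (d3_1 k a l m) (coef_1 R).
Proof.
rewrite /act2 /= !E; apply: seqF0 => -[|i] j /=; first by ring.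
apply: (eq0_comb1 (k := 1) (c := 1 / 27) _ (coef_1_lambda R i j)); rewrite ?oner_neq0 //.
by field; rewrite ?pnatr_eq0.
Qed.

Lemma annihilates_d1_2 : ann (d1_2 l m) (coef_2 R).
Proof.
rewrite /act2 /= !E; apply: seqF0 => -[|i] [|j] /=; try by ring.
by apply: (eq0_comb1 (k := 1) (c := 1) _ (coef_2_ratio R i j)); rewrite ?oner_neq0 //; ring.
Qed.

Lemma annihilates_d3_2 : ann (d3_2 l m) (coef_2 R).
Proof.
rewrite /act2 /= !E; apply: seqF0 => -[|[|i]] [|j] /=; try by ring.
- by apply: (eq0_comb1 (k := (3 * i.+1)%:R) (c := 9) _ (coef_2_lambda R i 0));
    rewrite ?pnatr_eq0 //; ring.
by apply: (eq0_comb2 (k := (3 * i.+1 + 4 * j.+1)%:R) (c := 9) (c' := - i.+1%:R) _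
  (coef_2_lambda R i j.+1) (coef_2_ratio R i.+1 j)); rewrite ?pnatr_eq0 //; ring.
Qed.

Lemma annihilates_d1_3 : ann (d1_3 l m) (coef_3 R).
Proof.
rewrite /act2 /= !E; apply: seqF0 => i [|j] /=; first by ring.
by apply: (eq0_comb1 (k := 1) (c := 1) _ (coef_3_mu R i j)); rewrite ?oner_neq0 //; ring.
Qed.

Lemma annihilates_d3_3 : ann (d3_3 l m) (coef_3 R).
Proof.
rewrite /act2 /= !E; apply: seqF0 => -[|i] [|j] /=; try by ring.
- by apply: (eq0_comb1 (k := (3 * i.+1)%:R) (c := 9) _ (coef_3_lambda R i 0));
    rewrite ?pnatr_eq0 //; ring.
by apply: (eq0_comb2 (k := (3 * i.+1 + 2 * j.+1)%:R) (c := 9) (c' := - (4 * i.+1%:R)) _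
  (coef_3_lambda R i j.+1) (coef_3_mu R i.+1 j)); rewrite ?pnatr_eq0 //; ring.
Qed.
End SequenceAction.

Section EtaSolution.
Variable R : realType.
Local Notation C := (Cx R).
Local Notation FS := (FS R).
Local Notation K := (mpoly 2 C).
Local Notation X0 := (mpolyX C (mnm1 ord0)).
Local Notation X1 := (mpolyX C (mnm1 ord_max)).
Local Notation k27 := (mpolyC 2 (1 / 27 : C)).
Local Notation k29 := (mpolyC 2 (2 / 9 : C)).
Implicit Types (a : nat -> nat -> C).

Let mul_l b : mulF (0, 0) X0 (seqF b) = seqF (shift_lambda b).
Proof. by rewrite -[X0]mulr1 mulF_X mulF1 xF0_seqF. Qed.
Let mul_m b : mulF (0, 0) X1 (seqF b) = seqF (shift_mu b).
Proof. by rewrite -[X1]mulr1 mulF_X mulF1 xF1_seqF. Qed.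
Let mulD := @mulFD R (0, 0).
Let mulM := @mulF_M R (0, 0).
Let mul1 := @mulF1 R (0, 0).

Definition period a z : C := (2 * (pi%:C)%C * 'i) ^+ 2 *
  lim ((fun N => \sum_(n < N) \sum_(m < N) a n m * z.1 ^+ n * z.2 ^+ m) @ \oo).

Lemma solution_seqF (D1 D3 : diffop R) a k : (0 < k)%N ->
  (forall n m, cabs (a n m) <= k%:R ^+ (n + m)) ->
  thetaF (0, 0) D1 (seqF a) = 0 -> thetaF (0, 0) D3 (seqF a) = 0 ->
  solution D1 D3 (0, 0) (period a).
Proof.
move=> k0 ha h1 h3; pose c : C := (2 * (pi%:C)%C * 'i) ^+ 2.
have r0 : 0 < (k%:R^-1 : R) by rewrite invr_gt0 ltr0n.
have rA := repZ c (@rep_psum R (0, 0) _ _ (growth_seqF ha k0)).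
apply: (formal_rep_solution r0 (A := c *: seqF a)).
  apply: rep_ext rA => z; apply: (congr1 (fun f : nat -> C => c * lim (f @ \oo))); apply/funext => N.
  rewrite /rect_sum; apply: eq_bigr => n _; apply: eq_bigr => m _.
  by rewrite psterm_seqF !subr0.
by split; rewrite (linZ (lin_thetaF _ _)) ?h1 ?h3 scaler0.
Qed.

Let mul_k := @mulF_C R (0, 0) (1 / 27).
Let mul_a := @mulF_C R (0, 0) (2 / 9).
Let th0 := @thF0_seqF R.
Let th1 := @thF1_seqF R.

Lemma eta_solution_0 : solution (D1_0 R) (D3_0 R) (0, 0) (period (@coef_0 R)).
Proof.
apply: (solution_seqF _ (@coef_0_le R)); first by rewrite expn_gt0.
  by rewrite D1_0E thetaF_diff2; exact: (annihilates_d1_0 _ mulD mulM mul1 mul_l th0 th1).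
by rewrite D3_0E thetaF_diff2; exact: (annihilates_d3_0 mulD mulM mul1 mul_l mul_m th0 th1).
Qed.

Lemma eta_solution_1 : solution (D1_1 R) (D3_1 R) (0, 0) (period (@coef_1 R)).
Proof.
apply: (solution_seqF _ (@coef_1_le R)); first by rewrite expn_gt0.
  by rewrite D1_1E thetaF_diff2; exact: (annihilates_d1_1 mulD mul_l mul_m th0 th1).
by rewrite D3_1E thetaF_diff2; exact: (annihilates_d3_1 _ mulD mulM mul1 mul_l mul_k mul_a th0 th1).
Qed.

Lemma eta_solution_2 : solution (D1_2 R) (D3_2 R) (0, 0) (period (@coef_2 R)).
Proof.
apply: (solution_seqF _ (@coef_2_le R)); first by rewrite expn_gt0.
  by rewrite D1_2E thetaF_diff2; exact: (annihilates_d1_2 mulD mulM mul1 mul_l mul_m th0 th1).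
by rewrite D3_2E thetaF_diff2; exact: (annihilates_d3_2 mulD mulM mul1 mul_l mul_m th0 th1).
Qed.

Lemma eta_solution_3 : solution (D1_3 R) (D3_3 R) (0, 0) (period (@coef_3 R)).
Proof.
apply: (solution_seqF _ (@coef_3_le R)); first by rewrite expn_gt0.
  by rewrite D1_3E thetaF_diff2; exact: (annihilates_d1_3 _ mulD mulM mul1 mul_m th0 th1).
by rewrite D3_3E thetaF_diff2; exact: (annihilates_d3_3 mulD mulM mul1 mul_l mul_m th0 th1).
Qed.

End EtaSolution.

Theorem theorem4p1 (R : realType) (j : 'I_4) :
  solution (D1 R j) (D3 R j) (0%R, 0%R) (@eta R j) /\
  solution_space_dim (D1 R j) (D3 R j) 4.
Proof.
case: j => [[|[|[|[|j]]]] lt_j4] //.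
- split; [exact: eta_solution_0 | exact: dim_0].
- split; [exact: eta_solution_1 | exact: dim_1].
- split; [exact: eta_solution_2 | exact: dim_2].
split; [exact: eta_solution_3 | exact: dim_3].
Qed.
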